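(* Let $\varphi:\Gamma\to\mathbb{C}$ be continuous, and let $$w(x)=\int_\Gamma \frac{\partial \Phi(x,y)}{\partial\tilde\nu(y)}\,\varphi(y)\,ds_y,\qquad x\in\mathbb{R}^2\setminus\Gamma,$$ be the double layer potential with density $\varphi$. Then $w$ can be continuously extended from $\Omega$ to $\bar\Omega$ and from $\mathbb{R}^2\setminus\bar\Omega$ to $\mathbb{R}^2\setminus\Omega$, respectively, with the limiting values $$w_\pm(x)=\int_\Gamma \frac{\partial \Phi(x,y)}{\partial\tilde\nu(y)}\,\varphi(y)\,ds_y\pm\frac12\varphi(x),\qquad x\in\Gamma,$$ where $w_\pm(x)=\lim_{h>0,\,h\to0} w(x\pm h\nu(x))$.
   Context: Let $k_0>0$ be the free-space wavenumber and let $\varepsilon_1,\varepsilon_2\in\mathbb{C}$ be constants with $\mathrm{Re}\,\varepsilon_1\cdot\mathrm{Re}\,\varepsilon_2<0$ and $\mathrm{Im}\,\varepsilon_j>0$ for $j=1,2$ (lossy hyperbolic medium). Put $A=\mathrm{diag}(1/\varepsilon_1,1/\varepsilon_2)$. The square root $\sqrt z=|z|^{1/2}e^{\frac12 i\arg z}$ is the analytic branch on $\mathbb{C}\setminus\{-it: t\ge0\}$, i.e. $\arg z\in(-\pi/2,3\pi/2)$. Set $$\tilde r(x,y)=\sqrt{(x-y)^TA^{-1}(x-y)}=\sqrt{\varepsilon_1(x_1-y_1)^2+\varepsilon_2(x_2-y_2)^2},$$ $$\Phi(x,y)=\frac{i}{4}\sqrt{\varepsilon_1\varepsilon_2}\,H_0^{(1)}(k_0\tilde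 r(x,y)),\qquad x\ne y,$$ where $H_0^{(1)}$ is the Hankel function of the first kind of order zero. $\Phi$ is the outgoing fundamental solution of $\nabla\cdot(A\nabla u)+k_0^2u=0$. $\Omega\subset\mathbb{R}^2$ is a bounded simply connected domain with boundary $\Gamma$ of class $C^2$; $\nu$ is the unit normal on $\Gamma$ pointing out of $\Omega$; $\tilde\nu=A\nu$; and $\frac{\partial f}{\partial\tilde\nu}=\nabla f\cdot\tilde\nu$, with the bilinear dot product (no complex conjugation). $\frac{\partial\Phi(x,y)}{\partial\tilde\nu(y)}=\nabla_y\Phi(x,y)\cdot\tilde\nu(y)$, and $ds$ is arc length on $\Gamma$. *)

(* Defs.v *)
From Stdlib Require Import Reals Factorial.
From Coquelicot Require Import Coquelicot.
Open Scope R_scope.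

Notation R2 := (R * R)%type.

(** * Complex functions *)

(** Half-angle formula [tan (theta / 2) = sin theta / (1 + cos theta)]; this is
    the principal argument, in [(-PI, PI)], off the half-line [x <= 0], [y = 0]
    (on which the value is meaningless). *)
Definition Carg (z : C) : R := 2 * atan (Im z / (Cmod z + Re z)).

(** The argument in [(-PI/2, 3PI/2)], off the half-line [{-it : t >= 0}]. *)
Definition Carg_cut (z : C) : R := PI / 2 + Carg (z / Ci).

Definition Csqrt (z : C) : C :=
  (RtoC (sqrt (Cmod z)) * (cos (Carg_cut z / 2), sin (Carg_cut z / 2)))%C.

Definition Clog (z : C) : C := (ln (Cmod z), Carg z).

Definition CSeries (a : nat -> C) : C :=
  (Series (fun k => Re (a k)), Series (fun k => Im (a k))).

Definition harmonic (n : nat) : R := sum_n_m (fun k => / INR k) 1 n.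

Definition Euler_gamma : R :=
  real (Lim_seq (fun n => harmonic n - ln (INR n))).

Definition bessel_J0 (z : C) : C :=
  CSeries (fun k =>
    RtoC ((-1) ^ k / (INR (fact k)) ^ 2) * (z * z / RtoC 4) ^ k)%C.

Definition bessel_Y0 (z : C) : C :=
  (RtoC (2 / PI) *
   ((Clog (z / RtoC 2) + RtoC Euler_gamma) * bessel_J0 z
    - CSeries (fun k =>
        RtoC ((-1) ^ k * harmonic k / (INR (fact k)) ^ 2)
        * (z * z / RtoC 4) ^ k)))%C.

Definition hankel_H0 (z : C) : C := (bessel_J0 z + Ci * bessel_Y0 z)%C.

(** * The fundamental solution and its conormal derivative *)

Section Medium.
Variables (k0 : R) (eps1 eps2 : C).

Definition rtilde (x y : R2) : C :=
  Csqrt (eps1 * RtoC (fst x - fst y) ^ 2 + eps2 * RtoC (snd x - snd y) ^ 2)%C.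

Definition Phi (x y : R2) : C :=
  (Ci / RtoC 4 * Csqrt (eps1 * eps2) * hankel_H0 (RtoC k0 * rtilde x y))%C.

(** [A v], where [A = diag (1 / eps1, 1 / eps2)]. *)
Definition mulA (v : R2) : C * C :=
  ((RtoC (fst v) / eps1)%C, (RtoC (snd v) / eps2)%C).

End Medium.

(** Derivative of a complex-valued function of a real variable. *)
Definition CDerive (f : R -> C) (t : R) : C :=
  (Derive (fun s => Re (f s)) t, Derive (fun s => Im (f s)) t).

Definition grad (f : R2 -> C) (y : R2) : C * C :=
  (CDerive (fun s => f (s, snd y)) (fst y),
   CDerive (fun s => f (fst y, s)) (snd y)).

Definition bilinear_dot (u v : C * C) : C :=
  (fst u * fst v + snd u * snd v)%C.

(** [n] is the value at [y] of the unit normal [nu]. *)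
Definition dPhi_conormal (k0 : R) (eps1 eps2 : C) (x y n : R2) : C :=
  bilinear_dot (grad (fun y' => Phi k0 eps1 eps2 x y') y) (mulA eps1 eps2 n).

(** * Plane domains *)

Definition compl (D : R2 -> Prop) (x : R2) : Prop := ~ D x.

Definition closure (D : R2 -> Prop) (x : R2) : Prop :=
  forall P : R2 -> Prop, locally x P -> exists y, P y /\ D y.

Definition boundary (D : R2 -> Prop) (x : R2) : Prop :=
  closure D x /\ closure (compl D) x.

Definition bounded_set (D : R2 -> Prop) : Prop :=
  exists M : R, forall x, D x -> Rabs (fst x) <= M /\ Rabs (snd x) <= M.

Definition connected_set (D : R2 -> Prop) : Prop :=
  forall U V : R2 -> Prop, open U -> open V ->
    (forall x, D x -> U x \/ V x) ->
    (exists x, D x /\ U x) -> (exists x, D x /\ V x) ->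
    exists x, D x /\ U x /\ V x.

Definition plane_domain (D : R2 -> Prop) : Prop :=
  open D /\ connected_set D /\ exists x, D x.

(** Every loop is null-homotopic in [D].  Paths and homotopies on [[0,1]] and
    [[0,1]^2] are represented by globally continuous maps, which is no
    restriction since one may extend them by clamping the parameters. *)
Definition simply_connected (D : R2 -> Prop) : Prop :=
  forall p : R -> R2,
    (forall t, continuous p t) ->
    (forall t, 0 <= t <= 1 -> D (p t)) ->
    p 0 = p 1 ->
    exists H : R2 -> R2,
      (forall st, continuous H st) /\
      (forall s t, 0 <= s <= 1 -> 0 <= t <= 1 -> D (H (s, t))) /\
      (forall t, 0 <= t <= 1 -> H (0, t) = p t) /\
      (forall t, 0 <= t <= 1 -> H (1, t) = p 0) /\
      (forall s, 0 <= s <= 1 -> H (s, 0) = p 0 /\ H (s, 1) = p 0).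

(** * Closed curves of class C^2 *)

Definition C2 (f : R -> R) : Prop :=
  forall t, ex_derive f t /\ ex_derive (Derive f) t /\
            continuous (Derive (Derive f)) t.

Definition tangent (gamma : R -> R2) (t : R) : R2 :=
  (Derive (fun s => fst (gamma s)) t, Derive (fun s => snd (gamma s)) t).

Definition norm2 (v : R2) : R := sqrt (fst v ^ 2 + snd v ^ 2).

(** [Gamma] is a simple closed curve of class C^2, and [gamma] is a regular
    [T]-periodic C^2 parametrization of it. *)
Definition C2_closed_curve (Gamma : R2 -> Prop) (gamma : R -> R2) (T : R)
    : Prop :=
  0 < T /\
  (forall t, gamma (t + T) = gamma t) /\
  (forall s t, 0 <= s < T -> 0 <= t < T -> gamma s = gamma t -> s = t) /\
  C2 (fun t => fst (gamma t)) /\ C2 (fun t => snd (gamma t)) /\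
  (forall t, tangent gamma t <> (0, 0)) /\
  (forall x, Gamma x <-> exists t, x = gamma t).

(** [x + h n] *)
Definition shift (x : R2) (h : R) (n : R2) : R2 :=
  (fst x + h * fst n, snd x + h * snd n).

Definition outward_unit_normal (Omega : R2 -> Prop) (gamma : R -> R2)
    (nu : R2 -> R2) : Prop :=
  forall t,
    let x := gamma t in
    norm2 (nu x) = 1 /\
    fst (nu x) * fst (tangent gamma t) + snd (nu x) * snd (tangent gamma t) = 0
    /\
    exists delta : R, 0 < delta /\
      forall h, 0 < h < delta ->
        Omega (shift x (- h) (nu x)) /\ ~ closure Omega (shift x h (nu x)).

(** * Integration with respect to arc length *)

Definition arc_integrand (gamma : R -> R2) (f : R2 -> C) (t : R) : C :=
  (f (gamma t) * RtoC (norm2 (tangent gamma t)))%C.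

Definition arc_integrable (gamma : R -> R2) (T : R) (f : R2 -> C) : Prop :=
  ex_RInt (V := C_R_NormedModule) (arc_integrand gamma f) 0 T.

Definition arc_integral (gamma : R -> R2) (T : R) (f : R2 -> C) : C :=
  RInt (V := C_R_CompleteNormedModule) (arc_integrand gamma f) 0 T.

(** For [x] on the curve, the integrand is meaningless at the single point
    [y = x]; this affects neither integrability nor the integral. *)
Definition dlp_integrand (k0 : R) (eps1 eps2 : C) (nu : R2 -> R2)
    (phi : R2 -> C) (x y : R2) : C :=
  (dPhi_conormal k0 eps1 eps2 x y (nu y) * phi y)%C.

Definition dlp (k0 : R) (eps1 eps2 : C) (gamma : R -> R2) (T : R)
    (nu : R2 -> R2) (phi : R2 -> C) (x : R2) : C :=
  arc_integral gamma T (dlp_integrand k0 eps1 eps2 nu phi x).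

(* Main.v *)
(** With [v = y - x] and [q(v) = eps1 v1^2 + eps2 v2^2], which lies in the open
    upper half-plane for [v <> 0], the conormal derivative of [Phi] is
    [(v . nu(y)) (kappa / q(v) + M(v))], where
    [kappa = - sqrt (eps1 eps2) / (2 PI)] and [|v| |M(v)| -> 0] as [v -> 0].
    Let [x] approach [x0 = gamma t0] from one side, and write
    [x = gamma ts + h n(ts)] with [gamma ts] the point of the curve nearest to
    [x]; the sign of [h] tells the side, since the segment from [x] to
    [gamma ts] does not meet the curve elsewhere.  Away from [x0] the integrand
    converges uniformly.  On a short arc around [x0] it is bounded by a multiple
    of [1 + |h| / (h^2 + (t - ts)^2)], whose integral is bounded uniformly in
    [h], so the density may be frozen at [x0] and [M] dropped.  What remains is
    the static integral, for which [q(v) = eps1 (v1 + rho v2) (v1 - rho v2)]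
    yields a primitive that is a difference of two logarithms; their arguments
    turn by [PI] and [- PI], and the limit is [+- 1/2].  This is local, so no
    Jordan curve theorem is needed. *)

From Stdlib Require Import ZArith Factorial Lra Lia Psatz Classical ClassicalEpsilon.
Require Import Defs.
From Stdlib Require Import Reals.
From Coquelicot Require Import Coquelicot.
Open Scope R_scope.

(** The sign of the jump is a question of branches. Replacing [Csqrt (eps1 * eps2)] by its negative
    flips both [kappa] and [rho], so the constant [kappa / (rho * eps1)] does not see the branch;
    only the half-plane containing [rho] decides which of the two logarithms gains [PI]. The
    opposite signs of [Re eps1] and [Re eps2], together with the cut along the negative imaginary
    axis, put [rho] in the upper one. The Hankel function is handled as a function of the square:
    both Bessel series are power series in it, and in the upper half-plane the logarithm of the root
    is half a logarithm, so the root is never differentiated. The losses give a lower bound for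
    [q(v)] by a multiple of the squared length of [v] although its real part is indefinite. A
    continuous extension requires limits along every approach, not only along the normal. The normal
    is given pointwise, so the constancy of its sign against the rotated tangent has to be derived:
    a parallel curve close to the boundary cannot change sides. Continuity of the extension along
    the curve is drawn from the one-sided limits alone. *)

Local Notation RV := R_NormedModule.
Local Notation CV := C_R_NormedModule.
Local Notation CCV := C_R_CompleteNormedModule.

Ltac Cmod_triangle_le := eapply Rle_trans; [apply Cmod_triangle|].
Ltac Cmod_triangle_lt := eapply Rle_lt_trans; [apply Cmod_triangle|].

(** * Componentwise calculus of complex-valued functions *)

Definition Ccontinuous {U : UniformSpace} (f : U -> C) (p : U) : Prop :=
  continuous (fun q => Re (f q)) p /\ continuous (fun q => Im (f q)) p.

Definition is_Cderive (f : R -> C) (t : R) (l : C) : Prop :=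
  is_derive (fun s => Re (f s)) t (Re l) /\
  is_derive (fun s => Im (f s)) t (Im l).

Lemma Rabs_diag_le (t e : R) : 0 <= e -> Rabs (t - t) <= e.
Proof. rewrite Rminus_diag, Rabs_R0. auto. Qed.

Lemma lt_Rmin (a b c : R) : a < Rmin b c -> a < b /\ a < c.
Proof. pose proof (Rmin_l b c). pose proof (Rmin_r b c). lra. Qed.

Lemma le_Rmin (a b c : R) : a <= Rmin b c -> a <= b /\ a <= c.
Proof. pose proof (Rmin_l b c). pose proof (Rmin_r b c). lra. Qed.

Lemma Cmod_le_Re_Im (z : C) : Cmod z <= Rabs (Re z) + Rabs (Im z).
Proof.
  pose proof (Cmod_triangle (RtoC (Re z)) (Ci * RtoC (Im z))%C) as H.
  rewrite Cmod_mult, Cmod_Ci, !Cmod_R in H.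
  replace (RtoC (Re z) + Ci * RtoC (Im z))%C with z in H; [lra|].
  destruct z; unfold Cplus, Cmult, Ci, RtoC, Re, Im; simpl; f_equal; ring.
Qed.

Lemma Rabs_Im_le_Cmod (z : C) : Rabs (Im z) <= Cmod z.
Proof. eapply Rle_trans; [apply Rmax_r | apply (Rmax_Cmod z)]. Qed.

Lemma Cmod_minus_sym (z w : C) : Cmod (z - w) = Cmod (w - z).
Proof. rewrite <- Cmod_opp. f_equal. ring. Qed.

Lemma Cmod_sqr (z : C) : Cmod z * Cmod z = Re z * Re z + Im z * Im z.
Proof. pose proof (Cmod2_alt z). nra. Qed.

(** The balls of the product structure on [C] are squares; a square of half the radius fits into a
    disc. *)
Lemma locally_Cmod (z : C) (P : C -> Prop) :
  locally z P <-> exists d, 0 < d /\ forall w, Cmod (w - z) < d -> P w.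
Proof.
  split.
  - intros [d Hd]. exists d. split; [apply cond_pos|].
    intros w Hw. apply Hd. split.
    + eapply Rle_lt_trans; [|exact Hw]. apply (re_le_Cmod (w - z)).
    + eapply Rle_lt_trans; [|exact Hw]. apply (Rabs_Im_le_Cmod (w - z)).
  - intros [d [Hd H]]. assert (Hd2 : 0 < d / 2) by lra.
    exists (mkposreal _ Hd2). intros w [Hw1 Hw2]. apply H.
    eapply Rle_lt_trans; [apply Cmod_le_Re_Im|].
    change (Rabs (fst w - fst z) < d / 2) in Hw1.
    change (Rabs (snd w - snd z) < d / 2) in Hw2.
    change (Rabs (fst w - fst z) + Rabs (snd w - snd z) < d). lra.
Qed.

Lemma Ccontinuous_iff {U : UniformSpace} (f : U -> C) (p : U) :
  continuous f p <-> Ccontinuous f p.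
Proof.
  split.
  - intros H. split; apply continuous_comp with (g := fst) || 
      apply continuous_comp with (g := snd); try exact H;
      [apply continuous_fst | apply continuous_snd].
  - intros [H1 H2]. intros P [e He].
    assert (A1 := H1 _ (locally_ball (T := R_UniformSpace) _ e)).
    assert (A2 := H2 _ (locally_ball (T := R_UniformSpace) _ e)).
    unfold filtermap in *.
    generalize (filter_and _ _ A1 A2). apply filter_imp.
    intros q [B1 B2]. apply He. split; assumption.
Qed.

Lemma Ccontinuous_Cmod {U : UniformSpace} (f : U -> C) (p : U) :
  Ccontinuous f p ->
  forall e, 0 < e -> locally p (fun q => Cmod (f q - f p) < e).
Proof.
  intros H e He. apply Ccontinuous_iff in H.
  apply (H (fun w => Cmod (w - f p) < e)).
  apply locally_Cmod. exists e. auto.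
Qed.

Lemma Ccontinuous_of_Cmod {U : UniformSpace} (f : U -> C) (p : U) :
  (forall e, 0 < e -> locally p (fun q => Cmod (f q - f p) < e)) ->
  Ccontinuous f p.
Proof.
  intros H. apply Ccontinuous_iff. intros P HP.
  apply locally_Cmod in HP. destruct HP as [d [Hd HP]].
  generalize (H d Hd). unfold filtermap. apply filter_imp. intros q. apply HP.
Qed.

Lemma Ccontinuous_const {U : UniformSpace} (c : C) (p : U) :
  Ccontinuous (fun _ => c) p.
Proof. split; apply continuous_const. Qed.

Lemma Ccontinuous_RtoC {U : UniformSpace} (f : U -> R) (p : U) :
  continuous f p -> Ccontinuous (fun q => RtoC (f q)) p.
Proof. intros H. split; [exact H | apply continuous_const]. Qed.

Lemma Ccontinuous_plus {U : UniformSpace} (f g : U -> C) (p : U) :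
  Ccontinuous f p -> Ccontinuous g p -> Ccontinuous (fun q => f q + g q)%C p.
Proof.
  intros [F1 F2] [G1 G2]; split.
  - exact (continuous_plus (V := RV) _ _ _ F1 G1).
  - exact (continuous_plus (V := RV) _ _ _ F2 G2).
Qed.

Lemma Ccontinuous_minus {U : UniformSpace} (f g : U -> C) (p : U) :
  Ccontinuous f p -> Ccontinuous g p -> Ccontinuous (fun q => f q - g q)%C p.
Proof.
  intros [F1 F2] [G1 G2]; split.
  - exact (continuous_minus (V := RV) _ _ _ F1 G1).
  - exact (continuous_minus (V := RV) _ _ _ F2 G2).
Qed.

Lemma Ccontinuous_mult {U : UniformSpace} (f g : U -> C) (p : U) :
  Ccontinuous f p -> Ccontinuous g p -> Ccontinuous (fun q => f q * g q)%C p.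
Proof.
  intros [F1 F2] [G1 G2]; split.
  - exact (continuous_minus (V := RV) _ _ _
      (continuous_mult (K := R_AbsRing) _ _ _ F1 G1)
      (continuous_mult (K := R_AbsRing) _ _ _ F2 G2)).
  - exact (continuous_plus (V := RV) _ _ _
      (continuous_mult (K := R_AbsRing) _ _ _ F1 G2)
      (continuous_mult (K := R_AbsRing) _ _ _ F2 G1)).
Qed.

Lemma continuous_Rinv_comp {U : UniformSpace} (f : U -> R) (p : U) :
  continuous f p -> f p <> 0 -> continuous (fun q => / f q) p.
Proof. intros H H0. apply continuous_comp; [exact H|]. apply continuous_Rinv; exact H0. Qed.

Lemma Ccontinuous_inv {U : UniformSpace} (f : U -> C) (p : U) :
  Ccontinuous f p -> f p <> 0 -> Ccontinuous (fun q => / f q)%C p.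
Proof.
  intros [F1 F2] H0.
  assert (HD : continuous (fun q => / (Re (f q) ^ 2 + Im (f q) ^ 2)) p).
  { apply continuous_Rinv_comp.
    - apply (continuous_plus (V := RV)).
      + apply (continuous_comp (fun q => Re (f q)) (fun x => x ^ 2)); [exact F1|].
        apply (ex_derive_continuous (K := R_AbsRing) (V := RV)).
        auto_derive; auto.
      + apply (continuous_comp (fun q => Im (f q)) (fun x => x ^ 2)); [exact F2|].
        apply (ex_derive_continuous (K := R_AbsRing) (V := RV)).
        auto_derive; auto.
    - rewrite <- Cmod2_alt. apply pow_nonzero. apply Cmod_gt_0 in H0. lra. }
  split.
  - exact (continuous_mult (K := R_AbsRing) _ _ _ F1 HD).
  - refine (continuous_mult (K := R_AbsRing) _ _ _ _ HD).
    exact (continuous_opp (V := RV) _ _ F2).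
Qed.

Lemma Ccontinuous_div {U : UniformSpace} (f g : U -> C) (p : U) :
  Ccontinuous f p -> Ccontinuous g p -> g p <> 0 ->
  Ccontinuous (fun q => f q / g q)%C p.
Proof.
  intros F G H. apply Ccontinuous_mult; [exact F|]. apply Ccontinuous_inv; auto.
Qed.

Lemma Ccontinuous_comp {U V : UniformSpace} (f : U -> V) (g : V -> C) (p : U) :
  continuous f p -> Ccontinuous g (f p) -> Ccontinuous (fun q => g (f q)) p.
Proof.
  intros Hf [G1 G2]; split;
    [apply (continuous_comp f (fun z => Re (g z))) |
     apply (continuous_comp f (fun z => Im (g z)))]; assumption.
Qed.

Lemma Ccontinuous_comp_C {U : UniformSpace} (f : U -> C) (g : C -> C) (p : U) :
  Ccontinuous f p -> Ccontinuous g (f p) -> Ccontinuous (fun q => g (f q)) p.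
Proof.
  intros Hf Hg. apply Ccontinuous_comp; [apply Ccontinuous_iff|]; assumption.
Qed.

Lemma Ccontinuous_ext_loc {U : UniformSpace} (f g : U -> C) (p : U) :
  locally p (fun q => f q = g q) -> Ccontinuous f p -> Ccontinuous g p.
Proof.
  intros H [F1 F2]. split.
  - apply continuous_ext_loc with (fun q => Re (f q)); [|exact F1].
    revert H. apply filter_imp. intros q ->; reflexivity.
  - apply continuous_ext_loc with (fun q => Im (f q)); [|exact F2].
    revert H. apply filter_imp. intros q ->; reflexivity.
Qed.

Lemma continuous_Cmod {U : UniformSpace} (f : U -> C) (p : U) :
  Ccontinuous f p -> continuous (fun q => Cmod (f q)) p.
Proof.
  intros H. apply filterlim_locally. intros e.
  generalize (Ccontinuous_Cmod f p H e (cond_pos e)). apply filter_imp.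
  intros q Hq. change (Rabs (Cmod (f q) - Cmod (f p)) < e).
  apply Rabs_def1.
  - pose proof (Cmod_triangle (f q - f p) (f p)).
    replace (f q - f p + f p)%C with (f q) in H0 by ring. lra.
  - pose proof (Cmod_triangle (f p - f q) (f q)).
    replace (f p - f q + f q)%C with (f p) in H0 by ring.
    rewrite Cmod_minus_sym in H0. lra.
Qed.

Lemma is_Cderive_ext_loc (f g : R -> C) (t : R) (l : C) :
  locally t (fun s => f s = g s) -> is_Cderive f t l -> is_Cderive g t l.
Proof.
  intros H [F1 F2]. split.
  - apply is_derive_ext_loc with (fun q => Re (f q)); [|exact F1].
    revert H. apply filter_imp. intros q ->; reflexivity.
  - apply is_derive_ext_loc with (fun q => Im (f q)); [|exact F2].
    revert H. apply filter_imp. intros q ->; reflexivity.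
Qed.

Lemma is_Cderive_eq (f : R -> C) (t : R) (l m : C) :
  is_Cderive f t l -> l = m -> is_Cderive f t m.
Proof. intros H <-; exact H. Qed.

Lemma is_Cderive_unique (f : R -> C) (t : R) (l : C) :
  is_Cderive f t l -> CDerive f t = l.
Proof.
  intros [H1 H2]. unfold CDerive.
  rewrite (surjective_pairing l).
  f_equal; apply is_derive_unique; assumption.
Qed.

Lemma is_Cderive_continuous (f : R -> C) (t : R) (l : C) :
  is_Cderive f t l -> Ccontinuous f t.
Proof.
  intros [H1 H2]; split;
    apply (ex_derive_continuous (K := R_AbsRing) (V := RV));
    eexists; eassumption.
Qed.

Lemma is_Cderive_const (c : C) (t : R) : is_Cderive (fun _ => c) t 0.
Proof. split; apply (is_derive_const (V := RV)). Qed.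

Lemma is_Cderive_RtoC (f : R -> R) (t l : R) :
  is_derive f t l -> is_Cderive (fun s => RtoC (f s)) t (RtoC l).
Proof. intros H. split; [exact H | exact (is_derive_const (V := RV) 0 t)]. Qed.

Lemma is_Cderive_plus (f g : R -> C) (t : R) (a b : C) :
  is_Cderive f t a -> is_Cderive g t b ->
  is_Cderive (fun s => f s + g s)%C t (a + b)%C.
Proof.
  intros [F1 F2] [G1 G2]; split.
  - exact (is_derive_plus (V := RV) _ _ _ _ _ F1 G1).
  - exact (is_derive_plus (V := RV) _ _ _ _ _ F2 G2).
Qed.

Lemma is_Cderive_minus (f g : R -> C) (t : R) (a b : C) :
  is_Cderive f t a -> is_Cderive g t b ->
  is_Cderive (fun s => f s - g s)%C t (a - b)%C.
Proof.
  intros [F1 F2] [G1 G2]; split.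
  - exact (is_derive_minus (V := RV) _ _ _ _ _ F1 G1).
  - exact (is_derive_minus (V := RV) _ _ _ _ _ F2 G2).
Qed.

Lemma is_Cderive_mult (f g : R -> C) (t : R) (a b : C) :
  is_Cderive f t a -> is_Cderive g t b ->
  is_Cderive (fun s => f s * g s)%C t (a * g t + f t * b)%C.
Proof.
  intros [F1 F2] [G1 G2]; split.
  - evar_last.
    + exact (is_derive_minus (V := RV) _ _ _ _ _
        (Derive.is_derive_mult _ _ _ _ _ F1 G1)
        (Derive.is_derive_mult _ _ _ _ _ F2 G2)).
    + unfold minus, plus, opp, Cplus, Cmult, Re, Im; simpl; ring.
  - evar_last.
    + exact (is_derive_plus (V := RV) _ _ _ _ _
        (Derive.is_derive_mult _ _ _ _ _ F1 G2)
        (Derive.is_derive_mult _ _ _ _ _ F2 G1)).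
    + unfold minus, plus, opp, Cplus, Cmult, Re, Im; simpl; ring.
Qed.

Lemma is_Cderive_scal (c : C) (f : R -> C) (t : R) (a : C) :
  is_Cderive f t a -> is_Cderive (fun s => c * f s)%C t (c * a)%C.
Proof.
  intros H. eapply is_Cderive_eq.
  - apply is_Cderive_mult; [apply is_Cderive_const | exact H].
  - cbv beta. ring.
Qed.

(** * The logarithm and the square root *)

(** The plane without the closed negative half-line, written as positivity of the denominator in the
    half-angle formula of [Carg]. *)
Definition slit (z : C) : Prop := 0 < Cmod z + Re z.

Lemma slit_iff (z : C) : slit z <-> ~ (Im z = 0 /\ Re z <= 0).
Proof.
  unfold slit. pose proof (Cmod_sqr z) as Hs. pose proof (Cmod_ge_0 z) as Hp.
  split.
  - intros H [H1 H2]. nra.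
  - intros H. destruct (Rlt_or_le 0 (Cmod z + Re z)) as [|Hle]; [assumption|].
    exfalso. apply H. split; nra.
Qed.

Lemma slit_Im (z : C) : Im z <> 0 -> slit z.
Proof. intros H. apply slit_iff. tauto. Qed.

Lemma slit_Re (z : C) : 0 < Re z -> slit z.
Proof. intros H. apply slit_iff. lra. Qed.

Lemma slit_Cmod (z : C) : slit z -> 0 < Cmod z.
Proof.
  unfold slit. pose proof (re_le_Cmod z). pose proof (Cmod_ge_0 z).
  intros H1. destruct (Rle_lt_or_eq_dec 0 (Cmod z)) as [|E]; auto.
  rewrite <- E in *. revert H. unfold Rabs. destruct (Rcase_abs _); lra.
Qed.

Lemma continuous_of_derive (f : R -> R) (x l : R) : is_derive f x l -> continuous f x.
Proof.
  intros H. apply (ex_derive_continuous (K := R_AbsRing) (V := RV)).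
  eexists; eassumption.
Qed.

Lemma Ccontinuous_Clog (z : C) : slit z -> Ccontinuous Clog z.
Proof.
  intros Hz.
  assert (Hid : Ccontinuous (fun w : C => w) z).
  { apply Ccontinuous_iff. apply continuous_id. }
  assert (Hm : continuous (fun w : C => Cmod w) z) by (apply continuous_Cmod, Hid).
  split; simpl.
  - apply (continuous_comp (fun w : C => Cmod w) ln); [exact Hm|].
    apply continuous_of_derive with (/ Cmod z). apply is_derive_ln, slit_Cmod, Hz.
  - unfold Carg.
    apply (continuous_mult (K := R_AbsRing)); [apply continuous_const|].
    apply (continuous_comp (fun w : C => Im w / (Cmod w + Re w)) atan).
    + apply (continuous_mult (K := R_AbsRing)); [apply Hid|].
      apply continuous_Rinv_comp.
      * apply (continuous_plus (V := RV)); [exact Hm | apply Hid].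
      * unfold slit in Hz. lra.
    + eapply continuous_of_derive. apply is_derive_atan.
Qed.

Lemma is_Cderive_Clog (f : R -> C) (t : R) (l : C) :
  slit (f t) -> is_Cderive f t l ->
  is_Cderive (fun s => Clog (f s)) t (l / f t)%C.
Proof.
  intros Hs [H1 H2].
  assert (Hm := slit_Cmod _ Hs).
  assert (Hr : 0 < Re (f t) ^ 2 + Im (f t) ^ 2).
  { rewrite <- Cmod2_alt. nra. }
  assert (Hsq := Cmod_sqr (f t)).
  assert (HC : is_derive (fun s => Cmod (f s)) t
            ((Re (f t) * Re l + Im (f t) * Im l) / Cmod (f t))).
  { unfold Cmod. evar_last.
    - apply is_derive_sqrt; [|exact Hr].
      apply (is_derive_plus (V := RV));
        [exact (is_derive_pow _ 2 _ _ H1) | exact (is_derive_pow _ 2 _ _ H2)].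
    - unfold plus; simpl. unfold Re, Im. field. unfold Cmod in Hm; simpl in Hm. lra. }
  set (x := Re (f t)) in *. set (y := Im (f t)) in *. set (m := Cmod (f t)) in *.
  assert (Hd : 0 < m + x) by exact Hs.
  assert (Hxy : m * m = x ^ 2 + y ^ 2) by nra.
  split.
  - evar_last.
    + apply (is_derive_comp (K := R_AbsRing) (V := RV) ln); [|exact HC]. apply is_derive_ln. exact Hm.
    + unfold scal; simpl; unfold mult; simpl.
      change (fst (f t)) with x. change (snd (f t)) with y. fold m.
      change (fst l) with (Re l). change (snd l) with (Im l). field_simplify; try lra.
      * replace (m ^ 2) with (x^2+y^2) by (rewrite <- Hxy; ring). field. lra.
  - unfold Clog, Carg. simpl. evar_last.
    + apply is_derive_scal.
      apply (is_derive_comp (K := R_AbsRing) (V := RV) atan).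
      * apply is_derive_atan.
      * apply is_derive_div; [exact H2| |fold m; fold x; lra].
        apply (is_derive_plus (V := RV)); [exact HC | exact H1].
    + unfold scal, plus; simpl; unfold mult; simpl.
      change (fst (f t)) with x. change (snd (f t)) with y. fold m x y.
      change (fst l) with (Re l). change (snd l) with (Im l).
      unfold Rsqr.
      transitivity ((x * Im l - y * Re l) / (x ^ 2 + y ^ 2)).
      2:{ field. lra. }
      (* Since [m * m = x ^ 2 + y ^ 2], the sum [(m + x) ^ 2 + y ^ 2] collapses to
         [2 * m * (m + x)]; this makes the derivative of the arctangent rational. *)
      assert (E : 1 + y / (m + x) * (y / (m + x)) = 2 * m / (m + x)).
      { replace (1 + y / (m + x) * (y / (m + x))) with (((m+x)^2 + y^2) / (m+x)^2) by (field; lra).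
        replace ((m + x) ^ 2 + y ^ 2) with (2 * m * (m + x))
        by (replace (y ^ 2) with (m * m - x ^ 2) by lra; ring). field. lra. }
      rewrite E, <- Hxy.
      assert (Ey : y ^ 2 = m * m - x ^ 2) by lra.
      field_simplify_eq; [|lra]. ring [Ey].
Qed.

Lemma Carg_bound (z : C) : - PI < Carg z < PI.
Proof. unfold Carg. pose proof (atan_bound (Im z / (Cmod z + Re z))). lra. Qed.

(** With [u = tan (Carg z / 2)], the double-angle formulas give the cosine and sine as rational
    functions of [u], and [1 + u * u = 2 * m / (m + x)] simplifies them. *)
Lemma Carg_sin_cos (z : C) :
  slit z -> Cmod z * cos (Carg z) = Re z /\ Cmod z * sin (Carg z) = Im z.
Proof.
  intros Hz. assert (Hm := slit_Cmod _ Hz). assert (Hd : 0 < Cmod z + Re z) by exact Hz.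
  assert (Hsq := Cmod_sqr z).
  unfold Carg.
  set (x := Re z) in *. set (y := Im z) in *. set (m := Cmod z) in *.
  set (u := y / (m + x)).
  assert (Hu : 1 + u * u = 2 * m / (m + x)).
  { unfold u.
    replace (1 + y / (m + x) * (y / (m + x))) with (((m + x) ^ 2 + y * y) / (m + x) ^ 2)
      by (field; lra).
    replace ((m + x) ^ 2 + y * y) with (2 * m * (m + x)).
    - field. lra.
    - replace (y * y) with (m * m - x * x) by lra. ring. }
  assert (Hp : 0 < 1 + u * u) by nra.
  assert (Hs : sqrt (1 + u²) * sqrt (1 + u²) = 2 * m / (m + x)).
  { rewrite sqrt_sqrt; [exact Hu | unfold Rsqr; lra]. }
  assert (Hs0 : 0 < sqrt (1 + u²)) by (apply sqrt_lt_R0; unfold Rsqr; lra).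
  set (w := sqrt (1 + u²)) in *.
  assert (Hw : / w * / w = (m + x) / (2 * m)).
  { rewrite <- Rinv_mult, Hs. field. lra. }
  assert (Hyy : y ^ 2 = m ^ 2 - x ^ 2) by (simpl; lra).
  rewrite cos_2a, sin_2a, sin_atan, cos_atan. fold w. split.
  - replace (1 / w * (1 / w) - u / w * (u / w)) with ((1 - u * u) * (/ w * / w))
      by (field; lra).
    rewrite Hw. unfold u. field_simplify_eq; [|lra]. ring [Hyy].
  - replace (2 * (u / w) * (1 / w)) with (2 * u * (/ w * / w)) by (field; lra).
    rewrite Hw. unfold u. field. lra.
Qed.

Lemma Cmod_polar (r a : R) : 0 <= r -> Cmod (r * cos a, r * sin a) = r.
Proof.
  intros Hr. unfold Cmod; simpl.
  replace (_ + _) with (r * r).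
  - apply sqrt_square, Hr.
  - pose proof (sin2_cos2 a) as H. unfold Rsqr in H.
    transitivity (r * r * (sin a * sin a + cos a * cos a)); [rewrite H|]; ring.
Qed.

Lemma Carg_polar (r a : R) :
  0 < r -> - PI < a < PI -> Carg (r * cos a, r * sin a) = a.
Proof.
  intros Hr Ha. unfold Carg. rewrite Cmod_polar by lra. simpl.
  assert (Hc : 0 < cos (a / 2)) by (apply cos_gt_0; lra).
  replace (r * sin a / (r + r * cos a)) with (tan (a / 2)).
  - rewrite atan_tan; lra.
  - replace (sin a) with (2 * sin (a / 2) * cos (a / 2))
      by (rewrite <- sin_2a; f_equal; field).
    replace (cos a) with (2 * cos (a / 2) * cos (a / 2) - 1)
      by (rewrite <- cos_2a_cos; f_equal; field).
    unfold tan. set (c := cos (a / 2)) in *.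
    replace (r + r * (2 * c * c - 1)) with (2 * r * c * c) by ring. field. lra.
Qed.

Lemma Carg_Re_pos (z : C) : 0 < Re z -> - (PI / 2) < Carg z < PI / 2.
Proof.
  intros H. destruct (Carg_sin_cos z (slit_Re _ H)) as [Hc _].
  pose proof (Carg_bound z). pose proof (Cmod_ge_0 z).
  split; apply Rnot_le_lt; intros Hle.
  - assert (cos (Carg z) <= 0).
    { rewrite <- cos_neg. apply cos_le_0; lra. }
    nra.
  - assert (cos (Carg z) <= 0) by (apply cos_le_0; lra). nra.
Qed.

Lemma Cdiv_Ci (z : C) : (z / Ci)%C = (Im z, - Re z).
Proof.
  destruct z as [x y].
  unfold Cdiv, Cmult, Cinv, Ci, Re, Im; simpl; f_equal; field.
Qed.

Lemma Cmod_div_Ci (z : C) : Cmod (z / Ci) = Cmod z.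
Proof.
  rewrite Cdiv_Ci. unfold Cmod, Re, Im; simpl. f_equal. ring.
Qed.

Lemma Carg_cut_sin_cos (z : C) :
  slit (z / Ci) ->
  Cmod z * cos (Carg_cut z) = Re z /\ Cmod z * sin (Carg_cut z) = Im z.
Proof.
  intros Hz. destruct (Carg_sin_cos _ Hz) as [H1 H2].
  rewrite Cmod_div_Ci in *. unfold Carg_cut.
  rewrite cos_plus, sin_plus, sin_PI2, cos_PI2.
  rewrite Cdiv_Ci in *.
  change (Re (Im z, - Re z)) with (Im z) in H1.
  change (Im (Im z, - Re z)) with (- Re z) in H2. lra.
Qed.

Lemma Csqrt_polar (z : C) :
  Csqrt z = (sqrt (Cmod z) * cos (Carg_cut z / 2), sqrt (Cmod z) * sin (Carg_cut z / 2)).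
Proof. unfold Csqrt, Cmult, RtoC; simpl. f_equal; ring. Qed.

Lemma Csqrt_sqr (z : C) : slit (z / Ci) -> (Csqrt z * Csqrt z)%C = z.
Proof.
  intros Hz. destruct (Carg_cut_sin_cos _ Hz) as [H1 H2].
  rewrite Csqrt_polar.
  assert (Hs := sqrt_sqrt _ (Cmod_ge_0 z)).
  set (w := sqrt (Cmod z)) in *.
  replace (Carg_cut z) with (2 * (Carg_cut z / 2)) in H1, H2 by field.
  rewrite cos_2a in H1. rewrite sin_2a in H2.
  rewrite <- Hs in H1, H2. clearbody w. set (a := Carg_cut z / 2) in *. clearbody a.
  transitivity (Re z, Im z); [|destruct z; reflexivity].
  unfold Cmult; cbn [fst snd]. f_equal; [rewrite <- H1 | rewrite <- H2]; ring.
Qed.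

(** Half of [Carg_cut z] lies between [- PI / 4] and [3 * PI / 4], so the sine of that half plus
    [PI / 4] is positive. This inequality is what later identifies the branch of the root of
    [eps1 * eps2]. *)
Lemma Csqrt_half_plane (z : C) :
  slit (z / Ci) -> 0 < Re (Csqrt z) + Im (Csqrt z).
Proof.
  intros Hz. rewrite Csqrt_polar. simpl.
  assert (Hm := slit_Cmod _ Hz). rewrite Cmod_div_Ci in Hm.
  apply sqrt_lt_R0 in Hm. pose proof (Carg_bound (z / Ci)%C) as Hb.
  unfold Carg_cut. set (a := (PI / 2 + Carg (z / Ci)) / 2).
  assert (Hs : 0 < sin (a + PI / 4)).
  { apply sin_gt_0; unfold a; lra. }
  rewrite sin_plus, cos_PI4, sin_PI4 in Hs.
  assert (0 < / sqrt 2) by (apply Rinv_0_lt_compat, sqrt_lt_R0; lra).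
  unfold Rdiv in Hs. rewrite Rmult_1_l in Hs. nra.
Qed.

Lemma Clog_scal (r : R) (z : C) :
  0 < r -> z <> 0 -> Clog (RtoC r * z)%C = (RtoC (ln r) + Clog z)%C.
Proof.
  intros Hr Hz. apply Cmod_gt_0 in Hz. unfold Clog.
  assert (Hm : Cmod (RtoC r * z) = r * Cmod z).
  { rewrite Cmod_mult, Cmod_R, Rabs_pos_eq; lra. }
  unfold Cplus; simpl. f_equal.
  - rewrite Hm. apply ln_mult; lra.
  - rewrite Rplus_0_l. unfold Carg. rewrite Hm. do 2 f_equal.
    unfold Cmult, RtoC, Re, Im; simpl. rewrite !Rmult_0_l, Rminus_0_r, Rplus_0_r.
    rewrite <- Rmult_plus_distr_l. unfold Rdiv. rewrite Rinv_mult.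
    rewrite <- Rmult_assoc. f_equal. field. lra.
Qed.

(** For [z] in the upper half-plane the root has its argument between [0] and [PI / 2], well inside
    the range of the principal logarithm, so halving the argument meets no branch. The bracket on
    the right is the logarithm of [z] with its cut along the negative imaginary axis. *)
Lemma Clog_Csqrt (c : R) (z : C) :
  0 < c -> 0 < Im z ->
  Clog (RtoC c * Csqrt z)%C =
  (RtoC (ln c) + RtoC (/ 2) * (Clog (z / Ci) + Ci * RtoC (PI / 2)))%C.
Proof.
  intros Hc Hz.
  assert (Hre : 0 < Re (z / Ci)) by (rewrite Cdiv_Ci; exact Hz).
  assert (Hm := slit_Cmod _ (slit_Re _ Hre)).
  assert (Ha := Carg_Re_pos _ Hre).
  assert (Hmz := Hm). rewrite Cmod_div_Ci in Hmz.
  assert (Hq := sqrt_lt_R0 _ Hmz).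
  assert (Hp : Csqrt z <> 0).
  { apply Cmod_gt_0. rewrite Csqrt_polar, Cmod_polar; lra. }
  rewrite Clog_scal by assumption. f_equal.
  unfold Clog. rewrite Csqrt_polar, Cmod_polar, Carg_polar, Cmod_div_Ci;
    [|lra|unfold Carg_cut; lra|lra].
  unfold Carg_cut, Cmult, Cplus, RtoC, Ci; simpl. f_equal.
  - rewrite <- (sqrt_sqrt _ (Cmod_ge_0 z)) at 2. rewrite ln_mult by lra. field.
  - field.
Qed.

(** From [(m + x) * (m - x) = y * y], the half-angle tangents of [u] and [- u] are [t] and [- / t]
    with [t > 0], and [atan t + atan (/ t) = PI / 2]. *)
Lemma Carg_opp (u : C) : 0 < Im u -> Carg u - Carg (- u) = PI.
Proof.
  intros Hu. unfold Carg. rewrite Cmod_opp. simpl.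
  change (fst u) with (Re u). change (snd u) with (Im u).
  assert (Hs := Cmod_sqr u). assert (Hp := Cmod_ge_0 u).
  set (x := Re u) in *. set (y := Im u) in *. set (m := Cmod u) in *.
  assert (0 < m + x) by nra. assert (0 < m - x) by nra.
  replace (- y / (m + - x)) with (- (/ (y / (m + x)))).
  - rewrite atan_opp, atan_inv; [field|]. apply Rdiv_lt_0_compat; assumption.
  - rewrite Rinv_div. replace (m + - x) with (y * y / (m + x)).
    + field. lra.
    + field_simplify_eq; [|lra]. nra.
Qed.

Lemma Clog_opp_pos (u : C) :
  0 < Im u -> (Clog u - Clog (- u))%C = (Ci * RtoC PI)%C.
Proof.
  intros Hu. unfold Clog. rewrite Cmod_opp.
  unfold Cminus, Cplus, Copp, Cmult, RtoC, Ci; simpl. f_equal; [ring|].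
  pose proof (Carg_opp u Hu) as H. unfold Copp in H. lra.
Qed.

Lemma Clog_opp_neg (u : C) :
  Im u < 0 -> (Clog u - Clog (- u))%C = (- (Ci * RtoC PI))%C.
Proof.
  intros Hu. rewrite <- (Clog_opp_pos (- u)%C).
  - replace (- - u)%C with u by ring. ring.
  - simpl. unfold Im in Hu. lra.
Qed.

(** * Entire power series *)

(** A linear-remainder form in the modulus, needed to compose a complex Taylor estimate with a
    function of a real variable. *)
Lemma is_Cderive_iff (f : R -> C) (t : R) (l : C) :
  is_Cderive f t l <->
  forall e, 0 < e -> exists d, 0 < d /\ forall s, Rabs (s - t) < d ->
    Cmod (f s - f t - RtoC (s - t) * l) <= e * Rabs (s - t).
Proof.
  split.
  - intros [H1 H2] e He. apply is_derive_Reals in H1. apply is_derive_Reals in H2.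
    destruct (H1 (e / 2)) as [d1 D1]; [lra|].
    destruct (H2 (e / 2)) as [d2 D2]; [lra|].
    exists (Rmin d1 d2). split; [apply Rmin_pos; apply cond_pos|].
    intros s Hs.
    destruct (lt_Rmin _ _ _ Hs) as [S1 S2].
    destruct (Req_dec (s - t) 0) as [E|N].
    + replace s with t by lra. rewrite Rminus_diag.
      replace (f t - f t - RtoC 0 * l)%C with (RtoC 0) by ring.
      rewrite Cmod_0, Rabs_R0. lra.
    + specialize (D1 _ N S1). specialize (D2 _ N S2).
      replace (t + (s - t)) with s in * by ring.
      eapply Rle_trans; [apply Cmod_le_Re_Im|].
      assert (Q : forall u v, Rabs (u / (s - t) - v) < e / 2 ->
                 Rabs (u - (s - t) * v) <= e / 2 * Rabs (s - t)).
      { intros u v Huv. replace (u - (s - t) * v) with ((u / (s - t) - v) * (s - t))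
          by (field; exact N).
        rewrite Rabs_mult. apply Rmult_le_compat_r; [apply Rabs_pos | lra]. }
      apply Q in D1. apply Q in D2.
      replace (Re (f s - f t - RtoC (s - t) * l)) with
        (Re (f s) - Re (f t) - (s - t) * Re l) by (unfold Re; simpl; ring).
      replace (Im (f s - f t - RtoC (s - t) * l)) with
        (Im (f s) - Im (f t) - (s - t) * Im l) by (unfold Im; simpl; ring).
      lra.
  - intros H.
    assert (Q : forall (F : R -> R) (m : R),
      (forall s, Rabs (F s - F t - (s - t) * m) <= Cmod (f s - f t - RtoC (s - t) * l)) ->
      is_derive F t m).
    { intros F m HF. apply is_derive_Reals. intros e He.
      destruct (H (e / 2)) as [del [Hdel D]]; [lra|].
      exists (mkposreal del Hdel). intros h Hh0 Hh. simpl in Hh.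
      specialize (D (t + h)). specialize (HF (t + h)).
      replace (t + h - t) with h in D, HF by ring. specialize (D Hh).
      assert (Hp := Rabs_pos_lt _ Hh0).
      replace ((F (t + h) - F t) / h - m) with ((F (t + h) - F t - h * m) / h) by (field; exact Hh0).
      unfold Rdiv. rewrite Rabs_mult, Rabs_inv.
      apply (Rmult_lt_reg_r (Rabs h)); [exact Hp|].
      rewrite Rmult_assoc, Rinv_l by lra. nra. }
    split; apply Q; intros s.
    + eapply Rle_trans; [|apply re_le_Cmod]. right; f_equal. unfold Re; simpl; ring.
    + eapply Rle_trans; [|apply Rabs_Im_le_Cmod]. right; f_equal. unfold Im; simpl; ring.
Qed.

Definition is_Cseries (c : nat -> C) (l : C) : Prop :=
  is_series (fun k => Re (c k)) (Re l) /\ is_series (fun k => Im (c k)) (Im l).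

Lemma is_Cseries_unique (c : nat -> C) (l : C) : is_Cseries c l -> CSeries c = l.
Proof.
  intros [H1 H2]. unfold CSeries. rewrite (surjective_pairing l).
  f_equal; apply is_series_unique; assumption.
Qed.

(** The factor [2] is the price of comparing real and imaginary parts separately with [b]. *)
Lemma is_Cseries_dominated (c : nat -> C) (b : nat -> R) (B : R) :
  (forall k, Cmod (c k) <= b k) -> is_series b B ->
  is_Cseries c (CSeries c) /\ Cmod (CSeries c) <= 2 * B.
Proof.
  intros H HB.
  assert (EB : ex_series b) by (eexists; exact HB).
  assert (HR : forall u : nat -> R, (forall k, Rabs (u k) <= b k) ->
            ex_series u /\ Rabs (Series u) <= B).
  { intros u Hu.
    assert (Ea : ex_series (fun k => Rabs (u k))).
    { apply (ex_series_le (K := R_AbsRing) (V := R_CompleteNormedModule)) with b; [|exact EB].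
      intros k. unfold norm; simpl. unfold abs; simpl.
      rewrite Rabs_Rabsolu. apply Hu. }
    split; [apply ex_series_Rabs, Ea|].
    eapply Rle_trans; [apply Series_Rabs, Ea|].
    rewrite <- (is_series_unique _ _ HB). apply Series_le; [|exact EB].
    intros k. split; [apply Rabs_pos | apply Hu]. }
  destruct (HR (fun k => Re (c k))) as [E1 B1].
  { intros k. eapply Rle_trans; [apply re_le_Cmod | apply H]. }
  destruct (HR (fun k => Im (c k))) as [E2 B2].
  { intros k. eapply Rle_trans; [apply Rabs_Im_le_Cmod | apply H]. }
  split.
  - split; apply Series_correct; assumption.
  - eapply Rle_trans; [apply Cmod_le_Re_Im|]. simpl. lra.
Qed.

Lemma is_Cseries_minus (c d : nat -> C) (l m : C) :
  is_Cseries c l -> is_Cseries d m -> is_Cseries (fun k => c k - d k)%C (l - m)%C.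
Proof.
  intros [C1 C2] [D1 D2]. split.
  - exact (is_series_minus (V := RV) _ _ _ _ C1 D1).
  - exact (is_series_minus (V := RV) _ _ _ _ C2 D2).
Qed.

Lemma is_Cseries_scal (z : C) (c : nat -> C) (l : C) :
  is_Cseries c l -> is_Cseries (fun k => z * c k)%C (z * l)%C.
Proof.
  intros [C1 C2]. split.
  - exact (is_series_minus (V := RV) _ _ _ _
      (is_series_scal (V := RV) (Re z) _ _ C1)
      (is_series_scal (V := RV) (Im z) _ _ C2)).
  - exact (is_series_plus (V := RV) _ _ _ _
      (is_series_scal (V := RV) (Re z) _ _ C2)
      (is_series_scal (V := RV) (Im z) _ _ C1)).
Qed.

Lemma is_series_shift (b : nat -> R) (B : R) :
  is_series (fun k => b (S k)) B -> b 0%nat = 0 -> is_series b B.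
Proof.
  intros H H0. apply is_series_decr_1. unfold plus, opp; simpl.
  rewrite H0, Ropp_0, Rplus_0_r. exact H.
Qed.

Lemma is_Cseries_shift (c : nat -> C) (l : C) :
  is_Cseries (fun k => c (S k)) l -> c 0%nat = 0 -> is_Cseries c l.
Proof.
  intros [H1 H2] H0.
  split; apply is_series_shift; try assumption; rewrite H0; reflexivity.
Qed.

(** A class large enough for both Bessel series, stable under termwise differentiation, and
    dominated by the exponential series. *)
Definition entire_coef (a : nat -> R) : Prop :=
  forall k, Rabs (a k) <= / INR (fact k).

Definition dcoef (a : nat -> R) (k : nat) : R := INR (S k) * a (S k).

Definition Pser (a : nat -> R) (z : C) : C :=
  CSeries (fun k => RtoC (a k) * z ^ k)%C.

Lemma entire_dcoef (a : nat -> R) : entire_coef a -> entire_coef (dcoef a).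
Proof.
  intros H k. unfold dcoef. rewrite Rabs_mult, Rabs_pos_eq by apply pos_INR.
  specialize (H (S k)). pose proof (INR_fact_lt_0 k). pose proof (lt_0_INR (S k) ltac:(lia)).
  replace (/ INR (fact k)) with (INR (S k) * / INR (fact (S k))).
  - apply Rmult_le_compat_l; lra.
  - rewrite fact_simpl, mult_INR. field. lra.
Qed.

Lemma is_series_exp (r : R) : is_series (fun k => / INR (fact k) * r ^ k) (exp r).
Proof. apply is_pseries_R, is_exp_Reals. Qed.

Lemma entire_term_bound (a : nat -> R) (z : C) (r : R) (k : nat) :
  entire_coef a -> Cmod z <= r ->
  Cmod (RtoC (a k) * z ^ k) <= / INR (fact k) * r ^ k.
Proof.
  intros Ha Hz. rewrite Cmod_mult, Cmod_pow, Cmod_R.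
  apply Rmult_le_compat; [apply Rabs_pos | | apply Ha |].
  - apply pow_le, Cmod_ge_0.
  - apply pow_incr. split; [apply Cmod_ge_0 | exact Hz].
Qed.

Lemma is_Cseries_Pser (a : nat -> R) (z : C) :
  entire_coef a -> is_Cseries (fun k => RtoC (a k) * z ^ k)%C (Pser a z).
Proof.
  intros Ha. eapply is_Cseries_dominated; [|apply (is_series_exp (Cmod z))].
  intros k. apply entire_term_bound; [exact Ha | lra].
Qed.

(** Induction on the remainder: the one for exponent [n + 1] is [w] times the one for [n] plus
    [n * z ^ (n - 1) * (w - z) ^ 2]. The factor [(k + 1) * (k + 2)] in the bound turns [/ (k + 2)!]
    into [/ k!] when the series is summed. *)
Lemma pow_taylor_bound (z w : C) (r : R) (k : nat) :
  Cmod z <= r -> Cmod w <= r ->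
  Cmod (w ^ S (S k) - z ^ S (S k) - RtoC (INR (S (S k))) * z ^ S k * (w - z)) <=
  INR (S k) * INR (S (S k)) * r ^ k * Cmod (w - z) ^ 2.
Proof.
  intros Hz Hw. assert (Hr : 0 <= r) by (pose proof (Cmod_ge_0 z); lra).
  induction k as [|k IH].
  - replace (w ^ 2 - z ^ 2 - RtoC (INR 2) * z ^ 1 * (w - z))%C with ((w - z) ^ 2)%C.
    + rewrite Cmod_pow. simpl. pose proof (pow2_ge_0 (Cmod (w - z))). simpl in H. lra.
    + replace (INR 2) with (1 + 1) by (simpl; ring). rewrite RtoC_plus. simpl. ring.
  - replace (w ^ S (S (S k)) - z ^ S (S (S k)) - RtoC (INR (S (S (S k)))) * z ^ S (S k) * (w - z))%C
      with (w * (w ^ S (S k) - z ^ S (S k) - RtoC (INR (S (S k))) * z ^ S k * (w - z)) +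
            RtoC (INR (S (S k))) * z ^ S k * (w - z) ^ 2)%C.
    2:{ rewrite (S_INR (S (S k))), RtoC_plus. simpl Cpow. ring. }
    Cmod_triangle_le.
    rewrite !Cmod_mult, !Cmod_pow, Cmod_R, Rabs_pos_eq by apply pos_INR.
    set (d := Cmod (w - z) ^ 2) in *.
    assert (Hd : 0 <= d) by apply pow2_ge_0.
    assert (Hk := pow_le r k Hr). assert (Hsk := pow_le r (S k) Hr).
    assert (Hzk : Cmod z ^ S k <= r ^ S k) by (apply pow_incr; split; [apply Cmod_ge_0 | exact Hz]).
    assert (P1 := pos_INR (S (S k))). assert (P0 := pos_INR k).
    apply Rle_trans with
      (r * (INR (S k) * INR (S (S k)) * r ^ k * d) + INR (S (S k)) * r ^ S k * d).
    + apply Rplus_le_compat.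
      * apply Rmult_le_compat; [apply Cmod_ge_0 | apply Cmod_ge_0 | exact Hw | exact IH].
      * apply Rmult_le_compat_r; [exact Hd|]. apply Rmult_le_compat_l; assumption.
    + replace (r * (INR (S k) * INR (S (S k)) * r ^ k * d)) with
        (INR (S k) * (INR (S (S k)) * r ^ S k * d)) by (simpl pow; ring).
      set (q := INR (S (S k)) * r ^ S k * d).
      replace (INR (S (S k)) * INR (S (S (S k))) * r ^ S k * d) with (INR (S (S (S k))) * q)
        by (unfold q; ring).
      assert (0 <= q) by exact (Rmult_le_pos _ _ (Rmult_le_pos _ _ P1 Hsk) Hd).
      rewrite !S_INR. nra.
Qed.

Lemma Pser_taylor (a : nat -> R) (z w : C) (r : R) :
  entire_coef a -> Cmod z <= r -> Cmod w <= r ->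
  Cmod (Pser a w - Pser a z - (w - z) * Pser (dcoef a) z) <=
  2 * exp r * Cmod (w - z) ^ 2.
Proof.
  intros Ha Hz Hw.
  (* The derivative series is shifted by one index so that all three series can be subtracted term
     by term; its new term at [0] vanishes because of the factor [INR 0]. *)
  assert (H0 := is_Cseries_minus _ _ _ _
    (is_Cseries_minus _ _ _ _ (is_Cseries_Pser a w Ha) (is_Cseries_Pser a z Ha))
    (is_Cseries_scal (w - z) _ _
      (is_Cseries_shift (fun k => RtoC (INR k * a k) * z ^ pred k)%C _
         (is_Cseries_Pser (dcoef a) z (entire_dcoef a Ha))
         ltac:(simpl; rewrite Rmult_0_l; ring)))).
  (* The terms of index [0] and [1] of the remainder cancel; from index [2] on, the bound is the
     exponential series at [r], shifted by two. *)
  set (b := fun k => match k with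
            | S (S j) => Cmod (w - z) ^ 2 * (/ INR (fact j) * r ^ j) | _ => 0 end).
  assert (Hb : is_series b (Cmod (w - z) ^ 2 * exp r)).
  { apply is_series_shift; [|reflexivity]. apply is_series_shift; [|reflexivity].
    exact (is_series_scal (V := RV) _ _ _ (is_series_exp r)). }
  apply is_Cseries_unique in H0. rewrite <- H0.
  replace (2 * exp r * Cmod (w - z) ^ 2) with (2 * (Cmod (w - z) ^ 2 * exp r)) by ring.
  eapply is_Cseries_dominated; [|exact Hb].
  intros [|[|k]].
  - simpl. rewrite Rmult_0_l.
    replace (RtoC (a 0%nat) * 1 - RtoC (a 0%nat) * 1 - (w - z) * (RtoC 0 * 1))%C with (RtoC 0) by ring.
    rewrite Cmod_0. lra.
  - simpl. rewrite Rmult_1_l.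
    match goal with |- Cmod ?u <= _ => replace u with (RtoC 0) by ring end.
    rewrite Cmod_0. lra.
  - simpl pred. unfold b. rewrite RtoC_mult.
    replace (RtoC (a (S (S k))) * w ^ S (S k) - RtoC (a (S (S k))) * z ^ S (S k) -
      (w - z) * (RtoC (INR (S (S k))) * RtoC (a (S (S k))) * z ^ S k))%C with
      (RtoC (a (S (S k))) * (w ^ S (S k) - z ^ S (S k) - RtoC (INR (S (S k))) * z ^ S k * (w - z)))%C
      by ring.
    rewrite Cmod_mult, Cmod_R.
    assert (Hp := pow_taylor_bound z w r k Hz Hw).
    apply Rle_trans with
      (/ INR (fact (S (S k))) * (INR (S k) * INR (S (S k)) * r ^ k * Cmod (w - z) ^ 2)).
    + apply Rmult_le_compat; [apply Rabs_pos | apply Cmod_ge_0 | apply Ha | exact Hp].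
    + right. rewrite !fact_simpl, !mult_INR.
      pose proof (INR_fact_lt_0 k). pose proof (pos_INR k). rewrite !S_INR. field. lra.
Qed.

Lemma Pser_0 (a : nat -> R) : Pser a 0 = RtoC (a 0%nat).
Proof.
  apply is_Cseries_unique. split; simpl.
  - apply is_series_decr_1. apply is_series_ext with (fun _ => 0).
    + intros k. simpl. ring.
    + unfold plus, opp; simpl. replace (a 0%nat + _) with 0 by ring.
      apply filterlim_ext with (fun _ : nat => 0); [|apply filterlim_const].
      intros n. symmetry. induction n as [|n IH]; [apply sum_O|].
      rewrite sum_Sn, IH. unfold plus; simpl; ring.
  - apply is_series_ext with (fun _ => 0).
    + intros [|k]; simpl; ring.
    + apply filterlim_ext with (fun _ : nat => 0); [|apply filterlim_const].
      intros n. symmetry. induction n as [|n IH]; [apply sum_O|].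
      rewrite sum_Sn, IH. unfold plus; simpl; ring.
Qed.

Lemma Pser_lipschitz (a : nat -> R) (z : C) :
  entire_coef a -> exists L, 0 < L /\ forall w, Cmod (w - z) <= 1 ->
    Cmod (Pser a w - Pser a z) <= L * Cmod (w - z).
Proof.
  intros Ha. set (r := Cmod z + 1).
  exists (Cmod (Pser (dcoef a) z) + 2 * exp r). 
  assert (He := exp_pos r). assert (Hd := Cmod_ge_0 (Pser (dcoef a) z)).
  split; [lra|].
  intros w Hw.
  assert (Hwr : Cmod w <= r).
  { replace w with (w - z + z)%C by ring. Cmod_triangle_le.
    unfold r. lra. }
  assert (Ht := Pser_taylor a z w r Ha ltac:(unfold r; lra) Hwr).
  assert (Tr := Cmod_triangle (Pser a w - Pser a z - (w - z) * Pser (dcoef a) z)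
                 ((w - z) * Pser (dcoef a) z)).
  replace (Pser a w - Pser a z - (w - z) * Pser (dcoef a) z + (w - z) * Pser (dcoef a) z)%C
    with (Pser a w - Pser a z)%C in Tr by ring.
  rewrite Cmod_mult in Tr. pose proof (Cmod_ge_0 (w - z)).
  assert (exp r * Cmod (w - z) ^ 2 <= exp r * Cmod (w - z)).
  { apply Rmult_le_compat_l; [lra|]. simpl. nra. }
  lra.
Qed.

Lemma Ccontinuous_Pser (a : nat -> R) (z : C) :
  entire_coef a -> Ccontinuous (Pser a) z.
Proof.
  intros Ha. apply Ccontinuous_of_Cmod. intros e He.
  destruct (Pser_lipschitz a z Ha) as [L [HL Hlip]].
  apply locally_Cmod. exists (Rmin 1 (e / L)).
  split; [apply Rmin_pos; [lra | apply Rdiv_lt_0_compat; lra]|].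
  intros w Hw.
  destruct (lt_Rmin _ _ _ Hw) as [W1 W2].
  eapply Rle_lt_trans; [apply Hlip; lra|].
  apply (Rmult_lt_compat_l L) in W2; [|exact HL].
  replace (L * (e / L)) with e in W2 by (field; lra). exact W2.
Qed.

Lemma is_Cderive_Pser (a : nat -> R) (f : R -> C) (t : R) (l : C) :
  entire_coef a -> is_Cderive f t l ->
  is_Cderive (fun s => Pser a (f s)) t (l * Pser (dcoef a) (f t))%C.
Proof.
  intros Ha Hf. assert (Hc := is_Cderive_continuous _ _ _ Hf).
  assert (Hf' := proj1 (is_Cderive_iff _ _ _) Hf).
  apply is_Cderive_iff. intros e He.
  set (D := Pser (dcoef a) (f t)). set (r := Cmod (f t) + 1).
  assert (HD := Cmod_ge_0 D). assert (Hr := exp_pos r).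
  set (e1 := e / (2 * (Cmod D + 1))).
  assert (He1 : 0 < e1) by (apply Rdiv_lt_0_compat; lra).
  destruct (Hf' e1 He1) as [d1 [Hd1 D1]].
  destruct (Hf' 1 Rlt_0_1) as [d2 [Hd2 D2]].
  set (M := Cmod l + 1). assert (HM : 1 <= M) by (pose proof (Cmod_ge_0 l); unfold M; lra).
  (* [M] is a Lipschitz constant of [f] near [t]. The bound [/ M] keeps [f s] in the disc of radius
     [r]; the other makes the quadratic remainder at most half of the allowed error, [e1] accounting
     for the other half. *)
  set (d3 := Rmin (/ M) (e / (4 * exp r * M * M))).
  assert (Hd3 : 0 < d3).
  { apply Rmin_pos; [apply Rinv_0_lt_compat; lra|]. apply Rdiv_lt_0_compat; [lra|].
    repeat apply Rmult_lt_0_compat; lra. }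
  exists (Rmin d1 (Rmin d2 d3)). split; [exact (Rmin_pos _ _ Hd1 (Rmin_pos _ _ Hd2 Hd3))|].
  intros s Hs.
  destruct (lt_Rmin _ _ _ Hs) as [S1 S23].
  destruct (lt_Rmin _ _ _ S23) as [S2 S3].
  destruct (lt_Rmin _ _ _ S3) as [S4 S5].
  specialize (D1 s S1). specialize (D2 s S2).
  assert (Hsp := Rabs_pos (s - t)). set (h := Rabs (s - t)) in *.
  assert (Hfs : Cmod (f s - f t) <= M * h).
  { replace (f s - f t)%C with (f s - f t - RtoC (s - t) * l + RtoC (s - t) * l)%C by ring.
    Cmod_triangle_le. rewrite Cmod_mult, Cmod_R. fold h.
    unfold M. nra. }
  assert (Hfs1 : Cmod (f s - f t) <= 1).
  { eapply Rle_trans; [exact Hfs|]. apply (Rmult_lt_compat_l M) in S4; [|lra].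
    rewrite Rinv_r in S4; lra. }
  assert (Hwr : Cmod (f s) <= r).
  { replace (f s) with (f s - f t + f t)%C by ring. Cmod_triangle_le.
    unfold r. lra. }
  assert (Ht := Pser_taylor a (f t) (f s) r Ha ltac:(unfold r; lra) Hwr). fold D in Ht.
  replace (Pser a (f s) - Pser a (f t) - RtoC (s - t) * (l * D))%C with
    ((Pser a (f s) - Pser a (f t) - (f s - f t) * D) + (f s - f t - RtoC (s - t) * l) * D)%C by ring.
  Cmod_triangle_le. rewrite Cmod_mult.
  assert (A1 : Cmod (f s - f t - RtoC (s - t) * l) * Cmod D <= e / 2 * h).
  { apply Rle_trans with (e1 * h * (Cmod D + 1)).
    - apply Rmult_le_compat; [apply Cmod_ge_0 | exact HD | exact D1 | lra].
    - right. unfold e1. field. lra. }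
  assert (A2 : 2 * exp r * Cmod (f s - f t) ^ 2 <= e / 2 * h).
  { apply Rle_trans with (2 * exp r * (M * h) ^ 2).
    - apply Rmult_le_compat_l; [lra|]. apply pow_incr. split; [apply Cmod_ge_0 | exact Hfs].
    - replace (2 * exp r * (M * h) ^ 2) with ((2 * exp r * M * M) * h * h) by ring.
      apply Rmult_le_compat_r; [exact Hsp|].
      apply (Rmult_lt_compat_l (2 * exp r * M * M)) in S5;
        [|repeat apply Rmult_lt_0_compat; lra].
      replace (2 * exp r * M * M * (e / (4 * exp r * M * M))) with (e / 2) in S5
        by (field; lra). lra. }
  lra.
Qed.

(** * The kernel of the double layer potential *)

Lemma RtoC_neq_0 (r : R) : r <> 0 -> RtoC r <> 0.
Proof. intros H E. apply (f_equal Re) in E. exact (H E). Qed.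

Definition j0_coef (k : nat) : R := (-1) ^ k / (INR (fact k)) ^ 2.

Definition y0_coef (k : nat) : R := (-1) ^ k * harmonic k / (INR (fact k)) ^ 2.

Lemma Rabs_m1_pow (k : nat) : Rabs ((-1) ^ k) = 1.
Proof.
  rewrite <- RPow_abs. replace (Rabs (-1)) with 1; [apply pow1|].
  rewrite Rabs_left; lra.
Qed.

Lemma INR_fact_ge_1 (k : nat) : 1 <= INR (fact k).
Proof. apply (le_INR 1). apply lt_O_fact. Qed.

Lemma entire_j0_coef : entire_coef j0_coef.
Proof.
  intros k. unfold j0_coef, Rdiv. rewrite Rabs_mult, Rabs_m1_pow, Rmult_1_l.
  pose proof (INR_fact_ge_1 k).
  rewrite Rabs_pos_eq by (left; apply Rinv_0_lt_compat; nra).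
  apply Rinv_le_contravar; simpl; nra.
Qed.

Lemma harmonic_bound (k : nat) : 0 <= harmonic k <= INR k.
Proof.
  unfold harmonic. induction k as [|k IH].
  - rewrite sum_n_m_zero by lia. simpl. unfold zero; simpl. lra.
  - rewrite sum_n_Sm by lia. unfold plus; simpl plus.
    assert (0 < / INR (S k) <= 1).
    { split; [apply Rinv_0_lt_compat, lt_0_INR; lia|].
      replace 1 with (/ 1) by field. apply Rinv_le_contravar; [lra|].
      apply (le_INR 1). lia. }
    rewrite S_INR in *. simpl. lra.
Qed.

(** One of the two factorials in the denominator absorbs the harmonic number, as
    [harmonic k <= k <= k!]. *)
Lemma entire_y0_coef : entire_coef y0_coef.
Proof.
  intros k. unfold y0_coef, Rdiv. rewrite !Rabs_mult, Rabs_m1_pow, Rmult_1_l.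
  pose proof (INR_fact_ge_1 k) as Hf. pose proof (harmonic_bound k) as [H1 H2].
  assert (Hk : INR k <= INR (fact k)).
  { apply le_INR. clear. induction k as [|k IH]; [simpl; lia|].
    rewrite fact_simpl. pose proof (lt_O_fact k). nia. }
  rewrite Rabs_pos_eq by exact H1.
  rewrite Rabs_pos_eq by (left; apply Rinv_0_lt_compat; nra).
  apply Rmult_le_reg_r with (INR (fact k) ^ 2); [nra|].
  rewrite Rmult_assoc, Rinv_l by nra.
  replace (/ INR (fact k) * INR (fact k) ^ 2) with (INR (fact k)) by (field; lra). lra.
Qed.

(** For [Im w > 0] this is the logarithm of [k0 / 2] times the root of [w], plus the Euler constant,
    with the root removed by [Clog_Csqrt]. *)
Definition log_term (k0 : R) (w : C) : C :=
  (RtoC (ln (k0 / 2)) + RtoC (/ 2) * (Clog (w / Ci) + Ci * RtoC (PI / 2)) +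
   RtoC Euler_gamma)%C.

Definition hankel_of_square (k0 : R) (w : C) : C :=
  (Pser j0_coef (RtoC (k0 * k0 / 4) * w) +
   Ci * (RtoC (2 / PI) *
     (log_term k0 w * Pser j0_coef (RtoC (k0 * k0 / 4) * w)
      - Pser y0_coef (RtoC (k0 * k0 / 4) * w))))%C.

Lemma hankel_H0_Csqrt (k0 : R) (w : C) :
  0 < k0 -> 0 < Im w ->
  hankel_H0 (RtoC k0 * Csqrt w) = hankel_of_square k0 w.
Proof.
  intros Hk Hw.
  assert (Hs : slit (w / Ci)) by (apply slit_Re; rewrite Cdiv_Ci; exact Hw).
  assert (Hz : (RtoC k0 * Csqrt w * (RtoC k0 * Csqrt w) / RtoC 4)%C =
               (RtoC (k0 * k0 / 4) * w)%C).
  { rewrite <- (Csqrt_sqr w Hs) at 3. rewrite RtoC_div, RtoC_mult by lra. field. }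
  unfold hankel_H0, bessel_Y0, bessel_J0.
  rewrite Hz.
  replace (RtoC k0 * Csqrt w / RtoC 2)%C with (RtoC (k0 / 2) * Csqrt w)%C.
  2:{ rewrite RtoC_div by lra. field. }
  rewrite Clog_Csqrt by lra. reflexivity.
Qed.

(** The derivative of [hankel_of_square] with respect to [w]. The only pole is [RtoC (/ 2) / w],
    which comes from differentiating [log_term]. *)
Definition hankel_deriv (k0 : R) (w : C) : C :=
  (RtoC (k0 * k0 / 4) * Pser (dcoef j0_coef) (RtoC (k0 * k0 / 4) * w) *
     (1 + Ci * RtoC (2 / PI) * log_term k0 w) +
   Ci * RtoC (2 / PI) *
     (RtoC (/ 2) / w * Pser j0_coef (RtoC (k0 * k0 / 4) * w)
      - RtoC (k0 * k0 / 4) * Pser (dcoef y0_coef) (RtoC (k0 * k0 / 4) * w)))%C.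

Lemma Ci_neq_0 : Ci <> 0.
Proof. intros E. apply (f_equal Im) in E. simpl in E. lra. Qed.

Lemma is_Cderive_hankel (k0 : R) (f : R -> C) (t : R) (l : C) :
  0 < Im (f t) -> is_Cderive f t l ->
  is_Cderive (fun s => hankel_of_square k0 (f s)) t (l * hankel_deriv k0 (f t))%C.
Proof.
  intros Him Hf.
  assert (Hw0 : f t <> 0) by (intros E; rewrite E in Him; simpl in Him; lra).
  assert (HL : is_Cderive (fun s => log_term k0 (f s)) t (RtoC (/ 2) * (l / f t))%C).
  { unfold log_term. eapply is_Cderive_eq.
    - apply is_Cderive_plus; [|apply is_Cderive_const].
      apply is_Cderive_plus; [apply is_Cderive_const|].
      apply is_Cderive_scal. apply is_Cderive_plus; [|apply is_Cderive_const].
      apply (is_Cderive_Clog (fun s => f s / Ci)%C).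
      + apply slit_Re. rewrite Cdiv_Ci. exact Him.
      + apply is_Cderive_mult; [exact Hf | apply is_Cderive_const].
    - cbv beta. field. split; [exact Hw0|exact Ci_neq_0]. }
  assert (Hc : is_Cderive (fun s => RtoC (k0 * k0 / 4) * f s)%C t (RtoC (k0 * k0 / 4) * l)%C)
    by (apply is_Cderive_scal, Hf).
  assert (HJ := is_Cderive_Pser _ _ _ _ entire_j0_coef Hc).
  assert (HY := is_Cderive_Pser _ _ _ _ entire_y0_coef Hc).
  unfold hankel_of_square, hankel_deriv. eapply is_Cderive_eq.
  - apply is_Cderive_plus; [exact HJ|].
    apply is_Cderive_scal, is_Cderive_scal.
    apply is_Cderive_minus; [|exact HY].
    apply is_Cderive_mult; [exact HL | exact HJ].
  - cbv beta. field. exact Hw0.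
Qed.

Definition quad (eps1 eps2 : C) (v : R2) : C :=
  (eps1 * RtoC (fst v) ^ 2 + eps2 * RtoC (snd v) ^ 2)%C.

Definition dot (u v : R2) : R := fst u * fst v + snd u * snd v.

(** The factor one half of [Ci] is [Ci / 4] from [Phi] times the [2] in the gradient of the
    quadratic form; the [eps1] and [eps2] of that gradient cancel against [mulA]. *)
Definition kernel_of_square (k0 : R) (s w : C) : C :=
  (Ci * RtoC (/ 2) * s * hankel_deriv k0 w)%C.

Definition kernel (k0 : R) (eps1 eps2 : C) (v : R2) : C :=
  kernel_of_square k0 (Csqrt (eps1 * eps2)) (quad eps1 eps2 v).

Lemma Im_quad (eps1 eps2 : C) (v : R2) :
  Im (quad eps1 eps2 v) = Im eps1 * fst v ^ 2 + Im eps2 * snd v ^ 2.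
Proof. destruct eps1, eps2, v. unfold quad, Im, Cplus, Cmult, RtoC; simpl. ring. Qed.

Lemma Cmod_R2_sqr (v : R2) : Cmod v ^ 2 = fst v ^ 2 + snd v ^ 2.
Proof. rewrite Cmod2_alt. reflexivity. Qed.

(** The imaginary part is a positive definite form because of the losses. It replaces the
    ellipticity that the real part lacks, and every later lower bound on the form rests on it. *)
Lemma Im_quad_ge (eps1 eps2 : C) (v : R2) :
  Rmin (Im eps1) (Im eps2) * Cmod v ^ 2 <= Im (quad eps1 eps2 v).
Proof.
  rewrite Im_quad, Cmod_R2_sqr.
  pose proof (Rmin_l (Im eps1) (Im eps2)). pose proof (Rmin_r (Im eps1) (Im eps2)).
  pose proof (pow2_ge_0 (fst v)). pose proof (pow2_ge_0 (snd v)). nra.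
Qed.

Lemma Im_quad_pos (eps1 eps2 : C) (v : R2) :
  0 < Im eps1 -> 0 < Im eps2 -> v <> (0, 0) -> 0 < Im (quad eps1 eps2 v).
Proof.
  intros H1 H2 Hv. eapply Rlt_le_trans; [|apply Im_quad_ge].
  apply Rmult_lt_0_compat; [apply Rmin_pos; assumption|].
  apply pow_lt. apply Cmod_gt_0. exact Hv.
Qed.

Lemma Cmod_quad_ge (eps1 eps2 : C) (v : R2) :
  Rmin (Im eps1) (Im eps2) * Cmod v ^ 2 <= Cmod (quad eps1 eps2 v).
Proof.
  eapply Rle_trans; [apply Im_quad_ge|].
  eapply Rle_trans; [apply Rle_abs | apply Rabs_Im_le_Cmod].
Qed.

Lemma Cmod_quad_le (eps1 eps2 : C) (v : R2) :
  Cmod (quad eps1 eps2 v) <= (Cmod eps1 + Cmod eps2) * Cmod v ^ 2.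
Proof.
  unfold quad. Cmod_triangle_le.
  rewrite !Cmod_mult, !Cmod_pow, !Cmod_R, !pow2_abs.
  rewrite Cmod_R2_sqr.
  pose proof (pow2_ge_0 (fst v)). pose proof (pow2_ge_0 (snd v)).
  pose proof (Cmod_ge_0 eps1). pose proof (Cmod_ge_0 eps2). nra.
Qed.

Lemma dPhi_conormal_kernel (k0 : R) (eps1 eps2 : C) (x y n : R2) :
  0 < k0 -> 0 < Im eps1 -> 0 < Im eps2 -> x <> y ->
  dPhi_conormal k0 eps1 eps2 x y n =
  (RtoC (dot (y - x)%C n) * kernel k0 eps1 eps2 (y - x)%C)%C.
Proof.
  intros Hk H1 H2 Hxy.
  assert (E1 : eps1 <> 0) by (intros E; rewrite E in H1; simpl in H1; lra).
  assert (E2 : eps2 <> 0) by (intros E; rewrite E in H2; simpl in H2; lra).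
  destruct x as [x1 x2], y as [y1 y2], n as [n1 n2].
  set (w := quad eps1 eps2 (x1 - y1, x2 - y2)).
  assert (Hw : 0 < Im w).
  { apply Im_quad_pos; try assumption. intros E. injection E as A B.
    apply Hxy. f_equal; lra. }
  assert (Hww : w = quad eps1 eps2 ((y1, y2) - (x1, x2))%C).
  { unfold w, quad; simpl fst; simpl snd.
    replace (y1 + - x1) with (- (x1 - y1)) by ring.
    replace (y2 + - x2) with (- (x2 - y2)) by ring.
    rewrite !RtoC_opp. simpl Cpow. ring. }
  unfold dPhi_conormal, grad, bilinear_dot, mulA; simpl fst; simpl snd.
  (* Both partial derivatives are derivatives of [Phi] along a path through [y], so one chain rule
     serves both. *)
  assert (Hgen : forall (f : R -> R2) (t : R) (l : C), f t = (y1, y2) ->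
    is_Cderive (fun s => quad eps1 eps2 (x1 - fst (f s), x2 - snd (f s))%R) t l ->
    CDerive (fun s => Phi k0 eps1 eps2 (x1, x2) (f s)) t =
    (Ci / RtoC 4 * Csqrt (eps1 * eps2) * (l * hankel_deriv k0 w))%C).
  { intros f t l Hft Hl.
    assert (Hft1 : quad eps1 eps2 (x1 - fst (f t), x2 - snd (f t)) = w)
      by (rewrite Hft; reflexivity).
    apply is_Cderive_unique.
    apply is_Cderive_ext_loc with (fun s => (Ci / RtoC 4 * Csqrt (eps1 * eps2)) *
       hankel_of_square k0 (quad eps1 eps2 (x1 - fst (f s), x2 - snd (f s))%R))%C.
    - destruct (is_Cderive_continuous _ _ _ Hl) as [_ Hc].
      (* The formula without root holds only in the upper half-plane; that condition is open, so it
         persists near [t], which is enough for a derivative. *)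
      assert (Hpos : locally t (fun s => 0 < Im (quad eps1 eps2 (x1 - fst (f s), x2 - snd (f s))%R))).
      { apply (Hc (fun r => 0 < r)). apply open_gt. rewrite Hft1. exact Hw. }
      revert Hpos. apply filter_imp. intros s Hs.
      unfold Phi, rtilde. simpl fst at 1; simpl snd at 1. f_equal.
      symmetry. apply hankel_H0_Csqrt; assumption.
    - apply is_Cderive_scal. rewrite <- Hft1. apply is_Cderive_hankel; [|exact Hl].
      rewrite Hft1. exact Hw. }
  rewrite (Hgen (fun s => (s, y2)) y1 (eps1 * (RtoC 2 * RtoC (y1 - x1)))%C); [|reflexivity|].
  2:{ unfold quad; simpl fst; simpl snd. eapply is_Cderive_eq.
      - apply is_Cderive_plus; [|apply is_Cderive_const].
        apply is_Cderive_scal.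
        apply is_Cderive_ext_loc with (fun s => RtoC ((x1 - s) ^ 2)).
        + apply filter_forall. intros s. rewrite RtoC_pow. reflexivity.
        + apply is_Cderive_RtoC. auto_derive; [auto|reflexivity].
      - rewrite <- !RtoC_mult.
        match goal with |- (_ * RtoC ?u + _)%C = _ => replace u with (2 * (y1 - x1)) by (simpl; ring) end.
        ring. }
  rewrite (Hgen (fun s => (y1, s)) y2 (eps2 * (RtoC 2 * RtoC (y2 - x2)))%C); [|reflexivity|].
  2:{ unfold quad; simpl fst; simpl snd. eapply is_Cderive_eq.
      - apply is_Cderive_plus; [apply is_Cderive_const|].
        apply is_Cderive_scal.
        apply is_Cderive_ext_loc with (fun s => RtoC ((x2 - s) ^ 2)).
        + apply filter_forall. intros s. rewrite RtoC_pow. reflexivity.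
        + apply is_Cderive_RtoC. auto_derive; [auto|reflexivity].
      - rewrite <- !RtoC_mult.
        match goal with |- (_ + _ * RtoC ?u)%C = _ => replace u with (2 * (y2 - x2)) by (simpl; ring) end.
        ring. }
  unfold kernel, kernel_of_square. rewrite <- Hww.
  unfold dot; simpl fst; simpl snd.
  change (y1 + - x1) with (y1 - x1). change (y2 + - x2) with (y2 - x2).
  rewrite RtoC_plus, !RtoC_mult, RtoC_inv by lra.
  assert (E3 : RtoC 2 <> 0) by (apply RtoC_neq_0; lra).
  replace (RtoC 4) with (RtoC 2 * RtoC 2)%C by (rewrite <- RtoC_mult; f_equal; ring).
  field. tauto.
Qed.

Lemma Ccontinuous_id (z : C) : Ccontinuous (fun w : C => w) z.
Proof. apply Ccontinuous_iff, continuous_id. Qed.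

Lemma Ccontinuous_hankel_deriv (k0 : R) (w : C) :
  0 < Im w -> Ccontinuous (hankel_deriv k0) w.
Proof.
  intros Hw. assert (Hw0 : w <> 0) by (intros E; rewrite E in Hw; simpl in Hw; lra).
  assert (HP : forall a, entire_coef a ->
            Ccontinuous (fun z => Pser a (RtoC (k0 * k0 / 4) * z)) w).
  { intros a Ha. apply (Ccontinuous_comp_C (fun z => RtoC (k0 * k0 / 4) * z)%C (Pser a)).
    - apply Ccontinuous_mult; [apply Ccontinuous_const | apply Ccontinuous_id].
    - apply Ccontinuous_Pser, Ha. }
  assert (HL : Ccontinuous (log_term k0) w).
  { unfold log_term. apply Ccontinuous_plus; [|apply Ccontinuous_const].
    apply Ccontinuous_plus; [apply Ccontinuous_const|].
    apply Ccontinuous_mult; [apply Ccontinuous_const|].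
    apply Ccontinuous_plus; [|apply Ccontinuous_const].
    apply (Ccontinuous_comp_C (fun z => z / Ci)%C Clog).
    - apply Ccontinuous_div; [apply Ccontinuous_id | apply Ccontinuous_const | exact Ci_neq_0].
    - apply Ccontinuous_Clog, slit_Re. rewrite Cdiv_Ci. exact Hw. }
  unfold hankel_deriv.
  apply Ccontinuous_plus.
  - apply Ccontinuous_mult.
    + apply Ccontinuous_mult; [apply Ccontinuous_const | apply HP, entire_dcoef, entire_j0_coef].
    + apply Ccontinuous_plus; [apply Ccontinuous_const|].
      apply Ccontinuous_mult; [apply Ccontinuous_const | exact HL].
  - apply Ccontinuous_mult; [apply Ccontinuous_const|]. apply Ccontinuous_minus.
    + apply Ccontinuous_mult; [|apply HP, entire_j0_coef].
      apply Ccontinuous_div; [apply Ccontinuous_const | apply Ccontinuous_id | exact Hw0].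
    + apply Ccontinuous_mult; [apply Ccontinuous_const | apply HP, entire_dcoef, entire_y0_coef].
Qed.

Lemma Ccontinuous_quad (eps1 eps2 : C) (v : R2) : Ccontinuous (quad eps1 eps2) v.
Proof.
  assert (H : forall f : R2 -> R, continuous f v -> Ccontinuous (fun u => RtoC (f u) ^ 2)%C v).
  { intros f Hf. simpl Cpow.
    repeat (apply Ccontinuous_mult; [apply Ccontinuous_RtoC, Hf|]).
    apply Ccontinuous_const. }
  unfold quad. apply Ccontinuous_plus; (apply Ccontinuous_mult; [apply Ccontinuous_const|]);
    apply H; [apply continuous_fst | apply continuous_snd].
Qed.

Lemma Ccontinuous_kernel (k0 : R) (eps1 eps2 : C) (v : R2) :
  0 < Im eps1 -> 0 < Im eps2 -> v <> (0, 0) ->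
  Ccontinuous (kernel k0 eps1 eps2) v.
Proof.
  intros H1 H2 Hv.
  apply (Ccontinuous_comp_C (quad eps1 eps2) (kernel_of_square k0 (Csqrt (eps1 * eps2)))).
  - apply Ccontinuous_quad.
  - unfold kernel_of_square. apply Ccontinuous_mult; [apply Ccontinuous_const|].
    apply Ccontinuous_hankel_deriv, Im_quad_pos; assumption.
Qed.

(** * The singularity of the kernel at the origin *)

Lemma Pser_bounded (a : nat -> R) :
  entire_coef a -> exists B, 0 <= B /\ forall z, Cmod z <= 1 -> Cmod (Pser a z) <= B.
Proof.
  intros Ha. destruct (Pser_lipschitz a 0 Ha) as [L [HL H]].
  exists (L + Cmod (Pser a 0)). pose proof (Cmod_ge_0 (Pser a 0)). split; [lra|].
  intros z Hz. replace (z) with (z - 0)%C in Hz by ring.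
  specialize (H z Hz).
  replace (Pser a z) with (Pser a z - Pser a 0 + Pser a 0)%C by ring.
  Cmod_triangle_le. nra.
Qed.

Lemma Cmod_Clog_le (z : C) : Cmod (Clog z) <= Rabs (ln (Cmod z)) + PI.
Proof.
  eapply Rle_trans; [apply Cmod_le_Re_Im|]. simpl. apply Rplus_le_compat_l.
  pose proof (Carg_bound z). apply Rabs_le. lra.
Qed.

Lemma ln_le_sub_1 (x : R) : 0 < x -> ln x <= x - 1.
Proof.
  intros Hx. rewrite <- (ln_exp (x - 1)). apply ln_le; [exact Hx|].
  pose proof (exp_ineq1_le (x - 1)). lra.
Qed.

(** Used with [p] the fourth root of a modulus: the square root of the modulus times its logarithm
    is then at most [4 * p], which tends to [0]. *)
Lemma Rabs_ln_le (p : R) : 0 < p <= 1 -> Rabs (ln (p * p * (p * p))) <= 4 / p.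
Proof.
  intros Hp. assert (Hi : 0 < / p) by (apply Rinv_0_lt_compat; lra).
  assert (Hpp : 0 < p * p) by nra.
  rewrite !ln_mult by lra.
  assert (H1 : ln p <= 0).
  { pose proof (ln_le_sub_1 p). lra. }
  pose proof (ln_le_sub_1 (/ p) Hi) as H2. rewrite ln_Rinv in H2 by lra.
  rewrite Rabs_left1 by lra. unfold Rdiv. lra.
Qed.

Lemma log_term_bound (k0 : R) :
  exists A, 0 <= A /\ forall w, Cmod (log_term k0 w) <= A + Rabs (ln (Cmod w)).
Proof.
  exists (Rabs (ln (k0 / 2)) + PI + Rabs Euler_gamma).
  pose proof PI_RGT_0 as Hpi.
  pose proof (Rabs_pos (ln (k0 / 2))) as P1. pose proof (Rabs_pos Euler_gamma) as P2.
  split; [lra|]. intros w.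
  unfold log_term.
  Cmod_triangle_le.
  eapply Rle_trans; [apply Rplus_le_compat_r, Cmod_triangle|].
  rewrite Cmod_mult, !Cmod_R.
  pose proof (Cmod_triangle (Clog (w / Ci)) (Ci * RtoC (PI / 2))) as T.
  rewrite Cmod_mult, Cmod_Ci, Cmod_R, (Rabs_pos_eq (PI / 2)) in T by lra.
  pose proof (Cmod_Clog_le (w / Ci)) as T2. rewrite Cmod_div_Ci in T2.
  rewrite (Rabs_pos_eq (/ 2)) by lra.
  pose proof (Rabs_pos (ln (Cmod w))). lra.
Qed.

Lemma kernel_of_square_asymp (k0 : R) (s : C) :
  0 < k0 -> forall e, 0 < e -> exists d, 0 < d /\ forall w, 0 < Im w -> Cmod w < d ->
    sqrt (Cmod w) * Cmod (kernel_of_square k0 s w - RtoC (- / (2 * PI)) * s / w) <= e.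
Proof.
  intros Hk e He. pose proof PI_RGT_0 as Hpi.
  assert (Hc : 0 < k0 * k0 / 4) by nra. remember (k0 * k0 / 4) as c eqn:Ec.
  destruct (Pser_bounded _ (entire_dcoef _ entire_j0_coef)) as [B1 [P1 HB1]].
  destruct (Pser_bounded _ (entire_dcoef _ entire_y0_coef)) as [B2 [P2 HB2]].
  destruct (Pser_lipschitz _ 0 entire_j0_coef) as [L [HL Hlip]].
  rewrite Pser_0 in Hlip. replace (j0_coef 0) with 1 in Hlip by (unfold j0_coef; simpl; field).
  destruct (log_term_bound k0) as [A [PA HA]].
  assert (PS : 0 <= Cmod s) by apply Cmod_ge_0. remember (Cmod s) as S eqn:ES.
  assert (Ht : 0 < 2 / PI) by (apply Rdiv_lt_0_compat; lra). remember (2 / PI) as t eqn:Et.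
  set (A2 := / 2 * S * (c * B1 * t)).
  set (A1 := / 2 * S * (c * B1 * (1 + t * A) + t * (c * B2)) + S * (/ (2 * PI) * (L * c))).
  assert (Hi : 0 < / (2 * PI)) by (apply Rinv_0_lt_compat; lra).
  assert (PA2 : 0 <= A2) by (unfold A2; repeat apply Rmult_le_pos; lra).
  assert (PA1 : 0 <= A1).
  { assert (0 <= t * A) by (apply Rmult_le_pos; lra).
    assert (0 <= c * B1 * (1 + t * A)) by (repeat apply Rmult_le_pos; lra).
    assert (0 <= t * (c * B2)) by (repeat apply Rmult_le_pos; lra).
    assert (0 <= S * (/ (2 * PI) * (L * c))) by (repeat apply Rmult_le_pos; lra).
    unfold A1. apply Rplus_le_le_0_compat; [|assumption].
    apply Rmult_le_pos; lra. }
  (* For the fourth root [p <= 1] of the modulus of [w], the final quantity is at most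
     [p * (p * A1 + 4 * A2)]; hence the smallness is imposed on [p] and the radius is a fourth
     power. *)
  set (p0 := e / (A1 + 4 * A2 + 1)). assert (Hp0 : 0 < p0) by (apply Rdiv_lt_0_compat; lra).
  exists (Rmin (Rmin 1 (/ c)) (p0 * p0 * (p0 * p0))). split.
  { assert (0 < p0 * p0) by nra. assert (0 < / c) by (apply Rinv_0_lt_compat, Hc).
    apply Rmin_pos; [apply Rmin_pos; lra | nra]. }
  intros w Him Hw.
  assert (W0 := Rlt_le_trans _ _ _ Hw (Rmin_l _ _)).
  destruct (lt_Rmin _ _ _ W0) as [W1 W2].
  assert (W3 := Rlt_le_trans _ _ _ Hw (Rmin_r _ _)).
  assert (Hw0 : w <> 0) by (intros E; rewrite E in Him; simpl in Him; lra).
  assert (Hu := proj1 (Cmod_gt_0 w) Hw0).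
  set (u := Cmod w) in *.
  assert (Hcw : Cmod (RtoC c * w) <= 1).
  { rewrite Cmod_mult, Cmod_R, Rabs_pos_eq by lra. fold u.
    apply (Rmult_lt_compat_l c) in W2; [|exact Hc]. rewrite Rinv_r in W2; lra. }
  assert (Hsu := sqrt_lt_R0 u Hu). assert (Hp := sqrt_lt_R0 _ Hsu).
  assert (E2 : sqrt u = sqrt (sqrt u) * sqrt (sqrt u)) by (symmetry; apply sqrt_sqrt; lra).
  assert (E4 : u = sqrt (sqrt u) * sqrt (sqrt u) * (sqrt (sqrt u) * sqrt (sqrt u))).
  { rewrite <- E2. symmetry; apply sqrt_sqrt; lra. }
  set (p := sqrt (sqrt u)) in *. rewrite E2.
  assert (Hp1 : p <= 1).
  { destruct (Rle_or_lt p 1); [assumption|]. exfalso.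
    assert (1 < p * p) by nra. assert (1 < p * p * (p * p)) by nra. lra. }
  assert (Hpp0 : p < p0).
  { destruct (Rlt_or_le p p0); [assumption|]. exfalso.
    assert (p0 * p0 <= p * p) by nra. assert (p0 * p0 * (p0 * p0) <= p * p * (p * p)) by nra. lra. }
  assert (Hln : Rabs (ln u) <= 4 / p) by (rewrite E4; apply Rabs_ln_le; lra).
  (* Removing the pole leaves a logarithm times a bounded function, and the series of [j0_coef]
     minus its value [1] at the origin divided by [w], bounded by the Lipschitz estimate. *)
  assert (Hmain : Cmod (kernel_of_square k0 s w - RtoC (- / (2 * PI)) * s / w) <= A1 + A2 * Rabs (ln u)).
  { replace (kernel_of_square k0 s w - RtoC (- / (2 * PI)) * s / w)%C with
      (Ci * RtoC (/ 2) * s *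
        (RtoC c * Pser (dcoef j0_coef) (RtoC c * w) * (1 + Ci * RtoC t * log_term k0 w) +
         - (Ci * RtoC t * (RtoC c * Pser (dcoef y0_coef) (RtoC c * w)))) +
       s * (RtoC (- / (2 * PI)) * (Pser j0_coef (RtoC c * w) - 1) / w))%C.
    2:{ unfold kernel_of_square, hankel_deriv. rewrite <- Ec, <- Et.
        (* The constant is the product of [Ci / 2] from the gradient, [Ci * (2 / PI)] from the
           weight of [bessel_Y0], and [/ 2] from the logarithm of the root. *)
        replace (RtoC (- / (2 * PI))) with (Ci * RtoC (/ 2) * (Ci * RtoC t) * RtoC (/ 2))%C.
        - field. exact Hw0.
        - rewrite Et. unfold Ci, Cmult, RtoC; simpl. f_equal; field; lra. }
    Cmod_triangle_le.
    rewrite !Cmod_mult, Cmod_Ci, <- ES.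
    assert (X1 : Cmod (RtoC c * Pser (dcoef j0_coef) (RtoC c * w) * (1 + Ci * RtoC t * log_term k0 w) +
         - (Ci * RtoC t * (RtoC c * Pser (dcoef y0_coef) (RtoC c * w)))) <=
         c * B1 * (1 + t * (A + Rabs (ln u))) + t * (c * B2)).
    { Cmod_triangle_le.
      rewrite Cmod_opp, !Cmod_mult, Cmod_Ci, !Cmod_R, Rmult_1_l.
      rewrite (Rabs_pos_eq c), (Rabs_pos_eq t) by lra.
      apply Rplus_le_compat.
      - apply Rmult_le_compat.
        + apply Rmult_le_pos; [lra | apply Cmod_ge_0].
        + apply Cmod_ge_0.
        + apply Rmult_le_compat_l; [lra | apply HB1, Hcw].
        + Cmod_triangle_le.
          rewrite Cmod_1, !Cmod_mult, Cmod_Ci, Cmod_R, (Rabs_pos_eq t) by lra.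
          apply Rplus_le_compat_l. rewrite Rmult_1_l. apply Rmult_le_compat_l; [lra | apply HA].
      - apply Rmult_le_compat_l; [lra|]. apply Rmult_le_compat_l; [lra | apply HB2, Hcw]. }
    assert (X2 : Cmod (RtoC (- / (2 * PI)) * (Pser j0_coef (RtoC c * w) - 1) / w) <= / (2 * PI) * (L * c)).
    { rewrite Cmod_div, Cmod_mult, Cmod_R, Rabs_Ropp, Rabs_pos_eq by (assumption || lra).
      fold u. unfold Rdiv. rewrite Rmult_assoc. apply Rmult_le_compat_l; [lra|].
      apply (Rmult_le_reg_r u); [exact Hu|]. rewrite Rmult_assoc, Rinv_l by lra.
      specialize (Hlip (RtoC c * w)%C). replace (RtoC c * w - 0)%C with (RtoC c * w)%C in Hlip by ring.
      specialize (Hlip Hcw). rewrite Cmod_mult, Cmod_R, Rabs_pos_eq in Hlip by lra. fold u in Hlip. lra. }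
    rewrite Cmod_R, Rabs_pos_eq by lra.
    apply Rle_trans with (1 * / 2 * S * (c * B1 * (1 + t * (A + Rabs (ln u))) + t * (c * B2)) +
       S * (/ (2 * PI) * (L * c))).
    - apply Rplus_le_compat.
      + apply Rmult_le_compat_l; [nra | exact X1].
      + apply Rmult_le_compat_l; [exact PS | exact X2].
    - right. unfold A1, A2. ring. }
  apply Rle_trans with (p * p * (A1 + A2 * (4 / p))).
  - apply Rmult_le_compat_l; [nra|]. eapply Rle_trans; [exact Hmain|].
    apply Rplus_le_compat_l, Rmult_le_compat_l; assumption.
  - replace (p * p * (A1 + A2 * (4 / p))) with (p * (p * A1 + 4 * A2)) by (field; lra).
    apply Rle_trans with (p0 * (A1 + 4 * A2 + 1)).
    + apply Rmult_le_compat; nra.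
    + right. unfold p0. field. lra.
Qed.

(** The estimate in the squared variable carries over because [sqrt m] times the length of [v] is at
    most the square root of the modulus of the form; this is why the error is scaled by [sqrt m]. *)
Lemma kernel_asymp (k0 : R) (eps1 eps2 : C) :
  0 < k0 -> 0 < Im eps1 -> 0 < Im eps2 ->
  forall e, 0 < e -> exists d, 0 < d /\ forall v : R2, v <> (0, 0) -> Cmod v < d ->
    Cmod v * Cmod (kernel k0 eps1 eps2 v -
      RtoC (- / (2 * PI)) * Csqrt (eps1 * eps2) / quad eps1 eps2 v) <= e.
Proof.
  intros Hk H1 H2 e He.
  set (m := Rmin (Im eps1) (Im eps2)). assert (Hm : 0 < m) by (apply Rmin_pos; assumption).
  assert (Hsm := sqrt_lt_R0 _ Hm).
  destruct (kernel_of_square_asymp k0 (Csqrt (eps1 * eps2)) Hk (sqrt m * e)) as [d [Hd H]].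
  { apply Rmult_lt_0_compat; assumption. }
  set (B := Cmod eps1 + Cmod eps2 + 1).
  assert (HB : 1 <= B) by (pose proof (Cmod_ge_0 eps1); pose proof (Cmod_ge_0 eps2); unfold B; lra).
  exists (Rmin 1 (d / B)). split.
  { apply Rmin_pos; [lra | apply Rdiv_lt_0_compat; lra]. }
  intros v Hv Hvd.
  destruct (lt_Rmin _ _ _ Hvd) as [V1 V2].
  assert (Hp := proj1 (Cmod_gt_0 v) Hv).
  specialize (H (quad eps1 eps2 v) (Im_quad_pos _ _ _ H1 H2 Hv)).
  assert (Hq : Cmod (quad eps1 eps2 v) < d).
  { eapply Rle_lt_trans; [apply Cmod_quad_le|].
    apply (Rmult_lt_compat_l B) in V2; [|lra].
    replace (B * (d / B)) with d in V2 by (field; lra).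
    apply Rle_lt_trans with (B * Cmod v); [|exact V2].
    apply Rmult_le_compat; [unfold B in HB; lra | apply pow2_ge_0 | unfold B; lra | simpl; nra]. }
  specialize (H Hq).
  assert (Hs : sqrt m * Cmod v <= sqrt (Cmod (quad eps1 eps2 v))).
  { rewrite <- (sqrt_square (Cmod v)) at 1 by lra. rewrite <- sqrt_mult by nra.
    apply sqrt_le_1_alt. pose proof (Cmod_quad_ge eps1 eps2 v) as G. fold m in G. simpl in G.
    rewrite Rmult_1_r in G. exact G. }
  unfold kernel.
  set (X := Cmod (kernel_of_square k0 (Csqrt (eps1 * eps2)) (quad eps1 eps2 v) -
      RtoC (- / (2 * PI)) * Csqrt (eps1 * eps2) / quad eps1 eps2 v)) in *.
  assert (HX : 0 <= X) by apply Cmod_ge_0.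
  apply (Rmult_le_reg_l (sqrt m)); [exact Hsm|].
  apply Rle_trans with (2 := H). rewrite <- Rmult_assoc.
  apply Rmult_le_compat_r; assumption.
Qed.

(** Here [eps1 = p + i q], [eps2 = r + i t], [u = a + i b] with [eps2 = u * u * eps1], and
    [x + i y = u * eps1] is the root of [eps1 * eps2]. As [p * r < 0], the real part of the product
    is negative, so [x * x < y * y]; with [x + y > 0] this forces [y > 0]. The sign of
    [t * p - r * q] is that of [p], and it is also that of [a * b]. If [a <= 0], both summands of
    [y = a * q + b * p] would be nonpositive. *)
Lemma Cdiv_Re_pos_aux (p q r t a b : R) :
  p * r < 0 -> 0 < q -> 0 < t ->
  r = (a * a - b * b) * p - 2 * a * b * q ->
  t = (a * a - b * b) * q + 2 * a * b * p ->
  0 < a * p - b * q + (a * q + b * p) -> 0 < a.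
Proof.
  intros Hpr Hq Ht Er Et Hs.
  remember (a * p - b * q) as x eqn:Ex. remember (a * q + b * p) as y eqn:Ey.
  assert (Hxy : x * x < y * y).
  { assert (E : x * x - y * y = p * r - q * t) by (rewrite Er, Et, Ex, Ey; ring).
    pose proof (Rmult_lt_0_compat _ _ Hq Ht). lra. }
  assert (Hy : 0 < y).
  { destruct (Rlt_or_le 0 y); [assumption|]. exfalso.
    assert (- y * - y <= x * x) by (apply Rmult_le_compat; lra). lra. }
  assert (Hi : t * p - r * q = 2 * (a * b) * (p * p + q * q)) by (rewrite Er, Et; ring).
  destruct (Rlt_or_le 0 a) as [|Ha]; [assumption|]. exfalso.
  assert (Hpq : 0 < p * p + q * q) by nra.
  destruct (Rlt_or_le 0 p) as [Hp|Hp].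
  - assert (Hr : r < 0) by nra.
    assert (0 < t * p) by nra. assert (r * q < 0) by nra.
    assert (0 < a * b).
    { apply Rnot_le_lt. intros Hab. assert (a * b * (p * p + q * q) <= 0) by nra. lra. }
    assert (b < 0) by nra. assert (a * q <= 0) by nra. assert (b * p < 0) by nra. lra.
  - assert (Hp' : p < 0) by nra. assert (Hr : 0 < r) by nra.
    assert (t * p < 0) by nra. assert (0 < r * q) by nra.
    assert (a * b < 0).
    { apply Rnot_le_lt. intros Hab. assert (0 <= a * b * (p * p + q * q)) by nra. lra. }
    assert (0 < b) by nra. assert (a * q <= 0) by nra. assert (b * p < 0) by nra. lra.
Qed.

(** The second conclusion fixes the sign of the jump: of the two square roots of [- eps2 / eps1],
    the one built from [Csqrt] lies in the upper half-plane. The product [eps1 * eps2] has negative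
    real part and hence avoids the cut. *)
Lemma Csqrt_mult_facts (eps1 eps2 : C) :
  Re eps1 * Re eps2 < 0 -> 0 < Im eps1 -> 0 < Im eps2 ->
  let s := Csqrt (eps1 * eps2) in
  (s * s = eps1 * eps2)%C /\ 0 < Im (Ci * s / eps1)%C.
Proof.
  intros Hre H1 H2 s.
  assert (E1 : eps1 <> 0) by (intros E; rewrite E in H1; simpl in H1; lra).
  assert (Hsl : slit (eps1 * eps2 / Ci)).
  { apply slit_Im. rewrite Cdiv_Ci. destruct eps1, eps2; unfold Re, Im in *; simpl in *. nra. }
  assert (Hss : (s * s)%C = (eps1 * eps2)%C) by (apply Csqrt_sqr, Hsl).
  split; [exact Hss|].
  assert (Hhp := Csqrt_half_plane _ Hsl). fold s in Hhp. clearbody s.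
  set (u := (s / eps1)%C).
  assert (Hs : s = (u * eps1)%C) by (unfold u; field; exact E1).
  assert (He2 : eps2 = (u * u * eps1)%C).
  { assert (eps1 * eps2 = eps1 * (u * u * eps1))%C by (rewrite <- Hss, Hs; ring).
    replace eps2 with (/ eps1 * (eps1 * eps2))%C by (field; exact E1).
    rewrite H. field. exact E1. }
  replace (Ci * s / eps1)%C with (Ci * u)%C by (unfold u; field; exact E1).
  replace (Im (Ci * u)) with (Re u) by (unfold Re, Im; simpl; ring).
  clearbody u. rewrite Hs in Hhp.
  apply (Cdiv_Re_pos_aux (Re eps1) (Im eps1) (Re eps2) (Im eps2) (Re u) (Im u)); try assumption.
  - rewrite He2 at 1. unfold Re, Im; simpl; ring.
  - rewrite He2 at 1. unfold Re, Im; simpl; ring.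
Qed.

(** * Integrals of complex-valued functions *)

Definition is_CInt (f : R -> C) (a b : R) (l : C) : Prop :=
  is_RInt (V := CV) f a b l.

Definition ex_CInt (f : R -> C) (a b : R) : Prop :=
  ex_RInt (V := CV) f a b.

Definition CInt (f : R -> C) (a b : R) : C :=
  RInt (V := CCV) f a b.

Lemma CInt_correct (f : R -> C) (a b : R) : ex_CInt f a b -> is_CInt f a b (CInt f a b).
Proof. apply (RInt_correct (V := CCV)). Qed.

Lemma is_CInt_unique (f : R -> C) (a b : R) (l : C) : is_CInt f a b l -> CInt f a b = l.
Proof. apply (is_RInt_unique (V := CCV)). Qed.

Lemma is_CInt_intro (f : R -> C) (a b : R) (l : C) :
  is_RInt (fun t => Re (f t)) a b (Re l) -> is_RInt (fun t => Im (f t)) a b (Im l) ->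
  is_CInt f a b l.
Proof.
  intros H1 H2. rewrite (surjective_pairing l).
  exact (is_RInt_fct_extend_pair (U := RV) (V := RV) f a b _ _ H1 H2).
Qed.

Lemma is_CInt_Re (f : R -> C) (a b : R) (l : C) :
  is_CInt f a b l -> is_RInt (fun t => Re (f t)) a b (Re l).
Proof. exact (is_RInt_fct_extend_fst (U := RV) (V := RV) f a b l). Qed.

Lemma is_CInt_Im (f : R -> C) (a b : R) (l : C) :
  is_CInt f a b l -> is_RInt (fun t => Im (f t)) a b (Im l).
Proof. exact (is_RInt_fct_extend_snd (U := RV) (V := RV) f a b l). Qed.

Lemma ex_CInt_continuous (f : R -> C) (a b : R) :
  a <= b -> (forall t, a <= t <= b -> Ccontinuous f t) -> ex_CInt f a b.
Proof.
  intros Hab H. apply (ex_RInt_continuous (V := CCV)).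
  rewrite Rmin_left, Rmax_right by exact Hab.
  intros t Ht. apply Ccontinuous_iff, H, Ht.
Qed.

Lemma is_CInt_derive (F f : R -> C) (a b : R) :
  a <= b -> (forall t, a <= t <= b -> is_Cderive F t (f t)) ->
  (forall t, a <= t <= b -> Ccontinuous f t) -> is_CInt f a b (F b - F a)%C.
Proof.
  intros Hab HF Hf.
  apply is_CInt_intro;
    [apply (is_RInt_derive (fun t => Re (F t)) (fun t => Re (f t))) |
     apply (is_RInt_derive (fun t => Im (F t)) (fun t => Im (f t)))];
    rewrite Rmin_left, Rmax_right by exact Hab; intros t Ht;
    apply (HF t Ht) || apply (Hf t Ht).
Qed.

Lemma is_CInt_scal (c : C) (f : R -> C) (a b : R) (l : C) :
  is_CInt f a b l -> is_CInt (fun t => c * f t)%C a b (c * l)%C.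
Proof.
  intros H. assert (H1 := is_CInt_Re _ _ _ _ H). assert (H2 := is_CInt_Im _ _ _ _ H).
  apply is_CInt_intro.
  - exact (is_RInt_minus (V := RV) _ _ _ _ _ _
      (is_RInt_scal (V := RV) _ _ _ (Re c) _ H1)
      (is_RInt_scal (V := RV) _ _ _ (Im c) _ H2)).
  - exact (is_RInt_plus (V := RV) _ _ _ _ _ _
      (is_RInt_scal (V := RV) _ _ _ (Re c) _ H2)
      (is_RInt_scal (V := RV) _ _ _ (Im c) _ H1)).
Qed.

Lemma is_CInt_minus (f g : R -> C) (a b : R) (l m : C) :
  is_CInt f a b l -> is_CInt g a b m -> is_CInt (fun t => f t - g t)%C a b (l - m)%C.
Proof. exact (is_RInt_minus (V := CV) f g a b l m). Qed.

Lemma is_CInt_Chasles (f : R -> C) (a b c : R) (l m : C) :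
  is_CInt f a b l -> is_CInt f b c m -> is_CInt f a c (l + m)%C.
Proof. exact (is_RInt_Chasles (V := CV) f a b c l m). Qed.

Lemma is_CInt_ext (f g : R -> C) (a b : R) (l : C) :
  a <= b -> (forall t, a < t < b -> f t = g t) -> is_CInt f a b l -> is_CInt g a b l.
Proof.
  intros Hab H. apply (is_RInt_ext (V := CV)).
  rewrite Rmin_left, Rmax_right by exact Hab. exact H.
Qed.

Lemma Cmod_is_CInt_le (f : R -> C) (k : R -> R) (a b : R) (l : C) (B : R) :
  a <= b -> (forall t, a <= t <= b -> Cmod (f t) <= k t) ->
  is_CInt f a b l -> is_RInt k a b B -> Cmod l <= B.
Proof.
  intros Hab H Hf Hk. rewrite Cmod_norm in *.
  apply (norm_RInt_le (V := CV) f k a b l B Hab); [|exact Hf|exact Hk].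
  intros t Ht. specialize (H t Ht). rewrite Cmod_norm in H. exact H.
Qed.

Lemma Cmod_is_CInt_le_const (f : R -> C) (a b : R) (l : C) (M : R) :
  a <= b -> (forall t, a <= t <= b -> Cmod (f t) <= M) ->
  is_CInt f a b l -> Cmod l <= M * (b - a).
Proof.
  intros Hab H Hf. apply (Cmod_is_CInt_le f (fun _ => M) a b l); try assumption.
  replace (M * (b - a)) with (scal (b - a) M) by (unfold scal; simpl; unfold mult; simpl; ring).
  apply (is_RInt_const (V := RV)).
Qed.

(** On the curve the integrand has a meaningless value at one parameter; splitting there leaves two
    open intervals on which it agrees with [h]. *)
Lemma ex_CInt_punctured (f h : R -> C) (a b c : R) :
  a <= c <= b -> (forall t, a <= t <= b -> Ccontinuous h t) ->
  (forall t, a <= t <= b -> t <> c -> f t = h t) -> ex_CInt f a b.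
Proof.
  intros Hc Hh Hfh.
  assert (Hpart : forall u v, a <= u -> u <= v -> v <= b -> (v <= c \/ c <= u) -> ex_CInt f u v).
  { intros u v Hau Huv Hvb Hside.
    apply (ex_RInt_ext (V := CV) h).
    - rewrite Rmin_left, Rmax_right by exact Huv. intros t Ht. symmetry. apply Hfh; lra.
    - apply ex_CInt_continuous; [exact Huv|]. intros t Ht. apply Hh. lra. }
  apply (ex_RInt_Chasles (V := CV)) with c; apply Hpart; lra.
Qed.

Lemma CInt_periodic (f : R -> C) (T a : R) :
  (forall t, f (t + T) = f t) -> 0 <= a <= T -> ex_CInt f a (a + T) ->
  is_CInt f 0 T (CInt f a (a + T)).
Proof.
  intros HT Ha Hex.
  assert (E1 : ex_CInt f a T) by (apply (ex_RInt_Chasles_1 (V := CCV)) with (a + T); [lra | exact Hex]).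
  assert (E2 : ex_CInt f T (a + T)) by (apply (ex_RInt_Chasles_2 (V := CCV)) with a; [lra | exact Hex]).
  apply CInt_correct in E1. apply CInt_correct in E2.
  assert (E3 : is_CInt f 0 a (CInt f T (a + T))).
  { apply is_CInt_ext with (fun y => scal (V := CV) 1 (f (1 * y + T))); [lra| |].
    - intros t _. rewrite Rmult_1_l, HT. apply (scal_one (V := CV)).
    - apply (is_RInt_comp_lin (V := CV)).
      replace (1 * 0 + T) with T by ring. replace (1 * a + T) with (a + T) by ring. exact E2. }
  replace (CInt f a (a + T)) with (CInt f T (a + T) + CInt f a T)%C.
  - exact (is_CInt_Chasles _ _ _ _ _ _ E3 E1).
  - rewrite Cplus_comm. symmetry. apply is_CInt_unique.
    exact (is_CInt_Chasles _ _ _ _ _ _ E1 E2).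
Qed.

(** Compactness of the interval: each [t] has its own radius, chosen by
    [constructive_indefinite_description], and [compactness_value_1d] gives a common one, up to a
    double negation. The halves arise because both [F x t] and [F x0 t] are compared with [F x0 u]
    at a nearby centre [u]. *)
Lemma continuous_uniform_on_interval (F : R2 -> R -> C) (x0 : R2) (a b : R) :
  (forall t, a <= t <= b ->
    Ccontinuous (U := prod_UniformSpace (prod_UniformSpace R_UniformSpace R_UniformSpace) R_UniformSpace)
      (fun p => F (fst p) (snd p)) (x0, t)) ->
  forall e, 0 < e -> exists d, 0 < d /\ forall x t, Cmod (x - x0)%C < d -> a <= t <= b ->
    Cmod (F x t - F x0 t) <= e.
Proof.
  intros H e He.
  assert (Hloc : forall t, exists d : posreal, a <= t <= b ->
    forall x s, Cmod (x - x0)%C < d -> Rabs (s - t) < d -> Cmod (F x s - F x0 t) < e / 2).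
  { intros t. destruct (classic (a <= t <= b)) as [Ht|Ht]; [|exists (mkposreal 1 Rlt_0_1); tauto].
    destruct (Ccontinuous_Cmod _ _ (H t Ht) (e / 2) ltac:(lra)) as [d Hd].
    exists d. intros _ x s Hx Hs. apply (Hd (x, s)). split; [split|].
    - eapply Rle_lt_trans; [|exact Hx]. apply (re_le_Cmod (x - x0)%C).
    - eapply Rle_lt_trans; [|exact Hx]. apply (Rabs_Im_le_Cmod (x - x0)%C).
    - exact Hs. }
  set (delta := fun t => proj1_sig (constructive_indefinite_description _ (Hloc t))).
  assert (Hdelta : forall t, a <= t <= b -> forall x s, Cmod (x - x0)%C < delta t ->
     Rabs (s - t) < delta t -> Cmod (F x s - F x0 t) < e / 2).
  { intros t. exact (proj2_sig (constructive_indefinite_description _ (Hloc t))). }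
  destruct (compactness_value_1d a b delta) as [d Hd].
  exists d. split; [apply cond_pos|]. intros x t Hx Ht.
  apply NNPP. intros Hneg. apply (Hd t Ht). intros [u [Hu [Htu Hdu]]]. apply Hneg.
  assert (B1 := Hdelta u Hu x t ltac:(lra) Htu).
  assert (Hx0 : Cmod (x0 - x0)%C < delta u).
  { replace (x0 - x0)%C with (RtoC 0) by ring. rewrite Cmod_0. apply cond_pos. }
  assert (B2 := Hdelta u Hu x0 t Hx0 Htu).
  replace (F x t - F x0 t)%C with (F x t - F x0 u + - (F x0 t - F x0 u))%C by ring.
  Cmod_triangle_le. rewrite Cmod_opp. lra.
Qed.

Lemma is_RInt_cauchy_kernel (h c a b : R) :
  0 < h -> a <= b -> exists B, is_RInt (fun t => h / (h ^ 2 + (t - c) ^ 2)) a b B /\ B <= PI.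
Proof.
  intros Hh Hab. exists (atan ((b - c) / h) - atan ((a - c) / h)). split.
  - apply (is_RInt_derive (fun t => atan ((t - c) / h))).
    + intros t _. auto_derive; [lra|]. field. 
      assert (0 < h ^ 2 + (t - c) ^ 2) by (pose proof (pow2_ge_0 (t - c)); nra).
      split; nra.
    + intros t _.
      assert (0 < h ^ 2 + (t - c) ^ 2) by (pose proof (pow2_ge_0 (t - c)); nra).
      apply (ex_derive_continuous (K := R_AbsRing) (V := RV)). auto_derive. lra.
  - pose proof (atan_bound ((b - c) / h)). pose proof (atan_bound ((a - c) / h)). lra.
Qed.

Lemma Rabs_derive_bound (f df : R -> R) (M x y : R) :
  (forall t, Rmin x y <= t <= Rmax x y -> is_derive f t (df t) /\ Rabs (df t) <= M) ->
  Rabs (f y - f x) <= M * Rabs (y - x).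
Proof.
  intros H. destruct (MVT_gen f x y df) as [c [Hc E]].
  - intros t Ht. apply H. lra.
  - intros t Ht. apply continuity_pt_filterlim.
    apply (ex_derive_continuous (K := R_AbsRing) (V := RV)).
    eexists. apply H. exact Ht.
  - rewrite E, Rabs_mult. apply Rmult_le_compat_r; [apply Rabs_pos | apply H, Hc].
Qed.

(** The mean value theorem applies to each component only, at different points; hence the factor
    [2]. *)
Lemma Cmod_Cderive_bound (f df : R -> C) (M x y : R) :
  (forall t, Rmin x y <= t <= Rmax x y -> is_Cderive f t (df t) /\ Cmod (df t) <= M) ->
  Cmod (f y - f x) <= 2 * M * Rabs (y - x).
Proof.
  intros H.
  assert (B1 : Rabs (Re (f y) - Re (f x)) <= M * Rabs (y - x)).
  { apply (Rabs_derive_bound (fun t => Re (f t)) (fun t => Re (df t))).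
    intros t Ht. destruct (H t Ht) as [[D _] B]. split; [exact D|].
    eapply Rle_trans; [apply re_le_Cmod | exact B]. }
  assert (B2 : Rabs (Im (f y) - Im (f x)) <= M * Rabs (y - x)).
  { apply (Rabs_derive_bound (fun t => Im (f t)) (fun t => Im (df t))).
    intros t Ht. destruct (H t Ht) as [[_ D] B]. split; [exact D|].
    eapply Rle_trans; [apply Rabs_Im_le_Cmod | exact B]. }
  eapply Rle_trans; [apply Cmod_le_Re_Im|].
  change (Rabs (Re (f y) - Re (f x)) + Rabs (Im (f y) - Im (f x)) <= 2 * M * Rabs (y - x)). lra.
Qed.

(** * Local geometry of a curve of class C^2 *)

Definition cross (u v : C) : R := fst u * snd v - snd u * fst v.

Lemma Rabs_cross_le (u v : C) : Rabs (cross u v) <= Cmod u * Cmod v.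
Proof.
  replace (cross u v) with (Im (Cconj u * v)) by (unfold cross, Im; simpl; ring).
  eapply Rle_trans; [apply Rabs_Im_le_Cmod|]. rewrite Cmod_mult, Cmod_conj. lra.
Qed.

Lemma Rabs_dot_le (u v : C) : Rabs (dot u v) <= Cmod u * Cmod v.
Proof.
  replace (dot u v) with (Re (Cconj u * v)) by (unfold dot, Re; simpl; ring).
  eapply Rle_trans; [apply re_le_Cmod|]. rewrite Cmod_mult, Cmod_conj. lra.
Qed.

Lemma Cmod_triangle_inv (u v : C) : Cmod u - Cmod v <= Cmod (u + v).
Proof.
  pose proof (Cmod_triangle (u + v) (- v)) as H. rewrite Cmod_opp in H.
  replace (u + v + - v)%C with u in H by ring. lra.
Qed.

(** For a curve with first and second derivatives [d] and [dd]: on the arc of half-length [eta] the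
    tangent deviates by at most [w], which makes the arc nearly straight, and [B] controls the
    curvature. All constants of the local estimates depend on these data only. *)
Definition frame (d dd : R -> C) (t0 w B eta : R) : Prop :=
  forall t, Rabs (t - t0) <= eta -> Cmod (d t - d t0) <= w /\ Cmod (dd t) <= B.

Lemma frame_mono (d dd : R -> C) (t0 w w' B eta eta' : R) :
  w <= w' -> eta' <= eta -> frame d dd t0 w B eta -> frame d dd t0 w' B eta'.
Proof. intros Hw He H t Ht. destruct (H t); lra. Qed.

Lemma Ccontinuous_R_Cmod (f : R -> C) (t0 e : R) :
  Ccontinuous f t0 -> 0 < e ->
  exists eta, 0 < eta /\ forall t, Rabs (t - t0) <= eta -> Cmod (f t - f t0) <= e.
Proof.
  intros H He. destruct (Ccontinuous_Cmod _ _ H e He) as [d Hd].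
  exists (d / 2). pose proof (cond_pos d). split; [lra|].
  intros t Ht. left. apply Hd. change (Rabs (t - t0) < d). lra.
Qed.

Lemma frame_exists (d dd : R -> C) (t0 w : R) :
  Ccontinuous d t0 -> Ccontinuous dd t0 -> 0 < w ->
  exists eta, 0 < eta /\ frame d dd t0 w (Cmod (dd t0) + 1) eta.
Proof.
  intros H1 H2 Hw.
  destruct (Ccontinuous_R_Cmod _ _ w H1 Hw) as [e1 [E1 D1]].
  destruct (Ccontinuous_R_Cmod _ _ 1 H2 Rlt_0_1) as [e2 [E2 D2]].
  exists (Rmin e1 e2). split; [apply Rmin_pos; assumption|].
  intros t Ht. split.
  - apply D1. eapply Rle_trans; [exact Ht | apply Rmin_l].
  - replace (dd t) with (dd t - dd t0 + dd t0)%C by ring.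
    Cmod_triangle_le.
    assert (Cmod (dd t - dd t0) <= 1); [|lra].
    apply D2. eapply Rle_trans; [exact Ht | apply Rmin_r].
Qed.

Lemma Rabs_between (t0 eta s t u : R) :
  Rabs (s - t0) <= eta -> Rabs (t - t0) <= eta -> Rmin s t <= u <= Rmax s t ->
  Rabs (u - t0) <= eta /\ Rabs (u - s) <= Rabs (t - s).
Proof.
  intros Hs Ht Hu. revert Hu. unfold Rmin, Rmax.
  destruct (Rle_dec s t); intros Hu; split; unfold Rabs in *;
    repeat destruct (Rcase_abs _); lra.
Qed.

Section Local.
Variables (g d dd : R -> C).
Hypothesis Hg : forall t, is_Cderive g t (d t).
Hypothesis Hd : forall t, is_Cderive d t (dd t).

Lemma frame_chord (t0 w B eta s t : R) :
  frame d dd t0 w B eta -> Rabs (s - t0) <= eta -> Rabs (t - t0) <= eta ->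
  Cmod (g t - g s - RtoC (t - s) * d t0) <= 2 * w * Rabs (t - s).
Proof.
  intros Hf Hs Ht.
  replace (g t - g s - RtoC (t - s) * d t0)%C with
    ((g t - RtoC t * d t0) - (g s - RtoC s * d t0))%C by (rewrite RtoC_minus; ring).
  apply (Cmod_Cderive_bound (fun u => g u - RtoC u * d t0)%C (fun u => d u - d t0)%C).
  intros u Hu. destruct (Rabs_between _ _ _ _ _ Hs Ht Hu) as [Hu0 _]. split.
  - eapply is_Cderive_eq.
    + apply is_Cderive_minus; [apply Hg|].
      apply is_Cderive_mult; [|apply is_Cderive_const].
      apply is_Cderive_RtoC. apply (is_derive_id (K := R_AbsRing)).
    + unfold one; simpl. ring.
  - apply Hf, Hu0.
Qed.

Lemma frame_chord_le (t0 w B eta s t : R) :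
  frame d dd t0 w B eta -> Rabs (s - t0) <= eta -> Rabs (t - t0) <= eta ->
  Cmod (g t - g s) <= (Cmod (d t0) + 2 * w) * Rabs (t - s).
Proof.
  intros Hf Hs Ht. pose proof (frame_chord _ _ _ _ _ _ Hf Hs Ht) as H.
  replace (g t - g s)%C with (g t - g s - RtoC (t - s) * d t0 + RtoC (t - s) * d t0)%C by ring.
  Cmod_triangle_le. rewrite Cmod_mult, Cmod_R. lra.
Qed.

Lemma frame_chord_ge (t0 w B eta s t : R) :
  frame d dd t0 w B eta -> Rabs (s - t0) <= eta -> Rabs (t - t0) <= eta ->
  (Cmod (d t0) - 2 * w) * Rabs (t - s) <= Cmod (g t - g s).
Proof.
  intros Hf Hs Ht. pose proof (frame_chord _ _ _ _ _ _ Hf Hs Ht) as H.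
  replace (g t - g s)%C with (RtoC (t - s) * d t0 + (g t - g s - RtoC (t - s) * d t0))%C by ring.
  eapply Rle_trans; [|apply Cmod_triangle_inv]. rewrite Cmod_mult, Cmod_R. lra.
Qed.

Lemma is_derive_cross (x : C) (t : R) :
  is_derive (fun u => cross (g u - x)%C (d u)) t (cross (g t - x)%C (dd t)).
Proof.
  destruct (Hg t) as [G1 G2]. destruct (Hd t) as [D1 D2]. unfold cross.
  evar_last.
  - apply (is_derive_minus (V := RV)); apply Derive.is_derive_mult.
    + apply (is_derive_minus (V := RV)); [exact G1 | apply is_derive_const].
    + exact D2.
    + apply (is_derive_minus (V := RV)); [exact G2 | apply is_derive_const].
    + exact D1.
  - unfold minus, plus, opp, zero; simpl. unfold Re, Im. ring.
Qed.

(** The cross product vanishes at [t = s], and in its derivative the term [cross (d u) (d u)] drops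
    out, leaving a chord times the second derivative. The resulting quadratic smallness is where
    class C^2 enters: it offsets the quadratic zero of the form. *)
Lemma frame_cross (t0 w B eta s t : R) :
  0 <= w -> frame d dd t0 w B eta -> Rabs (s - t0) <= eta -> Rabs (t - t0) <= eta ->
  Rabs (cross (g t - g s)%C (d t)) <= (Cmod (d t0) + 2 * w) * B * Rabs (t - s) ^ 2.
Proof.
  intros Hw Hf Hs Ht.
  replace (cross (g t - g s)%C (d t)) with
    (cross (g t - g s)%C (d t) - cross (g s - g s)%C (d s)).
  2:{ replace (g s - g s)%C with (RtoC 0) by ring. unfold cross; simpl. ring. }
  replace ((Cmod (d t0) + 2 * w) * B * Rabs (t - s) ^ 2) with
    ((Cmod (d t0) + 2 * w) * Rabs (t - s) * B * Rabs (t - s)) by ring.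
  apply (Rabs_derive_bound (fun u => cross (g u - g s)%C (d u)) (fun u => cross (g u - g s)%C (dd u))).
  intros u Hu. destruct (Rabs_between _ _ _ _ _ Hs Ht Hu) as [Hu0 Hus]. split.
  - apply is_derive_cross.
  - eapply Rle_trans; [apply Rabs_cross_le|].
    apply Rmult_le_compat; try apply Cmod_ge_0; [|apply Hf, Hu0].
    eapply Rle_trans; [apply (frame_chord_le _ _ _ _ _ _ Hf Hs Hu0)|].
    apply Rmult_le_compat_l; [pose proof (Cmod_ge_0 (d t0)); lra | exact Hus].
Qed.

(** Sharper than a quadratic bound: the leading coefficient is needed to give the integrand on the
    curve a limit at [t0]. The difference with the quadratic term has a derivative of size [e] times
    the distance to [t0], by continuity of [dd]. *)
Lemma cross_taylor (t0 : R) :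
  Ccontinuous dd t0 -> forall e, 0 < e -> exists eta, 0 < eta /\
  forall t, Rabs (t - t0) <= eta ->
    Rabs (cross (g t - g t0)%C (d t) - cross (d t0) (dd t0) / 2 * (t - t0) ^ 2) <=
    e * Rabs (t - t0) ^ 2.
Proof.
  intros Hdd e He.
  set (B := Cmod (dd t0) + 1). assert (HB : 1 <= B) by (pose proof (Cmod_ge_0 (dd t0)); unfold B; lra).
  set (l := Cmod (d t0)). assert (Hl : 0 <= l) by apply Cmod_ge_0.
  set (w := e / (4 * B)). assert (Hw : 0 < w) by (apply Rdiv_lt_0_compat; lra).
  set (w' := e / (2 * (l + 1))). assert (Hw' : 0 < w') by (apply Rdiv_lt_0_compat; lra).
  destruct (frame_exists d dd t0 w (is_Cderive_continuous _ _ _ (Hd t0)) Hdd Hw) as [e1 [E1 F1]].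
  destruct (Ccontinuous_R_Cmod _ _ w' Hdd Hw') as [e2 [E2 F2]].
  exists (Rmin e1 e2). split; [apply Rmin_pos; assumption|].
  intros t Ht.
  destruct (le_Rmin _ _ _ Ht) as [Ht1 Ht2].
  assert (Z : Rabs (t0 - t0) = 0) by (rewrite Rminus_diag; apply Rabs_R0).
  set (c := cross (d t0) (dd t0) / 2).
  replace (cross (g t - g t0)%C (d t) - c * (t - t0) ^ 2) with
    (cross (g t - g t0)%C (d t) - c * (t - t0) ^ 2 -
     (cross (g t0 - g t0)%C (d t0) - c * (t0 - t0) ^ 2)).
  2:{ replace (g t0 - g t0)%C with (RtoC 0) by ring. unfold cross; simpl. ring. }
  replace (e * Rabs (t - t0) ^ 2) with (e * Rabs (t - t0) * Rabs (t - t0)) by ring.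
  apply (Rabs_derive_bound (fun u => cross (g u - g t0)%C (d u) - c * (u - t0) ^ 2)
          (fun u => cross (g u - g t0)%C (dd u) - 2 * c * (u - t0))).
  intros u Hu.
  destruct (Rabs_between t0 e1 t0 t u ltac:(lra) Ht1 Hu) as [Hu1 Hut].
  split.
  - apply (is_derive_minus (V := RV)); [apply is_derive_cross|].
    auto_derive; [auto|ring].
  - replace (cross (g u - g t0)%C (dd u) - 2 * c * (u - t0)) with
      (cross (g u - g t0 - RtoC (u - t0) * d t0)%C (dd u) + (u - t0) * cross (d t0) (dd u - dd t0)%C)
      by (unfold c, cross; simpl; field).
    eapply Rle_trans; [apply Rabs_triang|]. rewrite Rabs_mult.
    assert (Hz : Rabs (t0 - t0) <= e1) by lra.
    pose proof (frame_chord _ _ _ _ _ _ F1 Hz Hu1) as C1.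
    pose proof (Rabs_cross_le (g u - g t0 - RtoC (u - t0) * d t0)%C (dd u)) as X1.
    pose proof (Rabs_cross_le (d t0) (dd u - dd t0)%C) as X2. fold l in X2.
    assert (F2u := F2 u ltac:(lra)). destruct (F1 u Hu1) as [_ F1u]. fold B in F1u.
    assert (Hru := Rabs_pos (u - t0)).
    assert (Y1 : Rabs (cross (g u - g t0 - RtoC (u - t0) * d t0)%C (dd u)) <= e / 2 * Rabs (u - t0)).
    { eapply Rle_trans; [exact X1|].
      apply Rle_trans with (2 * w * Rabs (u - t0) * B).
      - apply Rmult_le_compat; (apply Cmod_ge_0 || assumption).
      - right. unfold w. field. lra. }
    assert (Y2 : Rabs (u - t0) * Rabs (cross (d t0) (dd u - dd t0)%C) <= Rabs (u - t0) * (e / 2)).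
    { apply Rmult_le_compat_l; [exact Hru|]. eapply Rle_trans; [exact X2|].
      apply Rle_trans with ((l + 1) * w').
      - apply Rmult_le_compat; (apply Cmod_ge_0 || lra).
      - right. unfold w'. field. lra. }
    apply Rle_trans with (e * Rabs (u - t0)); [lra|].
    apply Rmult_le_compat_l; lra.
Qed.

(* The nearest point [g ts] to [x] splits the numerator into a part of size
   [(t - ts)^2] and a part of size [h]. *)
Lemma cross_kernel_bound (t0 w B eta ts : R) (x : C) :
  0 <= w -> 4 * w <= Cmod (d t0) -> 0 < Cmod (d t0) -> 0 <= B -> frame d dd t0 w B eta ->
  Rabs (ts - t0) <= eta -> 0 < Cmod (g ts - x) ->
  (forall t, Rabs (t - t0) <= eta -> Cmod (g ts - x) <= Cmod (g t - x)) ->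
  forall t, Rabs (t - t0) <= eta ->
  Rabs (cross (g t - x)%C (d t)) <=
  ((Cmod (d t0) + 2 * w) * B + 2 * Cmod (d t0)) * (1 + 16 / Cmod (d t0) ^ 2) *
  (1 + Cmod (g ts - x) / (Cmod (g ts - x) ^ 2 + (t - ts) ^ 2)) * Cmod (g t - x) ^ 2.
Proof.
  intros Hw Hwl Hl HB Hf Hts Hh Hmin t Ht.
  set (h := Cmod (g ts - x)) in *. set (l := Cmod (d t0)) in *.
  set (C1 := (l + 2 * w) * B). set (V := Cmod (g t - x)).
  assert (HC1 : 0 <= C1) by (apply Rmult_le_pos; lra).
  assert (HV : h <= V) by apply Hmin, Ht.
  assert (Hr := Rabs_pos (t - ts)).
  assert (Habs : (t - ts) ^ 2 = Rabs (t - ts) ^ 2) by (symmetry; apply pow2_abs).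
  rewrite Habs. set (r := Rabs (t - ts)) in *.
  assert (Hnum : Rabs (cross (g t - x)%C (d t)) <= C1 * r ^ 2 + 2 * l * h).
  { replace (cross (g t - x)%C (d t)) with
      (cross (g t - g ts)%C (d t) + cross (g ts - x)%C (d t)) by (unfold cross; simpl; ring).
    eapply Rle_trans; [apply Rabs_triang|]. apply Rplus_le_compat.
    - apply (frame_cross _ _ _ _ _ _ Hw Hf Hts Ht).
    - eapply Rle_trans; [apply Rabs_cross_le|]. fold h.
      assert (Cmod (d t) <= 2 * l).
      { replace (d t) with (d t - d t0 + d t0)%C by ring.
        Cmod_triangle_le. fold l. destruct (Hf t Ht). lra. }
      rewrite (Rmult_comm (2 * l)). apply Rmult_le_compat_l; lra. }
  (* As [g ts] is nearest to [x], the chord from [g ts] to [g t] is at most [2 * V], while it is at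
     least [l / 2 * r]. Squaring gives the [16] in the bound. *)
  assert (Hchord : l * r <= 4 * V).
  { assert (K1 := frame_chord_ge _ _ _ _ _ _ Hf Hts Ht). fold l r in K1.
    assert (K2 : Cmod (g t - g ts) <= V + h).
    { replace (g t - g ts)%C with ((g t - x) + - (g ts - x))%C by ring.
      Cmod_triangle_le. rewrite Cmod_opp. fold V h. lra. }
    assert (l / 2 * r <= (l - 2 * w) * r) by (apply Rmult_le_compat_r; lra). lra. }
  set (D := h ^ 2 + r ^ 2).
  assert (HD : 0 < D) by (unfold D; pose proof (pow2_ge_0 r); nra).
  assert (HDV : D <= (1 + 16 / l ^ 2) * V ^ 2).
  { unfold D. replace ((1 + 16 / l ^ 2) * V ^ 2) with (V ^ 2 + (4 * V / l) ^ 2) by (field; lra).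
    apply Rplus_le_compat; apply pow_incr; split; try lra.
    apply (Rmult_le_reg_l l); [exact Hl|]. replace (l * (4 * V / l)) with (4 * V) by (field; lra).
    exact Hchord. }
  eapply Rle_trans; [exact Hnum|].
  replace ((C1 + 2 * l) * (1 + 16 / l ^ 2) * (1 + h / D) * V ^ 2) with
    ((C1 + 2 * l) * ((1 + h / D) * ((1 + 16 / l ^ 2) * V ^ 2))) by ring.
  assert (Hk : 0 <= h / D) by (left; apply Rdiv_lt_0_compat; lra).
  apply Rle_trans with ((C1 + 2 * l) * (D + h)).
  - assert (0 <= r ^ 2) by apply pow2_ge_0. assert (0 <= h ^ 2) by apply pow2_ge_0.
    unfold D. nra.
  - apply Rmult_le_compat_l; [lra|].
    replace (D + h) with ((1 + h / D) * D) by (field; lra).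
    apply Rmult_le_compat_l; lra.
Qed.

End Local.

(** * The jump of the static kernel *)

Definition lin (rho : C) (v : R2) : C := (RtoC (fst v) + rho * RtoC (snd v))%C.

(** The clockwise quarter turn, chosen so that [dot u (rot v) = cross u v]. *)
Definition rot (v : R2) : C := (snd v, - fst v).

Lemma lin_neq_0 (rho : C) (v : R2) : Im rho <> 0 -> v <> (0, 0) -> lin rho v <> 0.
Proof.
  intros Hr Hv E. apply Hv. destruct v as [a b]. 
  assert (E1 := f_equal Re E). assert (E2 := f_equal Im E).
  unfold lin, Re, Im, Cplus, Cmult, RtoC in *. simpl in *.
  assert (Hb : b = 0).
  { apply (Rmult_eq_reg_l (snd rho)); [lra|exact Hr]. }
  subst b. f_equal. lra.
Qed.

Lemma lin_factor (eps1 eps2 rho : C) (v : R2) :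
  eps1 <> 0 -> (rho * rho * eps1)%C = (- eps2)%C ->
  quad eps1 eps2 v = (eps1 * (lin rho v * lin (- rho) v))%C.
Proof.
  intros H1 H. unfold quad, lin. 
  replace eps2 with (- (rho * rho * eps1))%C by (rewrite H; ring).
  ring.
Qed.

(** As a real-linear map of the plane, [lin rho] has determinant [Im rho], so it preserves or
    reverses the orientation of the pair [m], [v] according to the sign of [Im rho]. *)
Lemma lin_Im (rho : C) (v m : R2) :
  Im rho <> 0 -> m <> (0, 0) ->
  Im (lin rho v / lin rho m) = Im rho * cross m v / Cmod (lin rho m) ^ 2.
Proof.
  intros Hr Hm. assert (Hl := lin_neq_0 _ _ Hr Hm).
  assert (Hp : Re (lin rho m) ^ 2 + Im (lin rho m) ^ 2 <> 0).
  { rewrite <- Cmod2_alt. apply pow_nonzero. apply Cmod_gt_0 in Hl. lra. }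
  rewrite Cmod2_alt. revert Hp. 
  destruct rho, v, m. unfold cross, lin, Re, Im, Cdiv, Cinv, Cplus, Cmult, RtoC. simpl. 
  intros Hp. field. intros E. apply Hp. etransitivity; [|exact E]. ring.
Qed.

(** Injectivity of the real-linear map [lin rho]: a nonpositive real ratio [r] of the images forces
    [v] to be [r] times [m]. *)
Lemma lin_slit (rho : C) (v m : R2) :
  Im rho <> 0 -> m <> (0, 0) ->
  (forall r, r <= 0 -> v <> (RtoC r * m)%C) -> slit (lin rho v / lin rho m).
Proof.
  intros Hr Hm Hv. apply slit_iff. intros [HI HR].
  assert (Hl := lin_neq_0 _ _ Hr Hm).
  set (z := (lin rho v / lin rho m)%C) in *. apply (Hv (Re z) HR).
  assert (Hz : z = RtoC (Re z)).
  { rewrite (surjective_pairing z) at 1. change (snd z) with (Im z). rewrite HI. reflexivity. }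
  assert (E : lin rho v = (RtoC (Re z) * lin rho m)%C).
  { rewrite <- Hz. unfold z. field. exact Hl. }
  set (r := Re z) in *. clearbody r. clear - E Hr.
  assert (E1 := f_equal Re E). assert (E2 := f_equal Im E).
  destruct v as [v1 v2], m as [m1 m2], rho as [a b].
  unfold lin, Re, Im, Cplus, Cmult, RtoC in *. simpl in *.
  assert (H2 : v2 = r * m2) by (apply (Rmult_eq_reg_l b); [lra | exact Hr]).
  f_equal; [|lra]. rewrite H2 in E1. lra.
Qed.

(** Division by [lin rho m] moves the branch cut to the ray opposite to [m]. The ray is the same for
    [rho] and [- rho], so one geometric condition on [v] serves both logarithms. *)
Definition log_ratio (rho : C) (m v : R2) : C := Clog (lin rho v / lin rho m).

Lemma Ccontinuous_log_ratio (rho : C) (m v : R2) :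
  Im rho <> 0 -> m <> (0, 0) -> slit (lin rho v / lin rho m) ->
  Ccontinuous (log_ratio rho m) v.
Proof.
  intros Hr Hm Hs. apply (Ccontinuous_comp_C (fun u => lin rho u / lin rho m)%C Clog).
  - apply Ccontinuous_div; [|apply Ccontinuous_const | apply lin_neq_0; assumption].
    unfold lin. apply Ccontinuous_plus.
    + apply Ccontinuous_RtoC, continuous_fst.
    + apply Ccontinuous_mult; [apply Ccontinuous_const | apply Ccontinuous_RtoC, continuous_snd].
  - apply Ccontinuous_Clog, Hs.
Qed.

Lemma log_ratio_scal (rho : C) (m v : R2) (r : R) :
  Im rho <> 0 -> m <> (0, 0) -> v <> (0, 0) -> 0 < r ->
  log_ratio rho m (RtoC r * v)%C = (RtoC (ln r) + log_ratio rho m v)%C.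
Proof.
  intros Hr Hm Hv Hpos. unfold log_ratio.
  assert (L1 := lin_neq_0 _ _ Hr Hm). assert (L2 := lin_neq_0 _ _ Hr Hv).
  rewrite <- Clog_scal; [|exact Hpos|].
  - f_equal. unfold Cdiv. rewrite Cmult_assoc. f_equal.
    unfold lin, Cmult, Cplus, RtoC; simpl. f_equal; ring.
  - intros E. apply L2. replace (lin rho v) with (lin rho v / lin rho m * lin rho m)%C by (field; exact L1).
    rewrite E. ring.
Qed.

Lemma log_ratio_opp (rho : C) (m v : R2) (sg : R) :
  m <> (0, 0) -> sg = 1 \/ sg = -1 -> 0 < sg * (Im rho * cross m v) ->
  (log_ratio rho m v - log_ratio rho m (- v)%C)%C = (RtoC sg * (Ci * RtoC PI))%C.
Proof.
  intros Hm Hsg H.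
  assert (Hr : Im rho <> 0) by (intros E; rewrite E in H; lra).
  assert (L := lin_neq_0 _ _ Hr Hm). assert (Lp := proj1 (Cmod_gt_0 _) L).
  assert (Hp : 0 < / Cmod (lin rho m) ^ 2) by (apply Rinv_0_lt_compat, pow_lt, Lp).
  assert (HI := lin_Im rho v m Hr Hm).
  unfold log_ratio. set (z := (lin rho v / lin rho m)%C) in *.
  replace (lin rho (- v)%C / lin rho m)%C with (- z)%C.
  2:{ unfold z, lin. simpl. rewrite !RtoC_opp. field. exact L. }
  unfold Rdiv in HI.
  destruct Hsg as [-> | ->].
  - rewrite Clog_opp_pos; [ring|]. rewrite HI. apply Rmult_lt_0_compat; lra.
  - rewrite Clog_opp_neg; [ring|]. rewrite HI.
    assert (0 < - (Im rho * cross m v) * / Cmod (lin rho m) ^ 2) by (apply Rmult_lt_0_compat; lra). lra.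
Qed.

(** Homogeneous of degree zero in [v]: the real logarithms of a positive factor cancel, so only the
    direction of [v] matters. *)
Definition angle_diff (rho : C) (m v : R2) : C :=
  (log_ratio rho m v - log_ratio (- rho) m v)%C.

(** By homogeneity the endpoints may be divided by [eta], after which they are close to [d0] and
    [- d0], where both logarithms are continuous. Between these two vectors each logarithm changes
    by [PI] in the imaginary part, with opposite signs as [Im (- rho) = - Im rho]; the difference
    changes by twice that. *)
Lemma angle_diff_jump (rho : C) (m d0 : R2) (sg : R) :
  0 < Im rho -> sg = 1 \/ sg = -1 -> 0 < sg * cross m d0 ->
  forall e, 0 < e -> exists w, 0 < w /\ forall eta vp vm, 0 < eta ->
    Cmod (vp - RtoC eta * d0)%C <= w * eta -> Cmod (vm + RtoC eta * d0)%C <= w * eta ->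
    Cmod (angle_diff rho m vp - angle_diff rho m vm - RtoC sg * (RtoC 2 * Ci * RtoC PI)) <= e.
Proof.
  intros Hrho Hsg Hc e He.
  assert (Hm : m <> (0, 0)).
  { intros E. rewrite E in Hc. unfold cross in Hc; simpl in Hc. lra. }
  assert (Hd0 : d0 <> (0, 0)).
  { intros E. rewrite E in Hc. unfold cross in Hc; simpl in Hc. lra. }
  assert (Hcr : cross m d0 <> 0) by (intros E; rewrite E in Hc; lra).
  assert (Hr : Im rho <> 0) by lra. assert (Hr' : Im (- rho) <> 0) by (simpl; unfold Im in Hr; lra).
  assert (HL : forall r u, Im r <> 0 -> cross m u <> 0 -> Ccontinuous (log_ratio r m) u).
  { intros r u Hri Hu. apply Ccontinuous_log_ratio; [exact Hri | exact Hm|].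
    apply slit_Im. rewrite lin_Im by assumption.
    assert (L := proj1 (Cmod_gt_0 _) (lin_neq_0 _ _ Hri Hm)).
    unfold Rdiv. repeat apply Rmult_integral_contrapositive_currified; try assumption.
    apply Rinv_neq_0_compat, pow_nonzero. lra. }
  assert (HA : forall u, cross m u <> 0 -> Ccontinuous (angle_diff rho m) u).
  { intros u Hu. apply Ccontinuous_minus; apply HL; assumption. }
  assert (Hcr' : cross m (- d0)%C <> 0) by (unfold cross in *; simpl; lra).
  destruct (proj1 (locally_Cmod _ _) (Ccontinuous_Cmod _ _ (HA d0 Hcr) (e / 2) ltac:(lra))) as [w1 [W1 D1]].
  destruct (proj1 (locally_Cmod _ _) (Ccontinuous_Cmod _ _ (HA (- d0)%C Hcr') (e / 2) ltac:(lra))) as [w2 [W2 D2]].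
  assert (Hd0p := proj1 (Cmod_gt_0 d0) Hd0).
  set (w := Rmin (Rmin w1 w2) (Cmod d0) / 2).
  assert (Hw : 0 < w /\ w < w1 /\ w < w2 /\ w < Cmod d0).
  { assert (0 < Rmin (Rmin w1 w2) (Cmod d0)) by (repeat apply Rmin_pos; assumption).
    pose proof (Rmin_l (Rmin w1 w2) (Cmod d0)). pose proof (Rmin_r (Rmin w1 w2) (Cmod d0)).
    pose proof (Rmin_l w1 w2). pose proof (Rmin_r w1 w2). unfold w. lra. }
  exists w. split; [apply Hw|].
  intros eta vp vm Heta Hvp Hvm.
  assert (Heta0 : RtoC eta <> 0) by (apply RtoC_neq_0; lra).
  assert (Hnorm : forall v u0, Cmod (v - RtoC eta * u0)%C <= w * eta ->
            Cmod u0 = Cmod d0 ->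
            exists u, v = (RtoC eta * u)%C /\ Cmod (u - u0)%C <= w /\ u <> (0, 0)).
  { intros v u0 Hv Hu0. exists (/ RtoC eta * v)%C.
    assert (Hu : Cmod (/ RtoC eta * v - u0)%C <= w).
    { replace (/ RtoC eta * v - u0)%C with (/ RtoC eta * (v - RtoC eta * u0))%C by (field; exact Heta0).
      rewrite Cmod_mult, Cmod_inv, Cmod_R, Rabs_pos_eq by (assumption || lra).
      apply (Rmult_le_reg_l eta); [exact Heta|]. rewrite <- Rmult_assoc, Rinv_r by lra. lra. }
    split; [field; exact Heta0|]. split; [exact Hu|].
    intros E. rewrite E in Hu. change (0, 0) with (RtoC 0) in Hu.
    replace (RtoC 0 - u0)%C with (- u0)%C in Hu by ring. rewrite Cmod_opp, Hu0 in Hu. lra. }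
  destruct (Hnorm vp d0 Hvp eq_refl) as [up [-> [Up Up0]]].
  destruct (Hnorm vm (- d0)%C) as [um [-> [Um Um0]]].
  { replace (vm - RtoC eta * - d0)%C with (vm + RtoC eta * d0)%C by ring. exact Hvm. }
  { apply Cmod_opp. }
  assert (Hinv : forall u, u <> (0, 0) -> angle_diff rho m (RtoC eta * u)%C = angle_diff rho m u).
  { intros u Hu. unfold angle_diff. rewrite !log_ratio_scal by assumption. ring. }
  rewrite !Hinv by assumption.
  assert (A1 := D1 up ltac:(lra)). assert (A2 := D2 um ltac:(lra)).
  assert (Hjump : (angle_diff rho m d0 - angle_diff rho m (- d0)%C)%C = (RtoC sg * (RtoC 2 * Ci * RtoC PI))%C).
  { unfold angle_diff.
    assert (J1 := log_ratio_opp rho m d0 sg Hm Hsg).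
    assert (J2 := log_ratio_opp (- rho) m d0 (- sg) Hm).
    specialize (J1 ltac:(nra)).
    specialize (J2 ltac:(lra)).
    assert (Hj : 0 < - sg * (Im (- rho) * cross m d0)).
    { replace (Im (- rho)) with (- Im rho) by reflexivity. nra. }
    specialize (J2 Hj). rewrite RtoC_opp in J2.
    replace (log_ratio rho m d0 - log_ratio (- rho) m d0 -
      (log_ratio rho m (- d0)%C - log_ratio (- rho) m (- d0)%C))%C with
      ((log_ratio rho m d0 - log_ratio rho m (- d0)%C) -
       (log_ratio (- rho) m d0 - log_ratio (- rho) m (- d0)%C))%C by ring.
    rewrite J1, J2. replace (RtoC 2) with (1 + 1)%C by (rewrite <- RtoC_plus; reflexivity). ring. }
  rewrite <- Hjump.
  replace (angle_diff rho m up - angle_diff rho m um -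
    (angle_diff rho m d0 - angle_diff rho m (- d0)%C))%C with
    ((angle_diff rho m up - angle_diff rho m d0) + - (angle_diff rho m um - angle_diff rho m (- d0)%C))%C by ring.
  Cmod_triangle_le. rewrite Cmod_opp. lra.
Qed.

Section Static.
Variables (g d dd : R -> C) (eps1 eps2 rho : C).
Hypothesis Hg : forall t, is_Cderive g t (d t).
Hypothesis Hd : forall t, is_Cderive d t (dd t).
Hypothesis Heps1 : eps1 <> 0.
Hypothesis Hrho : 0 < Im rho.
Hypothesis Hrho2 : (rho * rho * eps1)%C = (- eps2)%C.

Lemma Ccontinuous_cross_quad (x : C) (t : R) :
  quad eps1 eps2 (g t - x)%C <> 0 ->
  Ccontinuous (fun u => RtoC (cross (g u - x)%C (d u)) / quad eps1 eps2 (g u - x)%C)%C t.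
Proof.
  intros Hq. apply Ccontinuous_div.
  - apply Ccontinuous_RtoC. eapply continuous_of_derive. apply (is_derive_cross g d dd Hg Hd).
  - apply (Ccontinuous_comp_C (fun u => g u - x)%C (quad eps1 eps2)).
    + apply Ccontinuous_minus; [|apply Ccontinuous_const]. apply (is_Cderive_continuous _ _ _ (Hg t)).
    + apply Ccontinuous_quad.
  - exact Hq.
Qed.

Lemma is_Cderive_lin (r : C) (x : C) (t : R) :
  is_Cderive (fun u => lin r (g u - x)%C) t (lin r (d t)).
Proof.
  assert (H : is_Cderive (fun u => g u - x)%C t (d t)).
  { eapply is_Cderive_eq; [apply is_Cderive_minus; [apply Hg | apply is_Cderive_const] | ring]. }
  destruct H as [H1 H2]. unfold lin. apply is_Cderive_plus.
  - apply is_Cderive_RtoC, H1.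
  - apply is_Cderive_scal, is_Cderive_RtoC, H2.
Qed.

(** The derivative of [angle_diff] along the curve has numerator [lin rho d * lin (- rho) v - lin
    rho v * lin (- rho) d], which equals [2 * rho] times [cross v d], over the product of the linear
    factors. The path must stay off the cut. *)
Lemma static_integral (x : C) (m : R2) (a b : R) :
  a <= b -> m <> (0, 0) ->
  (forall t, a <= t <= b -> forall r, r <= 0 -> (g t - x)%C <> (RtoC r * m)%C) ->
  is_CInt (fun t => RtoC (cross (g t - x)%C (d t)) / quad eps1 eps2 (g t - x)%C)%C a b
    (/ (RtoC 2 * rho * eps1) *
     (angle_diff rho m (g b - x)%C - angle_diff rho m (g a - x)%C))%C.
Proof.
  intros Hab Hm Hav.
  assert (Hr : Im rho <> 0) by lra.
  assert (Hr' : Im (- rho) <> 0) by (simpl; unfold Im in Hr; lra).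
  assert (Hrho0 : rho <> 0) by (intros E; rewrite E in Hr; simpl in Hr; lra).
  assert (Hv0 : forall t, a <= t <= b -> (g t - x)%C <> (0, 0)).
  { intros t Ht E. apply (Hav t Ht 0); [lra|]. rewrite E. change (0, 0) with (RtoC 0). ring. }
  assert (Hlm := lin_neq_0 _ _ Hr Hm). assert (Hlm' := lin_neq_0 _ _ Hr' Hm).
  replace (/ (RtoC 2 * rho * eps1) *
     (angle_diff rho m (g b - x)%C - angle_diff rho m (g a - x)%C))%C with
    (/ (RtoC 2 * rho * eps1) * angle_diff rho m (g b - x)%C -
     / (RtoC 2 * rho * eps1) * angle_diff rho m (g a - x)%C)%C by ring.
  apply (is_CInt_derive (fun t => / (RtoC 2 * rho * eps1) * angle_diff rho m (g t - x)%C)%C);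
    [exact Hab| |].
  - intros t Ht.
    assert (Hl := lin_neq_0 _ _ Hr (Hv0 t Ht)). assert (Hl' := lin_neq_0 _ _ Hr' (Hv0 t Ht)).
    assert (E2 : RtoC 2 <> 0) by (apply RtoC_neq_0; lra).
    unfold angle_diff, log_ratio. eapply is_Cderive_eq.
    + apply is_Cderive_scal. apply is_Cderive_minus.
      * apply (is_Cderive_Clog (fun t => lin rho (g t - x)%C / lin rho m)%C).
        -- apply lin_slit; [exact Hr | exact Hm | apply Hav, Ht].
        -- apply is_Cderive_mult; [apply is_Cderive_lin | apply is_Cderive_const].
      * apply (is_Cderive_Clog (fun t => lin (- rho) (g t - x)%C / lin (- rho) m)%C).
        -- apply lin_slit; [exact Hr' | exact Hm | apply Hav, Ht].
        -- apply is_Cderive_mult; [apply is_Cderive_lin | apply is_Cderive_const].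
    + rewrite (lin_factor eps1 eps2 rho) by assumption. cbv beta.
      set (v := (g t - x)%C) in *. clearbody v.
      replace (RtoC (cross v (d t))) with
        ((lin rho (d t) * lin (- rho) v - lin rho v * lin (- rho) (d t)) / (RtoC 2 * rho))%C.
      2:{ unfold lin, cross. rewrite RtoC_minus, !RtoC_mult. field. tauto. }
      field. tauto.
  - intros t Ht. apply Ccontinuous_cross_quad.
    rewrite (lin_factor eps1 eps2 rho) by assumption.
    assert (Hl := lin_neq_0 _ _ Hr (Hv0 t Ht)). assert (Hl' := lin_neq_0 _ _ Hr' (Hv0 t Ht)).
    apply Cmult_neq_0; [exact Heps1|]. apply Cmult_neq_0; assumption.
Qed.

(* This keeps [log_ratio] off the branch cut along the arc near [t0]. *)
Lemma frame_avoids_ray (t0 w B eta ts h sg t r : R) (x : C) :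
  0 < w -> 4 * w <= Cmod (d t0) -> frame d dd t0 w B eta ->
  Rabs (ts - t0) <= eta -> Rabs (t - t0) <= eta ->
  sg = 1 \/ sg = -1 -> 0 < sg * h -> x = (g ts + RtoC h * rot (d ts))%C -> r <= 0 ->
  (g t - x)%C <> (RtoC r * (RtoC (- sg) * rot (d t0)))%C.
Proof.
  intros Hw Hwl Hf Hts Ht Hsg Hh -> Hr E.
  set (l := Cmod (d t0)) in *. assert (Hl : 0 < l) by lra.
  assert (Hch := frame_chord g d dd Hg _ _ _ _ _ _ Hf Hts Ht).
  set (Q := (g t - g ts - RtoC (t - ts) * d t0)%C) in *.
  assert (Hrot : forall u, Cmod (rot u) = Cmod u).
  { intros u. unfold Cmod, rot; simpl. f_equal. ring. }
  destruct (Hf ts Hts) as [HS _].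
  assert (Hll : l ^ 2 = fst (d t0) ^ 2 + snd (d t0) ^ 2) by apply Cmod_R2_sqr.
  set (k := Rabs (t - ts)) in *. assert (Hk : 0 <= k) by apply Rabs_pos.
  set (a := sg * h) in *.
  assert (Ea : Rabs h = a).
  { unfold a. destruct Hsg as [-> | ->]; [rewrite Rabs_pos_eq | rewrite Rabs_left]; unfold a in Hh; lra. }
  assert (Hsg2 : sg * sg = 1) by (destruct Hsg as [-> | ->]; lra).
  assert (E' : (RtoC (t - ts) * d t0 + Q)%C =
     (RtoC h * rot (d ts) + RtoC r * (RtoC (- sg) * rot (d t0)))%C).
  { rewrite <- E. unfold Q. ring. }
  clearbody Q. set (S := (d ts - d t0)%C) in *.
  assert (ES : d ts = (d t0 + S)%C) by (unfold S; ring). rewrite ES in E'. clearbody S.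
  assert (Hsgr : 0 <= - r) by lra.
  (* The supposed equality is projected on the normal and, in [N2], on the tangent at [t0]. Here [Q]
     is the chord error and [S] the deviation of the tangent at [ts]. *)
  assert (N1 : sg * dot Q (rot (d t0)) = a * (l ^ 2 + dot S (d t0)) + - r * l ^ 2).
  { assert (dot (RtoC (t - ts) * d t0 + Q)%C (rot (d t0)) = dot Q (rot (d t0))).
    { unfold dot, rot; simpl. ring. }
    rewrite <- H, E'. unfold a. rewrite Hll. unfold dot, rot; simpl.
    transitivity (sg * h * (fst (d t0) ^ 2 + snd (d t0) ^ 2 + (fst S * fst (d t0) + snd S * snd (d t0))) -
       r * (sg * sg) * (fst (d t0) ^ 2 + snd (d t0) ^ 2)); [ring|]. rewrite Hsg2. ring. }
  assert (N2 : (t - ts) * l ^ 2 + dot Q (d t0) = h * cross (d t0) S).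
  { assert (H : dot (RtoC (t - ts) * d t0 + Q)%C (d t0) = (t - ts) * l ^ 2 + dot Q (d t0)).
    { rewrite Hll. unfold dot; simpl. ring. }
    rewrite <- H, E'. unfold dot, rot, cross; simpl. ring. }
  assert (B1 := Rabs_dot_le Q (rot (d t0))). rewrite Hrot in B1. fold l in B1.
  assert (B2 := Rabs_dot_le Q (d t0)). fold l in B2.
  assert (B3 := Rabs_dot_le S (d t0)). fold l in B3.
  assert (B4 := Rabs_cross_le (d t0) S). fold l in B4.
  assert (HQl : Cmod Q * l <= 2 * w * k * l) by (apply Rmult_le_compat_r; lra).
  assert (HSl : Cmod S * l <= w * l) by (apply Rmult_le_compat_r; lra).
  assert (M1 : a * (l - w) <= 2 * w * k).
  { apply (Rmult_le_reg_r l); [exact Hl|].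
    assert (sg * dot Q (rot (d t0)) <= Rabs (dot Q (rot (d t0)))).
    { destruct Hsg as [-> | ->]; unfold Rabs; destruct (Rcase_abs _); lra. }
    assert (- (w * l) <= dot S (d t0)).
    { apply Rabs_le_between in B3. lra. }
    assert (a * (l ^ 2 - w * l) <= a * (l ^ 2 + dot S (d t0))) by (apply Rmult_le_compat_l; lra).
    assert (0 <= - r * l ^ 2) by (apply Rmult_le_pos; [lra | apply pow2_ge_0]).
    replace (a * (l - w) * l) with (a * (l ^ 2 - w * l)) by ring. lra. }
  assert (M2 : k * (l - 2 * w) <= a * w).
  { apply (Rmult_le_reg_r l); [exact Hl|].
    assert (X : Rabs ((t - ts) * l ^ 2) <= Rabs (dot Q (d t0)) + Rabs (h * cross (d t0) S)).
    { replace ((t - ts) * l ^ 2) with (- dot Q (d t0) + h * cross (d t0) S) by lra.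
      eapply Rle_trans; [apply Rabs_triang|]. rewrite Rabs_Ropp. lra. }
    rewrite !Rabs_mult, Ea in X. fold k in X. rewrite (Rabs_pos_eq (l ^ 2)) in X by apply pow2_ge_0.
    assert (a * Rabs (cross (d t0) S) <= a * (w * l)) by (apply Rmult_le_compat_l; lra).
    replace (k * (l - 2 * w) * l) with (k * l ^ 2 - 2 * w * k * l) by ring. lra. }
  (* With [4 * w <= l], [M1] gives [3 * a <= 2 * k] and [M2] gives [2 * k <= a], contrary to
     [a > 0]. *)
  nra.
Qed.

(** The reference direction [RtoC (- sg) * rot (d t0)] points from [x] back to the curve, so the cut
    runs away from it. Seen from [x], the ends of the arc lie nearly along [d t0] and its opposite,
    and [w0] does not depend on [eta] or on the position of [x]. *)
Lemma static_jump (t0 : R) :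
  d t0 <> 0 -> forall e, 0 < e -> exists w0, 0 < w0 /\
  forall w B eta ts h sg x, 0 < w <= w0 -> frame d dd t0 w B eta -> 0 < eta ->
    Rabs (ts - t0) <= eta -> sg = 1 \/ sg = -1 -> 0 < sg * h ->
    x = (g ts + RtoC h * rot (d ts))%C -> Cmod (x - g t0) <= w * eta ->
    exists I, is_CInt (fun t => RtoC (cross (g t - x)%C (d t)) / quad eps1 eps2 (g t - x)%C)%C
                (t0 - eta) (t0 + eta) I /\
      Cmod (I - RtoC (- sg) * (Ci * RtoC PI / (rho * eps1))) <= e.
Proof.
  intros Hd0 e He.
  assert (Hl : 0 < Cmod (d t0)) by (apply Cmod_gt_0, Hd0).
  assert (Hrho0 : rho <> 0) by (intros E; rewrite E in Hrho; simpl in Hrho; lra).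
  assert (E2 : RtoC 2 <> 0) by (apply RtoC_neq_0; lra).
  set (c := Cmod (/ (RtoC 2 * rho * eps1))).
  assert (Hc : 0 < c).
  { unfold c. apply Cmod_gt_0. intros E.
    assert (RtoC 1 = RtoC 0).
    { replace (RtoC 1) with ((RtoC 2 * rho * eps1) * / (RtoC 2 * rho * eps1))%C by (field; tauto).
      rewrite E. ring. }
    apply RtoC_inj in H. lra. }
  assert (Hcross : forall sg, sg = 1 \/ sg = -1 ->
            0 < - sg * cross (RtoC (- sg) * rot (d t0))%C (d t0)).
  { intros sg Hsg.
    replace (- sg * cross (RtoC (- sg) * rot (d t0))%C (d t0)) with (sg * sg * Cmod (d t0) ^ 2).
    - replace (sg * sg) with 1 by (destruct Hsg as [-> | ->]; lra). nra.
    - rewrite Cmod_R2_sqr. unfold cross, rot; simpl. ring. }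
  assert (Hm : forall sg, sg = 1 \/ sg = -1 -> (RtoC (- sg) * rot (d t0))%C <> (0, 0)).
  { intros sg Hsg E. specialize (Hcross sg Hsg). rewrite E in Hcross.
    unfold cross in Hcross; simpl in Hcross. lra. }
  assert (He' : 0 < e / c) by (apply Rdiv_lt_0_compat; assumption).
  destruct (angle_diff_jump rho _ (d t0) (- (1)) Hrho ltac:(lra) (Hcross 1 ltac:(lra)) _ He') as [w1 [W1 J1]].
  destruct (angle_diff_jump rho _ (d t0) (- (-1)) Hrho ltac:(lra) (Hcross (-1) ltac:(lra)) _ He') as [w2 [W2 J2]].
  (* The end vectors miss their model directions by [2 * w * eta] from the chord and [w * eta] from
     the displacement of [x], so [3 * w0] must stay below [w1] and [w2]; the ray lemma asks for
     [4 * w0] below the speed. *)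
  set (w0 := Rmin (Rmin w1 w2) (Cmod (d t0)) / 4).
  assert (Hw0 : 0 < w0 /\ 3 * w0 <= w1 /\ 3 * w0 <= w2 /\ 4 * w0 <= Cmod (d t0)).
  { assert (0 < Rmin (Rmin w1 w2) (Cmod (d t0))) by (repeat apply Rmin_pos; assumption).
    pose proof (Rmin_l (Rmin w1 w2) (Cmod (d t0))). pose proof (Rmin_r (Rmin w1 w2) (Cmod (d t0))).
    pose proof (Rmin_l w1 w2). pose proof (Rmin_r w1 w2). unfold w0. lra. }
  exists w0. split; [apply Hw0|].
  intros w B eta ts h sg x Hw Hf Heta Hts Hsg Hh Hx Hxd.
  eexists. split.
  { apply (static_integral x (RtoC (- sg) * rot (d t0))%C); [lra | apply Hm, Hsg|].
    intros t Ht r Hr.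
    apply (frame_avoids_ray t0 w B eta ts h sg t r x); try assumption; try lra.
    apply Rabs_le. lra. }
  assert (Zb : Rabs (t0 - t0) <= eta) by (apply Rabs_diag_le; lra).
  assert (Rp : Rabs (t0 + eta - t0) <= eta) by (apply Rabs_le; lra).
  assert (Rm : Rabs (t0 - eta - t0) <= eta) by (apply Rabs_le; lra).
  assert (Vp : Cmod (g (t0 + eta)%R - x - RtoC eta * d t0) <= 3 * w * eta).
  { pose proof (frame_chord g d dd Hg _ _ _ _ _ _ Hf Zb Rp) as H.
    replace (t0 + eta - t0) with eta in H by ring. rewrite (Rabs_pos_eq eta) in H by lra.
    replace (g (t0 + eta)%R - x - RtoC eta * d t0)%C with
      ((g (t0 + eta)%R - g t0 - RtoC eta * d t0) + - (x - g t0))%C by ring.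
    Cmod_triangle_le. rewrite Cmod_opp. lra. }
  assert (Vm : Cmod (g (t0 - eta)%R - x + RtoC eta * d t0) <= 3 * w * eta).
  { pose proof (frame_chord g d dd Hg _ _ _ _ _ _ Hf Zb Rm) as H.
    replace (t0 - eta - t0) with (- eta) in H by ring. rewrite Rabs_Ropp, (Rabs_pos_eq eta) in H by lra.
    rewrite RtoC_opp in H.
    replace (g (t0 - eta)%R - x + RtoC eta * d t0)%C with
      ((g (t0 - eta)%R - g t0 - - RtoC eta * d t0) + - (x - g t0))%C by ring.
    Cmod_triangle_le. rewrite Cmod_opp. lra. }
  replace (/ (RtoC 2 * rho * eps1) *
      (angle_diff rho (RtoC (- sg) * rot (d t0))%C (g (t0 + eta)%R - x)%C -
       angle_diff rho (RtoC (- sg) * rot (d t0))%C (g (t0 - eta)%R - x)%C) -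
      RtoC (- sg) * (Ci * RtoC PI / (rho * eps1)))%C with
    (/ (RtoC 2 * rho * eps1) *
      (angle_diff rho (RtoC (- sg) * rot (d t0))%C (g (t0 + eta)%R - x)%C -
       angle_diff rho (RtoC (- sg) * rot (d t0))%C (g (t0 - eta)%R - x)%C -
       RtoC (- sg) * (RtoC 2 * Ci * RtoC PI)))%C by (field; tauto).
  rewrite Cmod_mult. fold c.
  replace e with (c * (e / c)) by (field; lra).
  apply Rmult_le_compat_l; [lra|].
  assert (Hwe : forall w', 3 * w0 <= w' -> 3 * w * eta <= w' * eta).
  { intros w' Hw'. apply Rmult_le_compat_r; lra. }
  destruct Hsg as [-> | ->].
  - apply (J1 eta); [exact Heta| |].
    + eapply Rle_trans; [exact Vp | apply Hwe; lra].
    + eapply Rle_trans; [exact Vm | apply Hwe; lra].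
  - apply (J2 eta); [exact Heta| |].
    + eapply Rle_trans; [exact Vp | apply Hwe; lra].
    + eapply Rle_trans; [exact Vm | apply Hwe; lra].
Qed.

End Static.

(** * The double layer integrand near a boundary point *)

Section Integrand.
Variables (k0 : R) (eps1 eps2 : C) (g d dd psi : R -> C).
Hypothesis Hk0 : 0 < k0.
Hypothesis Hre : Re eps1 * Re eps2 < 0.
Hypothesis Him1 : 0 < Im eps1.
Hypothesis Him2 : 0 < Im eps2.
Hypothesis Hg : forall t, is_Cderive g t (d t).
Hypothesis Hd : forall t, is_Cderive d t (dd t).
Hypothesis Hdd : forall t, Ccontinuous dd t.
Hypothesis Hreg : forall t, d t <> 0.
Hypothesis Hpsi : forall t, Ccontinuous psi t.

Local Notation q := (quad eps1 eps2).
Local Notation K0 := (kernel k0 eps1 eps2).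

(** The integrand for the normal [rot (d t)], whose length already contains the arc length factor.
    The actual integrand differs from it by a locally constant sign. *)
Definition cross_kernel (x : R2) (t : R) : C :=
  (RtoC (cross (g t - x)%C (d t)) * K0 (g t - x)%C * psi t)%C.

Definition kappa : C := (RtoC (- / (2 * PI)) * Csqrt (eps1 * eps2))%C.

Definition rho : C := (Ci * Csqrt (eps1 * eps2) / eps1)%C.

Lemma eps1_neq_0 : eps1 <> 0.
Proof. intros E. rewrite E in Him1. simpl in Him1. lra. Qed.

Lemma rho_facts : 0 < Im rho /\ (rho * rho * eps1)%C = (- eps2)%C.
Proof.
  destruct (Csqrt_mult_facts eps1 eps2 Hre Him1 Him2) as [H1 H2].
  split; [exact H2|]. unfold rho.
  assert (E := eps1_neq_0).
  replace (Ci * Csqrt (eps1 * eps2) / eps1 * (Ci * Csqrt (eps1 * eps2) / eps1) * eps1)%C with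
    (Ci * Ci * (Csqrt (eps1 * eps2) * Csqrt (eps1 * eps2)) / eps1)%C by (field; exact E).
  rewrite H1. replace (Ci * Ci)%C with (- (1))%C by (unfold Ci, Cmult, Copp, RtoC; simpl; f_equal; ring).
  field. exact E.
Qed.

(** Since [rho * eps1] is [Ci] times the root contained in [kappa], the root and [PI] cancel and no
    trace of the medium remains. *)
Lemma kappa_jump (sg : R) :
  (kappa * (RtoC (- sg) * (Ci * RtoC PI / (rho * eps1))))%C = RtoC (sg / 2).
Proof.
  assert (E := eps1_neq_0). destruct rho_facts as [Hr _].
  assert (Hs : Csqrt (eps1 * eps2) <> 0).
  { intros E'. unfold rho in Hr. rewrite E' in Hr.
    replace (Ci * 0 / eps1)%C with (RtoC 0) in Hr by (field; exact E). simpl in Hr. lra. }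
  unfold kappa, rho. pose proof PI_RGT_0 as Hpi.
  assert (RtoC PI <> 0) by (apply RtoC_neq_0; lra).
  rewrite RtoC_opp, RtoC_inv, RtoC_mult, RtoC_opp, RtoC_div by lra.
  assert (E2 : RtoC 2 <> 0) by (apply RtoC_neq_0; lra).
  assert (Hi := Ci_neq_0). field. tauto.
Qed.

Lemma quad_neq_0 (v : R2) : v <> (0, 0) -> q v <> 0.
Proof.
  intros Hv E. assert (H := Im_quad_pos eps1 eps2 v Him1 Him2 Hv).
  rewrite E in H. simpl in H. lra.
Qed.

Lemma Cminus_neq (u v : C) : u <> v -> (u - v)%C <> (0, 0).
Proof.
  intros H E. apply H. replace u with (u - v + v)%C by ring. rewrite E.
  change (0, 0) with (RtoC 0). ring.
Qed.

(* Near [t0] the static part carries the jump; the estimate of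
   [cross_kernel_bound] makes the remainder small. *)
Lemma near_jump (t0 : R) :
  forall e, 0 < e -> exists eta0, 0 < eta0 /\ forall eta, 0 < eta <= eta0 ->
  exists del, 0 < del /\ forall ts h sg x J,
    Rabs (ts - t0) <= eta -> sg = 1 \/ sg = -1 -> 0 < sg * h ->
    x = (g ts + RtoC h * rot (d ts))%C -> Cmod (x - g t0) < del ->
    (forall t, Rabs (t - t0) <= eta -> Cmod (g ts - x) <= Cmod (g t - x)) ->
    is_CInt (cross_kernel x) (t0 - eta) (t0 + eta) J ->
    Cmod (J - RtoC (sg / 2) * psi t0) <= e.
Proof.
  intros e He.
  assert (Hl := proj1 (Cmod_gt_0 _) (Hreg t0)). set (l := Cmod (d t0)) in *.
  destruct rho_facts as [Hrho Hrho2].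
  set (K := Cmod kappa). assert (HK : 0 <= K) by apply Cmod_ge_0.
  set (P0 := Cmod (psi t0)). assert (HP0 : 0 <= P0) by apply Cmod_ge_0.
  assert (HKP : 0 <= K * P0) by (apply Rmult_le_pos; assumption).
  (* The error is shared in thirds: [e2] for the static integral, [e1] for the oscillation of the
     density, and the length of the arc for the non-static part of the kernel. *)
  set (e2 := e / (3 * (K * P0 + 1))). assert (He2 : 0 < e2) by (apply Rdiv_lt_0_compat; lra).
  destruct (static_jump g d dd eps1 eps2 rho Hg Hd eps1_neq_0 Hrho Hrho2 t0 (Hreg t0) e2 He2)
    as [w0 [Hw0 Hjump]].
  set (w := Rmin w0 (l / 4)).
  assert (Hw : 0 < w /\ w <= w0 /\ 4 * w <= l).
  { pose proof (Rmin_l w0 (l / 4)). pose proof (Rmin_r w0 (l / 4)).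
    assert (0 < w) by (apply Rmin_pos; lra). unfold w in *. lra. }
  clearbody w. destruct Hw as [Hw [Hww0 Hwl]].
  set (B := Cmod (dd t0) + 1). assert (HB : 0 <= B) by (pose proof (Cmod_ge_0 (dd t0)); unfold B; lra).
  destruct (frame_exists d dd t0 w (is_Cderive_continuous _ _ _ (Hd t0)) (Hdd t0) Hw)
    as [eta1 [Heta1 Hframe1]]. fold B in Hframe1.
  set (m := Rmin (Im eps1) (Im eps2)). assert (Hm : 0 < m) by (apply Rmin_pos; assumption).
  set (C0 := ((l + 2 * w) * B + 2 * l) * (1 + 16 / l ^ 2)).
  assert (HC0 : 0 <= C0).
  { assert (0 <= (l + 2 * w) * B) by (apply Rmult_le_pos; lra).
    assert (0 < 16 / l ^ 2) by (apply Rdiv_lt_0_compat; [lra | apply pow_lt, Hl]).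
    apply Rmult_le_pos; lra. }
  set (C1 := K * (C0 / m)). assert (HC1 : 0 <= C1).
  { apply Rmult_le_pos; [exact HK|]. apply Rmult_le_pos; [exact HC0|].
    left; apply Rinv_0_lt_compat, Hm. }
  pose proof PI_RGT_0 as Hpi.
  assert (HC1pi : 0 <= C1 * (PI + 2)) by (apply Rmult_le_pos; lra).
  set (e1 := e / (3 * (C1 * (PI + 2) + 1))). assert (He1 : 0 < e1) by (apply Rdiv_lt_0_compat; lra).
  destruct (Ccontinuous_R_Cmod _ _ e1 (Hpsi t0) He1) as [eta2 [Heta2 Hpsi2]].
  set (M := P0 + e1). assert (HM : 0 < M) by (unfold M; lra).
  destruct (kernel_asymp k0 eps1 eps2 Hk0 Him1 Him2 1 Rlt_0_1) as [dK [HdK Hasy]].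
  assert (HlM : 0 <= 4 * l * M) by (apply Rmult_le_pos; lra).
  (* The bound [1] makes [2 * eta + A] at most [PI + 2]; [dK / (4 * l)], with [dK / 2] for the
     distance of [x] to [g t0], keeps [g t - x] where the kernel asymptotics hold. *)
  set (eta0 := Rmin (Rmin eta1 eta2) (Rmin (Rmin 1 (e / (3 * (4 * l * M + 1)))) (dK / (4 * l)))).
  exists eta0. split.
  { unfold eta0. repeat apply Rmin_pos; try assumption; try lra;
      apply Rdiv_lt_0_compat; lra. }
  intros eta [Heta Hetale].
  destruct (le_Rmin _ _ _ Hetale) as [L1 L2].
  destruct (le_Rmin _ _ _ L1) as [L3 L4].
  destruct (le_Rmin _ _ _ L2) as [L5 L6].
  destruct (le_Rmin _ _ _ L5) as [L7 L8].
  clear eta0 Hetale L1 L2 L5.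
  assert (Hframe : frame d dd t0 w B eta) by (eapply frame_mono; [| exact L3 | exact Hframe1]; lra).
  exists (Rmin (w * eta) (dK / 2)). split.
  { apply Rmin_pos; [apply Rmult_lt_0_compat; assumption | lra]. }
  intros ts h sg x J Hts Hsg Hh Hx Hxd Hmin HJ.
  destruct (lt_Rmin _ _ _ Hxd) as [Hxd1 Hxd2].
  destruct (Hjump w B eta ts h sg x ltac:(lra) Hframe Heta Hts Hsg Hh Hx ltac:(lra)) as [I [HI HIe]].
  assert (Hhx : 0 < Cmod (g ts - x)).
  { rewrite Hx. replace (g ts - (g ts + RtoC h * rot (d ts)))%C with (- (RtoC h * rot (d ts)))%C by ring.
    rewrite Cmod_opp, Cmod_mult, Cmod_R. apply Rmult_lt_0_compat.
    - apply Rabs_pos_lt. intros E. rewrite E in Hh. lra.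
    - apply Cmod_gt_0. intros E. apply (Hreg ts). unfold rot in E.
      assert (E1 := f_equal Re E). assert (E2 := f_equal Im E). simpl in E1, E2.
      destruct (d ts) as [a b]. simpl in *. unfold RtoC. f_equal; lra. }
  set (hh := Cmod (g ts - x)) in *.
  destruct (is_RInt_cauchy_kernel hh ts (t0 - eta) (t0 + eta) Hhx ltac:(lra)) as [A [HA HApi]].
  assert (Hrest := is_CInt_minus _ _ _ _ _ _ HJ (is_CInt_scal (kappa * psi t0)%C _ _ _ _ HI)).
  assert (HgI : forall t, t0 - eta <= t <= t0 + eta -> Rabs (t - t0) <= eta)
    by (intros t Ht; apply Rabs_le; lra).
  assert (Hbound : Cmod (J - kappa * psi t0 * I) <= e1 * C1 * (2 * eta + A) + 2 * l * M * (2 * eta)).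
  { apply (Cmod_is_CInt_le _ (fun t => e1 * C1 * (1 + hh / (hh ^ 2 + (t - ts) ^ 2)) + 2 * l * M)
             (t0 - eta) (t0 + eta) _ _ ltac:(lra)) with (2 := Hrest).
    - intros t Ht. apply HgI in Ht.
      assert (Hnum := cross_kernel_bound g d dd Hg Hd t0 w B eta ts x ltac:(lra) Hwl Hl HB Hframe Hts Hhx Hmin t Ht).
      fold l C0 hh in Hnum.
      assert (Hv : Cmod (g t - x) > 0) by (pose proof (Hmin t Ht); lra).
      assert (Hv0 : (g t - x)%C <> (0, 0)) by (apply Cmod_gt_0; exact Hv).
      assert (Hq := quad_neq_0 _ Hv0).
      assert (HvdK : Cmod (g t - x) < dK).
      { replace (g t - x)%C with ((g t - g t0) + - (x - g t0))%C by ring.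
        Cmod_triangle_lt. rewrite Cmod_opp.
        assert (Z : Rabs (t0 - t0) <= eta) by (apply Rabs_diag_le; lra).
        pose proof (frame_chord_le g d dd Hg _ _ _ _ _ _ Hframe Z Ht) as Hc. fold l in Hc.
        assert ((l + 2 * w) * Rabs (t - t0) <= 2 * l * eta).
        { apply Rmult_le_compat; try lra. apply Rabs_pos. }
        assert (2 * l * eta <= dK / 2).
        { apply (Rmult_le_compat_l (2 * l)) in L6; [|lra].
          replace (2 * l * (dK / (4 * l))) with (dK / 2) in L6 by (field; lra). exact L6. }
        lra. }
      specialize (Hasy _ Hv0 HvdK).
      assert (Hquad := Cmod_quad_ge eps1 eps2 (g t - x)%C). fold m in Hquad.
      set (v := (g t - x)%C) in *. set (cr := cross v (d t)) in *.
      assert (Hpt : Cmod (psi t - psi t0) <= e1) by (apply Hpsi2; lra).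
      assert (HpM : Cmod (psi t) <= M).
      { replace (psi t) with (psi t - psi t0 + psi t0)%C by ring.
        Cmod_triangle_le. fold P0. unfold M. lra. }
      assert (Hcr2 : Rabs cr <= 2 * l * Cmod v).
      { eapply Rle_trans; [apply Rabs_cross_le|]. rewrite Rmult_comm.
        apply Rmult_le_compat_r; [lra|].
        replace (d t) with (d t - d t0 + d t0)%C by ring.
        Cmod_triangle_le. fold l. destruct (Hframe t Ht). lra. }
      unfold cross_kernel. fold v. fold cr.
      (* The static kernel meets the oscillation of the density, small but only integrable uniformly
         in [x]; the rest of the kernel meets the full density and is merely bounded, which suffices
         on a short arc. *)
      replace (RtoC cr * K0 v * psi t - kappa * psi t0 * (RtoC cr / q v))%C
        with (kappa * (RtoC cr / q v) * (psi t - psi t0) +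
              RtoC cr * (K0 v - kappa / q v) * psi t)%C by (field; exact Hq).
      Cmod_triangle_le. rewrite !Cmod_mult, Cmod_div, !Cmod_R by exact Hq. fold K.
      assert (Hkq : Rabs cr * / Cmod (q v) <= C0 / m * (1 + hh / (hh ^ 2 + (t - ts) ^ 2))).
      { assert (Hv2 : 0 < Cmod v ^ 2) by (apply pow_lt; lra).
        assert (Hqp : 0 < Cmod (q v)) by (apply Cmod_gt_0, Hq).
        apply (Rmult_le_reg_r (Cmod (q v))); [exact Hqp|].
        rewrite Rmult_assoc, Rinv_l, Rmult_1_r by lra.
        eapply Rle_trans; [exact Hnum|].
        set (Y := 1 + hh / (hh ^ 2 + (t - ts) ^ 2)).
        assert (HY : 0 <= Y).
        { assert (0 < hh ^ 2 + (t - ts) ^ 2) by (pose proof (pow2_ge_0 (t - ts)); nra).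
          assert (0 < hh / (hh ^ 2 + (t - ts) ^ 2)) by (apply Rdiv_lt_0_compat; lra). unfold Y. lra. }
        replace (C0 * Y * Cmod v ^ 2) with (C0 / m * Y * (m * Cmod v ^ 2)) by (field; lra).
        apply Rmult_le_compat_l; [|exact Hquad].
        apply Rmult_le_pos; [|exact HY]. apply Rmult_le_pos; [exact HC0|].
        left; apply Rinv_0_lt_compat, Hm. }
      set (Y := 1 + hh / (hh ^ 2 + (t - ts) ^ 2)) in *.
      assert (Hkq0 : 0 <= Rabs cr * / Cmod (q v)).
      { apply Rmult_le_pos; [apply Rabs_pos|]. left; apply Rinv_0_lt_compat, Cmod_gt_0, Hq. }
      apply Rplus_le_compat.
      + apply Rle_trans with (K * (C0 / m * Y) * e1).
        * apply Rmult_le_compat; [|apply Cmod_ge_0| |exact Hpt].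
          -- apply Rmult_le_pos; assumption.
          -- apply Rmult_le_compat_l; assumption.
        * right. unfold C1. ring.
      + apply Rmult_le_compat; [|apply Cmod_ge_0| |exact HpM].
        * apply Rmult_le_pos; [apply Rabs_pos | apply Cmod_ge_0].
        * apply Rle_trans with (2 * l * Cmod v * Cmod (K0 v - kappa / q v)).
          -- apply Rmult_le_compat_r; [apply Cmod_ge_0 | exact Hcr2].
          -- rewrite Rmult_assoc. rewrite <- (Rmult_1_r (2 * l)) at 2.
             apply Rmult_le_compat_l; [lra|]. exact Hasy.
    - assert (R1 := is_RInt_const (V := RV) (t0 - eta) (t0 + eta) (e1 * C1)).
      assert (R2 := is_RInt_const (V := RV) (t0 - eta) (t0 + eta) (2 * l * M)).
      assert (R3 := is_RInt_scal (V := RV) _ _ _ (e1 * C1) _ HA).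
      assert (R4 := is_RInt_plus (V := RV) _ _ _ _ _ _
                      (is_RInt_plus (V := RV) _ _ _ _ _ _ R1 R3) R2).
      eapply is_RInt_ext; [|evar_last; [exact R4|]].
      + intros t _. unfold plus, scal; simpl; unfold mult; simpl. ring.
      + unfold plus, scal; simpl; unfold mult; simpl. ring. }
  assert (Hb1 : e1 * C1 * (2 * eta + A) <= e / 3).
  { apply Rle_trans with (e1 * C1 * (PI + 2)).
    - apply Rmult_le_compat_l; [|lra]. apply Rmult_le_pos; lra.
    - apply Rle_trans with (e1 * (C1 * (PI + 2) + 1)); [lra|]. right. unfold e1. field. lra. }
  assert (Hb2 : 2 * l * M * (2 * eta) <= e / 3).
  { apply Rle_trans with ((4 * l * M + 1) * eta); [lra|].
    apply (Rmult_le_compat_l (4 * l * M + 1)) in L8; [|lra].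
    replace ((4 * l * M + 1) * (e / (3 * (4 * l * M + 1)))) with (e / 3) in L8 by (field; lra).
    exact L8. }
  assert (Hb3 : Cmod (kappa * psi t0 * I - RtoC (sg / 2) * psi t0) <= e / 3).
  { rewrite <- kappa_jump.
    replace (kappa * psi t0 * I - kappa * (RtoC (- sg) * (Ci * RtoC PI / (rho * eps1))) * psi t0)%C with
      (kappa * psi t0 * (I - RtoC (- sg) * (Ci * RtoC PI / (rho * eps1))))%C by ring.
    rewrite !Cmod_mult. fold K P0.
    apply Rle_trans with ((K * P0 + 1) * e2).
    - apply Rmult_le_compat; [exact HKP | apply Cmod_ge_0 | lra | exact HIe].
    - right. unfold e2. field. lra. }
  replace (J - RtoC (sg / 2) * psi t0)%C with
    ((J - kappa * psi t0 * I) + (kappa * psi t0 * I - RtoC (sg / 2) * psi t0))%C by ring.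
  Cmod_triangle_le. lra.
Qed.

(** * The removable singularity of the integrand on the curve *)

Lemma chord_quotient_continuous (t0 : R) :
  Ccontinuous (fun t => if Req_EM_T t t0 then d t0 else ((g t - g t0) / RtoC (t - t0))%C) t0.
Proof.
  apply Ccontinuous_of_Cmod. intros e He.
  destruct (proj1 (is_Cderive_iff _ _ _) (Hg t0) (e / 2) ltac:(lra)) as [del [Hdel H]].
  exists (mkposreal _ Hdel). intros t Ht. change (Rabs (t - t0) < del) in Ht.
  specialize (H t Ht).
  destruct (Req_EM_T t0 t0) as [_|]; [|lra].
  destruct (Req_EM_T t t0) as [E|N].
  - replace (d t0 - d t0)%C with (RtoC 0) by ring. rewrite Cmod_0. exact He.
  - assert (Hn : t - t0 <> 0) by lra. assert (Hc : RtoC (t - t0) <> 0) by (apply RtoC_neq_0, Hn).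
    replace ((g t - g t0) / RtoC (t - t0) - d t0)%C with
      ((g t - g t0 - RtoC (t - t0) * d t0) / RtoC (t - t0))%C by (field; exact Hc).
    rewrite Cmod_div, Cmod_R by exact Hc.
    assert (Hp := Rabs_pos_lt _ Hn).
    apply Rle_lt_trans with (e / 2); [|lra].
    apply (Rmult_le_reg_r (Rabs (t - t0))); [exact Hp|].
    unfold Rdiv at 1. rewrite Rmult_assoc, Rinv_l by lra. lra.
Qed.

Lemma cross_quotient_continuous (t0 : R) :
  Ccontinuous (fun t => RtoC (if Req_EM_T t t0 then cross (d t0) (dd t0) / 2
     else cross (g t - g t0)%C (d t) / (t - t0) ^ 2)) t0.
Proof.
  apply Ccontinuous_of_Cmod. intros e He.
  destruct (cross_taylor g d dd Hg Hd t0 (Hdd t0) (e / 2) ltac:(lra)) as [del [Hdel H]].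
  exists (mkposreal _ Hdel). intros t Ht. change (Rabs (t - t0) < del) in Ht.
  specialize (H t ltac:(lra)).
  destruct (Req_EM_T t0 t0) as [_|]; [|lra].
  rewrite <- RtoC_minus, Cmod_R.
  destruct (Req_EM_T t t0) as [E|N].
  - rewrite Rminus_diag, Rabs_R0. exact He.
  - assert (Hn : t - t0 <> 0) by lra.
    set (c := cross (d t0) (dd t0) / 2) in *. set (y := cross (g t - g t0)%C (d t)) in *.
    replace (y / (t - t0) ^ 2 - c) with ((y - c * (t - t0) ^ 2) / (t - t0) ^ 2) by (field; exact Hn).
    assert (Hp : 0 < (t - t0) ^ 2) by (apply pow2_gt_0, Hn).
    unfold Rdiv. rewrite Rabs_mult, (Rabs_pos_eq (/ (t - t0) ^ 2))
      by (left; apply Rinv_0_lt_compat, Hp).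
    rewrite pow2_abs in H.
    apply Rle_lt_trans with (e / 2); [|lra].
    apply (Rmult_le_reg_r ((t - t0) ^ 2)); [exact Hp|].
    rewrite Rmult_assoc, Rinv_l by lra. lra.
Qed.

(** The numerator is quadratic in [t - t0], while the non-static part of the kernel is at most the
    inverse of the chord; the product is at most linear in the distance to [t0]. *)
Lemma remainder_continuous (t0 : R) :
  Ccontinuous (fun t => if Req_EM_T t t0 then RtoC 0 else
     (RtoC (cross (g t - g t0)%C (d t)) *
      (K0 (g t - g t0)%C - kappa / q (g t - g t0)%C))%C) t0.
Proof.
  apply Ccontinuous_of_Cmod. intros e He.
  assert (Hl := proj1 (Cmod_gt_0 _) (Hreg t0)). set (l := Cmod (d t0)) in *.
  destruct (frame_exists d dd t0 (l / 4) (is_Cderive_continuous _ _ _ (Hd t0)) (Hdd t0) ltac:(lra))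
    as [eta1 [Heta1 Hf]].
  set (B := Cmod (dd t0) + 1) in *. assert (HB : 1 <= B) by (pose proof (Cmod_ge_0 (dd t0)); unfold B; lra).
  set (C1 := (l + 2 * (l / 4)) * B). assert (HC1 : 0 < C1) by (apply Rmult_lt_0_compat; lra).
  destruct (kernel_asymp k0 eps1 eps2 Hk0 Him1 Him2 1 Rlt_0_1) as [dK [HdK Hasy]].
  set (del := Rmin eta1 (Rmin (dK / (2 * l)) (e * l / (4 * C1)))).
  assert (Hdel : 0 < del).
  { repeat apply Rmin_pos; try assumption; apply Rdiv_lt_0_compat; try nra. }
  exists (mkposreal _ Hdel). intros t Ht. change (Rabs (t - t0) < del) in Ht.
  destruct (Req_EM_T t0 t0) as [_|]; [|lra].
  destruct (Req_EM_T t t0) as [E|N].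
  { replace (RtoC 0 - RtoC 0)%C with (RtoC 0) by ring. rewrite Cmod_0. exact He. }
  destruct (lt_Rmin _ _ _ Ht) as [L1 L2].
  destruct (lt_Rmin _ _ _ L2) as [L3 L4].
  assert (Z : Rabs (t0 - t0) <= eta1) by (apply Rabs_diag_le; lra).
  assert (T : Rabs (t - t0) <= eta1) by lra.
  assert (Hup := frame_chord_le g d dd Hg _ _ _ _ _ _ Hf Z T).
  assert (Hlo := frame_chord_ge g d dd Hg _ _ _ _ _ _ Hf Z T).
  assert (Hcr := frame_cross g d dd Hg Hd t0 (l / 4) _ _ _ _ ltac:(lra) Hf Z T).
  fold l in Hup, Hlo, Hcr. fold C1 in Hcr.
  assert (Hr : 0 < Rabs (t - t0)) by (apply Rabs_pos_lt; lra).
  set (r := Rabs (t - t0)) in *. set (v := (g t - g t0)%C) in *.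
  assert (Hlr : l / 2 * r <= Cmod v) by lra.
  assert (Hlr0 : 0 < l / 2 * r) by (apply Rmult_lt_0_compat; lra).
  assert (Hvp : 0 < Cmod v) by lra.
  assert (Hv0 : v <> (0, 0)) by (apply Cmod_gt_0, Hvp).
  assert (HvdK : Cmod v < dK).
  { apply Rle_lt_trans with (2 * l * r); [lra|].
    apply (Rmult_lt_compat_l (2 * l)) in L3; [|lra].
    replace (2 * l * (dK / (2 * l))) with dK in L3 by (field; lra). exact L3. }
  specialize (Hasy v Hv0 HvdK). fold kappa in Hasy.
  match goal with |- Cmod (?u - RtoC 0) < _ => replace (u - RtoC 0)%C with u by ring end.
  rewrite Cmod_mult, Cmod_R.
  set (X := Cmod (K0 v - kappa / q v)) in *.
  assert (HX : 0 <= X) by apply Cmod_ge_0.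
  assert (HlrX : l / 2 * r * X <= 1).
  { apply Rle_trans with (Cmod v * X); [|exact Hasy]. apply Rmult_le_compat_r; assumption. }
  apply Rle_lt_trans with (C1 * r ^ 2 * X).
  - apply Rmult_le_compat_r; [exact HX | exact Hcr].
  - apply Rle_lt_trans with (2 * C1 / l * r).
    + replace (C1 * r ^ 2 * X) with (2 * C1 / l * r * (l / 2 * r * X)) by (field; lra).
      rewrite <- (Rmult_1_r (2 * C1 / l * r)) at 2.
      apply Rmult_le_compat_l; [|exact HlrX].
      apply Rmult_le_pos; [|lra]. left; apply Rdiv_lt_0_compat; lra.
    + apply (Rmult_lt_compat_l (2 * C1 / l)) in L4; [|apply Rdiv_lt_0_compat; lra].
      replace (2 * C1 / l * (e * l / (4 * C1))) with (e / 2) in L4 by (field; lra). lra.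
Qed.

(** In the static part, numerator and form are both divided by [(t - t0) ^ 2]. By homogeneity of the
    form the denominator becomes its value on the chord quotient, which tends to the nonzero value
    on [d t0]. *)
Lemma cross_kernel_extension (t0 : R) :
  exists f, Ccontinuous f t0 /\
    forall t, t <> t0 -> g t <> g t0 -> cross_kernel (g t0) t = f t.
Proof.
  eexists. split.
  - apply Ccontinuous_mult; [|apply Hpsi].
    apply Ccontinuous_plus; [|apply (remainder_continuous t0)].
    apply Ccontinuous_mult; [apply (Ccontinuous_const kappa)|].
    apply Ccontinuous_div; [apply (cross_quotient_continuous t0)| |].
    + apply (Ccontinuous_comp_C (fun t => if Req_EM_T t t0 then d t0 else ((g t - g t0) / RtoC (t - t0))%C)
               (q)).
      * apply (chord_quotient_continuous t0).
      * apply Ccontinuous_quad.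
    + cbv beta. destruct (Req_EM_T t0 t0) as [_|]; [|lra]. apply quad_neq_0, Hreg.
  - intros t Ht Hgt. cbv beta. destruct (Req_EM_T t t0) as [|_]; [contradiction|].
    assert (Hn : RtoC (t - t0) <> 0) by (apply RtoC_neq_0; lra).
    assert (Hq := quad_neq_0 _ (Cminus_neq _ _ Hgt)).
    unfold cross_kernel. set (v := (g t - g t0)%C) in *.
    assert (Hqv : q (v / RtoC (t - t0))%C =
                  (q v / (RtoC (t - t0) * RtoC (t - t0)))%C).
    { replace v with (RtoC (t - t0) * (v / RtoC (t - t0)))%C at 2 by (field; exact Hn).
      set (u := (v / RtoC (t - t0))%C).
      assert (Hs : q (RtoC (t - t0) * u)%C = (RtoC (t - t0) * RtoC (t - t0) * q u)%C).
      { unfold quad.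
        replace (fst (RtoC (t - t0) * u)%C) with ((t - t0) * fst u) by (simpl; ring).
        replace (snd (RtoC (t - t0) * u)%C) with ((t - t0) * snd u) by (simpl; ring).
        rewrite !RtoC_mult. simpl Cpow. ring. }
      rewrite Hs. field. exact Hn. }
    rewrite Hqv, RtoC_div by (apply pow_nonzero; lra).
    rewrite RtoC_pow. simpl Cpow. field. split; [exact Hq | exact Hn].
Qed.

End Integrand.

(** * The two sides of the boundary *)

Lemma boundary_or_sides (D : R2 -> Prop) (x : R2) :
  ~ boundary D x -> D x \/ ~ closure D x.
Proof.
  intros H. destruct (classic (closure D x)) as [Hc|Hc]; [left|right; exact Hc].
  apply NNPP. intros Hn. apply H. split; [exact Hc|].
  intros P HP. exists x. split; [apply locally_singleton, HP | exact Hn].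
Qed.

Lemma open_not_boundary (D : R2 -> Prop) (x : R2) : open D -> D x -> ~ boundary D x.
Proof.
  intros HD Hx [_ Hc]. destruct (Hc D (HD x Hx)) as [y [Hy1 Hy2]]. exact (Hy2 Hy1).
Qed.

Lemma not_closure_not_in (D : R2 -> Prop) (x : R2) : ~ closure D x -> ~ D x.
Proof.
  intros H Hx. apply H. intros P HP. exists x. split; [apply locally_singleton, HP | exact Hx].
Qed.

Lemma not_closure_locally (D : R2 -> Prop) (x : R2) :
  ~ closure D x -> locally x (fun y => ~ D y).
Proof.
  intros H. apply not_all_ex_not in H. destruct H as [P H].
  apply imply_to_and in H. destruct H as [HP H].
  revert HP. apply filter_imp. intros y Hy HD. apply H. exists y. split; assumption.
Qed.

(** At the supremum [c] of the times spent in [D], the point [p c] is off the boundary. If it is in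
    [D], openness prolongs the stay beyond [c]; if it is outside the closure, the times just before
    [c] are excluded as well. *)
Lemma path_in_open (D : R2 -> Prop) (p : R -> C) (a b : R) :
  open D -> a <= b -> (forall t, a <= t <= b -> Ccontinuous p t) ->
  (forall t, a <= t <= b -> ~ boundary D (p t)) -> D (p a) -> D (p b).
Proof.
  intros HD Hab Hc Hb Ha. apply NNPP. intros Hn.
  set (E := fun t => a <= t <= b /\ D (p t)).
  destruct (completeness E) as [c [Hub Hlub]].
  { exists b. intros t [Ht _]. apply Ht. }
  { exists a. split; [lra | exact Ha]. }
  assert (Hac : a <= c) by (apply Hub; split; [lra | exact Ha]).
  assert (Hcb : c <= b) by (apply Hlub; intros t [Ht _]; apply Ht).
  assert (Hcont := proj2 (Ccontinuous_iff p c) (Hc c (conj Hac Hcb))).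
  destruct (boundary_or_sides D (p c) (Hb c (conj Hac Hcb))) as [Hin|Hout].
  - destruct (Rle_lt_or_eq_dec c b Hcb) as [Hlt|Heq]; [|subst c; contradiction].
    destruct (Hcont D (HD _ Hin)) as [e He].
    set (t := c + Rmin (e / 2) (b - c)).
    assert (Hm : 0 < Rmin (e / 2) (b - c)).
    { apply Rmin_pos; [pose proof (cond_pos e); lra | lra]. }
    assert (HtE : E t).
    { split.
      - unfold t. pose proof (Rmin_r (e / 2) (b - c)). lra.
      - apply He. change (Rabs (t - c) < e). unfold t.
        replace (c + Rmin (e / 2) (b - c) - c) with (Rmin (e / 2) (b - c)) by ring.
        rewrite Rabs_pos_eq by lra. pose proof (Rmin_l (e / 2) (b - c)).
        pose proof (cond_pos e). lra. }
    apply Hub in HtE. unfold t in HtE. lra.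
  - destruct (Hcont _ (not_closure_locally D _ Hout)) as [e He].
    assert (Hup : is_upper_bound E (c - e)).
    { intros t [Ht HtD]. destruct (Rle_or_lt t (c - e)) as [|Hlt]; [assumption|]. exfalso.
      assert (Htc : t <= c) by (apply Hub; split; assumption).
      apply (He t); [|exact HtD]. change (Rabs (t - c) < e).
      apply Rabs_def1; pose proof (cond_pos e); lra. }
    apply Hlub in Hup. pose proof (cond_pos e). lra.
Qed.

Lemma path_same_side (D : R2 -> Prop) (p : R -> C) (a b : R) :
  open D -> (forall t, Ccontinuous p t) ->
  (forall t, Rmin a b <= t <= Rmax a b -> ~ boundary D (p t)) -> D (p a) -> D (p b).
Proof.
  intros HD Hc Hb Ha. destruct (Rle_or_lt a b) as [Hab|Hab].
  - rewrite Rmin_left, Rmax_right in Hb by lra.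
    apply (path_in_open D p a b); try assumption. intros t _; apply Hc.
  - rewrite Rmin_right, Rmax_left in Hb by lra.
    replace (p b) with (p (- - b)) by (f_equal; ring).
    apply (path_in_open D (fun t => p (- t)) (- a) (- b)); try assumption.
    + lra.
    + intros t _. apply (Ccontinuous_comp (fun t => - t) p); [|apply Hc].
      apply (continuous_opp (V := RV) (fun t => t)), continuous_id.
    + intros t Ht. apply Hb. lra.
    + rewrite Ropp_involutive. exact Ha.
Qed.

Lemma periodic_Z (g : R -> C) (T : R) :
  (forall t, g (t + T) = g t) -> forall (k : Z) t, g (t + IZR k * T) = g t.
Proof.
  intros H.
  assert (Hn : forall n t, g (t + INR n * T) = g t).
  { induction n as [|n IH]; intros t.
    - f_equal. simpl. ring.
    - rewrite S_INR. replace (t + (INR n + 1) * T) with (t + INR n * T + T) by ring.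
      rewrite H. apply IH. }
  intros k t. destruct (Z_le_dec 0 k) as [Hk|Hk].
  - rewrite <- (Z2Nat.id k) by exact Hk. rewrite <- INR_IZR_INZ. apply Hn.
  - rewrite <- (Hn (Z.to_nat (- k))). rewrite INR_IZR_INZ, Z2Nat.id by lia.
    rewrite opp_IZR. f_equal. ring.
Qed.

Lemma floor_period (T a t : R) : 0 < T -> exists k : Z, a <= t + IZR k * T < a + T.
Proof.
  intros HT. destruct (archimed ((t - a) / T)) as [A1 A2].
  (* [up] is strictly above its argument, so [up - 1] is the integer part, the number of periods to
     subtract. *)
  exists (1 - up ((t - a) / T))%Z. rewrite minus_IZR.
  set (u := IZR (up ((t - a) / T))) in *.
  assert (E : (t - a) / T * T = t - a) by (field; lra).
  assert (B1 : (t - a) / T * T < u * T) by (apply Rmult_lt_compat_r; lra).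
  assert (B2 : (u - (t - a) / T) * T <= 1 * T) by (apply Rmult_le_compat_r; lra).
  lra.
Qed.

Lemma Ccontinuous_rot (f : R -> C) (t : R) :
  Ccontinuous f t -> Ccontinuous (fun u => rot (f u)) t.
Proof.
  intros [H1 H2]. split; [exact H2|].
  exact (continuous_opp (V := RV) _ _ H1).
Qed.

Lemma Cmod_rot (u : C) : Cmod (rot u) = Cmod u.
Proof. unfold Cmod, rot; simpl. f_equal. ring. Qed.

Lemma orthogonal_rot (u v : C) :
  v <> 0 -> dot u v = 0 -> u = (RtoC (dot u (rot v) / Cmod v ^ 2) * rot v)%C.
Proof.
  intros Hv Huv. assert (Hp := proj1 (Cmod_gt_0 v) Hv).
  assert (Hl : Cmod v ^ 2 = fst v ^ 2 + snd v ^ 2) by apply Cmod_R2_sqr.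
  assert (Hlp : fst v ^ 2 + snd v ^ 2 <> 0) by (rewrite <- Hl; apply pow_nonzero; lra).
  rewrite Hl. destruct u as [u1 u2], v as [v1 v2]. unfold dot, rot in *. simpl in *.
  unfold Cmult, RtoC; simpl. f_equal.
  - field_simplify_eq; [|intros E; apply Hlp; etransitivity; [|exact E]; ring].
    assert ((u1 * v1 + u2 * v2) * v1 = 0) by (rewrite Huv; ring). lra.
  - field_simplify_eq; [|intros E; apply Hlp; etransitivity; [|exact E]; ring].
    assert ((u1 * v1 + u2 * v2) * v2 = 0) by (rewrite Huv; ring). lra.
Qed.

Section Sides.
Variables (Omega : R2 -> Prop) (g d dd : R -> C) (T : R) (nu : R2 -> R2).
Hypothesis HO : open Omega.
Hypothesis HT : 0 < T.
Hypothesis Hper : forall t, g (t + T) = g t.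
Hypothesis Hinj : forall s t, 0 <= s < T -> 0 <= t < T -> g s = g t -> s = t.
Hypothesis Hg : forall t, is_Cderive g t (d t).
Hypothesis Hd : forall t, is_Cderive d t (dd t).
Hypothesis Hdd : forall t, Ccontinuous dd t.
Hypothesis Hreg : forall t, d t <> 0.
Hypothesis Hbd : forall x, boundary Omega x <-> exists t, x = g t.
Hypothesis Hnu : forall t, Cmod (nu (g t)) = 1 /\ dot (nu (g t)) (d t) = 0 /\
  exists del, 0 < del /\ forall h, 0 < h < del ->
    Omega (shift (g t) (- h) (nu (g t))) /\ ~ closure Omega (shift (g t) h (nu (g t))).

(** With the arc length factor included, the normal is exactly plus or minus [rot (d t)]. *)
Definition scaled_normal (t : R) : C := (RtoC (Cmod (d t)) * nu (g t))%C.

Lemma curve_injective (s t : R) : Rabs (s - t) < T -> g s = g t -> s = t.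
Proof.
  intros Hst E.
  destruct (floor_period T 0 s HT) as [k Hk]. destruct (floor_period T 0 t HT) as [j Hj].
  assert (E' : s + IZR k * T = t + IZR j * T).
  { apply Hinj; [lra | lra|]. rewrite !(periodic_Z g T Hper). exact E. }
  assert (Hs : s - t = IZR (j - k) * T) by (rewrite minus_IZR; lra).
  destruct (Z.eq_dec (j - k) 0) as [Z0|Z0].
  - rewrite Z0 in Hs. lra.
  - exfalso. rewrite Hs, Rabs_mult, (Rabs_pos_eq T) in Hst by lra.
    assert (1 <= Rabs (IZR (j - k))).
    { rewrite <- abs_IZR. apply IZR_le. lia. }
    nra.
Qed.

Lemma curve_window (a t : R) : exists s, a <= s < a + T /\ g s = g t.
Proof.
  destruct (floor_period T a t HT) as [k Hk]. exists (t + IZR k * T).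
  split; [exact Hk | apply (periodic_Z g T Hper)].
Qed.

Lemma continuity_dist (x : C) (t : R) : continuity_pt (fun u => Cmod (g u - x)) t.
Proof.
  apply continuity_pt_filterlim. apply (continuous_Cmod (fun u => g u - x)%C).
  apply Ccontinuous_minus; [|apply Ccontinuous_const]. apply (is_Cderive_continuous _ _ _ (Hg t)).
Qed.

Lemma nearest_point (x : C) (a : R) :
  exists ts, a <= ts <= a + T /\ forall t, Cmod (g ts - x) <= Cmod (g t - x).
Proof.
  destruct (continuity_ab_min (fun u => Cmod (g u - x)) a (a + T)) as [ts [H1 H2]].
  - lra.
  - intros t _. apply continuity_dist.
  - exists ts. split; [exact H2|]. intros t.
    destruct (curve_window a t) as [s [Hs <-]]. apply H1. lra.
Qed.

Lemma boundary_distance (x : C) :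
  ~ boundary Omega x -> exists del, 0 < del /\ forall t, del <= Cmod (g t - x).
Proof.
  intros Hx. destruct (nearest_point x 0) as [ts [_ H]].
  exists (Cmod (g ts - x)). split; [|exact H].
  apply Cmod_gt_0. intros E. apply Hx, Hbd. exists ts.
  replace (g ts) with (g ts - x + x)%C by ring. rewrite E. change (x = (RtoC 0 + x)%C). ring.
Qed.

(** On the two closed arcs away from [t0] the distance to [g t0] attains a minimum, positive by
    injectivity. It rules out other branches of the curve near [g t0] and makes the local analysis
    sufficient. *)
Lemma curve_separation (t0 eta : R) :
  0 < eta -> exists del, 0 < del /\ forall t, t0 - T / 2 <= t <= t0 + T / 2 ->
    Cmod (g t - g t0) < del -> Rabs (t - t0) < eta.
Proof.
  intros Heta.
  assert (Hpart : forall a b, a <= b ->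
    (forall t, a <= t <= b -> Rabs (t - t0) < T /\ t <> t0) ->
    exists del, 0 < del /\ forall t, a <= t <= b -> del <= Cmod (g t - g t0)).
  { intros a b Hab H.
    destruct (continuity_ab_min (fun u => Cmod (g u - g t0)) a b Hab) as [ts [H1 H2]].
    - intros t _. apply continuity_dist.
    - exists (Cmod (g ts - g t0)). split; [|exact H1].
      apply Cmod_gt_0. destruct (H ts H2) as [A B]. intros E. apply B.
      apply curve_injective; [exact A|].
      replace (g ts) with (g ts - g t0 + g t0)%C by ring. rewrite E. ring. }
  destruct (Rle_or_lt eta (T / 2)) as [He|He].
  - destruct (Hpart (t0 - T / 2) (t0 - eta)) as [d1 [D1 H1]]; [lra| |].
    { intros t Ht. split; [apply Rabs_def1|]; lra. }
    destruct (Hpart (t0 + eta) (t0 + T / 2)) as [d2 [D2 H2]]; [lra| |].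
    { intros t Ht. split; [apply Rabs_def1|]; lra. }
    exists (Rmin d1 d2). split; [apply Rmin_pos; assumption|].
    intros t Ht Hc. apply Rabs_def1.
    + apply Rnot_le_lt. intros Hle. specialize (H2 t ltac:(lra)).
      pose proof (Rmin_r d1 d2). lra.
    + apply Rnot_le_lt. intros Hle. specialize (H1 t ltac:(lra)).
      pose proof (Rmin_l d1 d2). lra.
  - exists 1. split; [lra|]. intros t Ht _. apply Rabs_def1; lra.
Qed.

Lemma scaled_normal_rot (t : R) :
  exists sg, (sg = 1 \/ sg = -1) /\ scaled_normal t = (RtoC sg * rot (d t))%C.
Proof.
  destruct (Hnu t) as [H1 [H2 _]].
  assert (E := orthogonal_rot _ _ (Hreg t) H2).
  assert (Hp := proj1 (Cmod_gt_0 _) (Hreg t)).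
  set (c := dot (nu (g t)) (rot (d t)) / Cmod (d t) ^ 2) in *.
  exists (Cmod (d t) * c). split.
  - assert (Hc : Rabs (Cmod (d t) * c) = 1).
    { rewrite E, Cmod_mult, Cmod_R, Cmod_rot in H1.
      rewrite Rabs_mult, (Rabs_pos_eq (Cmod (d t))) by lra. lra. }
    revert Hc. unfold Rabs. destruct (Rcase_abs _); intros Hc; [right | left]; lra.
  - unfold scaled_normal. rewrite E at 1. rewrite RtoC_mult. ring.
Qed.

Lemma shift_eq (x : C) (h : R) (n : C) : shift x h n = (x + RtoC h * n)%C.
Proof. unfold shift, Cplus, Cmult, RtoC; simpl. f_equal; ring. Qed.

Lemma scaled_normal_sides (t : R) :
  exists del, 0 < del /\ forall h, 0 < h < del ->
    Omega (g t - RtoC h * scaled_normal t)%C /\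
    ~ closure Omega (g t + RtoC h * scaled_normal t)%C.
Proof.
  destruct (Hnu t) as [_ [_ [del [Hdel H]]]].
  assert (Hp := proj1 (Cmod_gt_0 _) (Hreg t)).
  exists (del / Cmod (d t)). split; [apply Rdiv_lt_0_compat; assumption|].
  intros h [Hh1 Hh2].
  assert (Hh : 0 < h * Cmod (d t) < del).
  { split; [apply Rmult_lt_0_compat; assumption|].
    apply (Rmult_lt_compat_r (Cmod (d t))) in Hh2; [|exact Hp].
    replace (del / Cmod (d t) * Cmod (d t)) with del in Hh2 by (field; lra). exact Hh2. }
  destruct (H _ Hh) as [A B]. rewrite !shift_eq in *. unfold scaled_normal.
  rewrite RtoC_opp, RtoC_mult in A. rewrite RtoC_mult in B. split.
  - replace (g t - RtoC h * (RtoC (Cmod (d t)) * nu (g t)))%C with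
      (g t + - (RtoC h * RtoC (Cmod (d t))) * nu (g t))%C by ring. exact A.
  - replace (g t + RtoC h * (RtoC (Cmod (d t)) * nu (g t)))%C with
      (g t + RtoC h * RtoC (Cmod (d t)) * nu (g t))%C by ring. exact B.
Qed.

Lemma cross_rot (h : R) (v : C) : cross (RtoC h * rot v)%C v = h * Cmod v ^ 2.
Proof. rewrite Cmod_R2_sqr. unfold cross, rot; simpl. ring. Qed.

(* By [frame_cross], a point of the curve on the normal at [g t] has height at
   most quadratic in its distance from [g t]. *)
Lemma tube_avoids_boundary (t0 : R) :
  exists eta h0, 0 < eta /\ 0 < h0 /\ forall t h, Rabs (t - t0) <= eta ->
    h <> 0 -> Rabs h < h0 -> ~ boundary Omega (g t + RtoC h * rot (d t))%C.
Proof.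
  assert (Hl := proj1 (Cmod_gt_0 _) (Hreg t0)). set (l := Cmod (d t0)) in *.
  destruct (frame_exists d dd t0 (l / 4) (is_Cderive_continuous _ _ _ (Hd t0)) (Hdd t0) ltac:(lra))
    as [eta1 [Heta1 Hf]].
  set (B := Cmod (dd t0) + 1) in *. assert (HB : 1 <= B) by (pose proof (Cmod_ge_0 (dd t0)); unfold B; lra).
  set (C1 := (l + 2 * (l / 4)) * B). assert (HC1 : 0 < C1) by (apply Rmult_lt_0_compat; lra).
  destruct (curve_separation t0 eta1 Heta1) as [del [Hdel Hsep]].
  set (eta := Rmin eta1 (del / (4 * l))).
  (* The first bound, with the one on [eta], confines a hypothetical boundary point to the arc
     around [t0]. There the height estimate would give [l ^ 2 <= 4 * C1 * Rabs h], which the second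
     bound excludes. *)
  set (h0 := Rmin (del / (4 * l)) (l ^ 2 / (4 * C1))).
  assert (Hl2 : 0 < l ^ 2) by (apply pow_lt, Hl).
  exists eta, h0.
  assert (Heta : 0 < eta) by (apply Rmin_pos; [assumption | apply Rdiv_lt_0_compat; lra]).
  assert (Hh0 : 0 < h0) by (apply Rmin_pos; apply Rdiv_lt_0_compat; lra).
  split; [exact Heta|]. split; [exact Hh0|].
  intros t h Ht Hh Hhh0 Hb. apply Hbd in Hb. destruct Hb as [s' E].
  destruct (curve_window (t0 - T / 2) s') as [s [Hs Es]]. rewrite <- Es in E. clear s' Es.
  destruct (le_Rmin _ _ _ Ht) as [T1 T2].
  destruct (lt_Rmin _ _ _ Hhh0) as [H1 H2].
  assert (Z : Rabs (t0 - t0) <= eta1) by (apply Rabs_diag_le; lra).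
  assert (Hdt : Cmod (d t) <= 2 * l).
  { replace (d t) with (d t - d t0 + d t0)%C by ring.
    Cmod_triangle_le. fold l. destruct (Hf t T1). lra. }
  assert (Hdtp := proj1 (Cmod_gt_0 _) (Hreg t)).
  assert (Hgs : (g s - g t)%C = (RtoC h * rot (d t))%C) by (rewrite <- E; ring).
  assert (Hgsn : Cmod (g s - g t) = Rabs h * Cmod (d t)).
  { rewrite Hgs, Cmod_mult, Cmod_R, Cmod_rot. reflexivity. }
  assert (Hhp := Rabs_pos_lt _ Hh).
  assert (Hdl : forall u, u <= del / (4 * l) -> 2 * l * u <= del / 2).
  { intros u Hu. apply (Rmult_le_compat_l (2 * l)) in Hu; [|lra].
    replace (2 * l * (del / (4 * l))) with (del / 2) in Hu by (field; lra). exact Hu. }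
  assert (Hs1 : Rabs (s - t0) < eta1).
  { apply Hsep; [lra|].
    replace (g s - g t0)%C with ((g s - g t) + (g t - g t0))%C by ring.
    Cmod_triangle_lt.
    pose proof (frame_chord_le g d dd Hg _ _ _ _ _ _ Hf Z T1) as Hc. fold l in Hc.
    assert ((l + 2 * (l / 4)) * Rabs (t - t0) <= 2 * l * Rabs (t - t0)).
    { apply Rmult_le_compat_r; [apply Rabs_pos | lra]. }
    assert (Rabs h * Cmod (d t) <= 2 * l * Rabs h).
    { rewrite Rmult_comm. apply Rmult_le_compat_r; lra. }
    pose proof (Hdl _ T2).
    assert (2 * l * Rabs h < del / 2).
    { apply (Rmult_lt_compat_l (2 * l)) in H1; [|lra].
      replace (2 * l * (del / (4 * l))) with (del / 2) in H1 by (field; lra). exact H1. }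
    lra. }
  assert (Hcr := frame_cross g d dd Hg Hd t0 (l / 4) _ _ s t ltac:(lra) Hf ltac:(lra) T1).
  fold l in Hcr. fold C1 in Hcr.
  replace (g t - g s)%C with (RtoC (- h) * rot (d t))%C in Hcr
    by (rewrite RtoC_opp; replace (g t - g s)%C with (- (g s - g t))%C by ring; rewrite Hgs; ring).
  rewrite cross_rot, Rabs_mult, Rabs_Ropp, (Rabs_pos_eq (Cmod (d t) ^ 2)) in Hcr by apply pow2_ge_0.
  assert (Hlo := frame_chord_ge g d dd Hg _ _ _ _ _ _ Hf T1 ltac:(apply Rlt_le, Hs1)). fold l in Hlo.
  rewrite Hgsn in Hlo. rewrite Rabs_minus_sym in Hcr.
  set (r := Rabs (s - t)) in *. set (D := Cmod (d t)) in *. set (a := Rabs h) in *.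
  assert (Hr : 0 <= r) by apply Rabs_pos.
  assert (Hlr : l * r <= 2 * (a * D)) by lra.
  assert (Hsq : (l * r) ^ 2 <= (2 * (a * D)) ^ 2).
  { apply pow_incr. split; [apply Rmult_le_pos; lra | exact Hlr]. }
  assert (Hfin : l ^ 2 * (a * D ^ 2) <= C1 * (2 * (a * D)) ^ 2).
  { apply Rle_trans with (l ^ 2 * (C1 * r ^ 2)).
    - apply Rmult_le_compat_l; lra.
    - replace (l ^ 2 * (C1 * r ^ 2)) with (C1 * (l * r) ^ 2) by ring.
      apply Rmult_le_compat_l; lra. }
  assert (HaD : 0 < a * D ^ 2) by (apply Rmult_lt_0_compat; [exact Hhp | apply pow_lt, Hdtp]).
  assert (H4 : 4 * C1 * a < l ^ 2).
  { apply (Rmult_lt_compat_l (4 * C1)) in H2; [|lra].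
    replace (4 * C1 * (l ^ 2 / (4 * C1))) with (l ^ 2) in H2 by (field; lra). exact H2. }
  replace (C1 * (2 * (a * D)) ^ 2) with (4 * C1 * a * (a * D ^ 2)) in Hfin by ring.
  apply Rmult_le_reg_r in Hfin; [lra | exact HaD].
Qed.

(** If the sign at some nearby [t] were opposite, the parallel curve at one small height would lead
    from a point of [Omega] near [g t] to a point outside the closure near [g t0] without meeting
    the boundary. Continuity of the normal follows. *)
Lemma scaled_normal_locally (t0 : R) :
  exists sg eta, (sg = 1 \/ sg = -1) /\ 0 < eta /\
    forall t, Rabs (t - t0) <= eta -> scaled_normal t = (RtoC sg * rot (d t))%C.
Proof.
  destruct (scaled_normal_rot t0) as [sg [Hsg E0]].
  destruct (tube_avoids_boundary t0) as [eta [h0 [Heta [Hh0 Htube]]]].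
  exists sg, eta. split; [exact Hsg|]. split; [exact Heta|].
  intros t Ht. destruct (scaled_normal_rot t) as [sg' [Hsg' E]].
  destruct (Req_dec sg' sg) as [->|Hne]; [exact E|]. exfalso.
  assert (Hopp : sg' = - sg) by (destruct Hsg, Hsg'; lra). subst sg'.
  destruct (scaled_normal_sides t0) as [d1 [D1 S1]].
  destruct (scaled_normal_sides t) as [d2 [D2 S2]].
  set (h := Rmin (Rmin d1 d2) h0 / 2).
  assert (Hh : 0 < h /\ h < d1 /\ h < d2 /\ h < h0).
  { assert (0 < Rmin (Rmin d1 d2) h0) by (repeat apply Rmin_pos; assumption).
    pose proof (Rmin_l (Rmin d1 d2) h0). pose proof (Rmin_r (Rmin d1 d2) h0).
    pose proof (Rmin_l d1 d2). pose proof (Rmin_r d1 d2). unfold h. lra. }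
  destruct (S1 h ltac:(lra)) as [_ A1]. destruct (S2 h ltac:(lra)) as [A2 _].
  apply not_closure_not_in in A1. apply A1.
  rewrite E0. rewrite E in A2.
  set (p := fun u => (g u + RtoC (h * sg) * rot (d u))%C).
  assert (Ep : (g t0 + RtoC h * (RtoC sg * rot (d t0)))%C = p t0) by (unfold p; rewrite RtoC_mult; ring).
  rewrite Ep.
  assert (Ep2 : (g t - RtoC h * (RtoC (- sg) * rot (d t)))%C = p t)
    by (unfold p; rewrite RtoC_mult, RtoC_opp; ring).
  rewrite Ep2 in A2.
  apply (path_same_side Omega p t t0 HO); [| |exact A2].
  - intros u. apply Ccontinuous_plus; [apply (is_Cderive_continuous _ _ _ (Hg u))|].
    apply Ccontinuous_mult; [apply Ccontinuous_const|].
    apply Ccontinuous_rot, (is_Cderive_continuous _ _ _ (Hd u)).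
  - intros u Hu. apply Htube.
    + assert (Z : Rabs (t0 - t0) <= eta) by (apply Rabs_diag_le; lra).
      apply (Rabs_between t0 eta t t0 u Ht Z Hu).
    + destruct Hsg as [-> | ->]; lra.
    + rewrite Rabs_mult, (Rabs_pos_eq h) by lra.
      replace (Rabs sg) with 1; [lra|].
      destruct Hsg as [-> | ->]; [rewrite Rabs_R1 | rewrite Rabs_left]; lra.
Qed.

Lemma scaled_normal_continuous (t : R) : Ccontinuous scaled_normal t.
Proof.
  destruct (scaled_normal_locally t) as [sg [eta [_ [Heta H]]]].
  apply Ccontinuous_ext_loc with (fun u => RtoC sg * rot (d u))%C.
  - exists (mkposreal _ Heta). intros u Hu. change (Rabs (u - t) < eta) in Hu.
    symmetry. apply H. lra.
  - apply Ccontinuous_mult; [apply Ccontinuous_const|].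
    apply Ccontinuous_rot, (is_Cderive_continuous _ _ _ (Hd t)).
Qed.

(** First-order condition for the squared distance, a smooth function of the parameter: [g ts - x]
    is orthogonal to the tangent. *)
Lemma nearest_point_normal (x : C) (ts : R) :
  ~ boundary Omega x -> (forall t, Cmod (g ts - x) <= Cmod (g t - x)) ->
  exists h, h <> 0 /\ x = (g ts + RtoC h * rot (d ts))%C.
Proof.
  intros Hx Hmin.
  assert (Hder : is_derive (fun t => Cmod (g t - x) ^ 2) ts (2 * dot (g ts - x)%C (d ts))).
  { destruct (Hg ts) as [G1 G2].
    assert (X1 : is_derive (fun t => Re (g t) - Re x) ts (Re (d ts))).
    { evar_last; [apply (is_derive_minus (V := RV)); [exact G1 | apply is_derive_const]|].
      unfold minus, plus, opp, zero; simpl. ring. }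
    assert (X2 : is_derive (fun t => Im (g t) - Im x) ts (Im (d ts))).
    { evar_last; [apply (is_derive_minus (V := RV)); [exact G2 | apply is_derive_const]|].
      unfold minus, plus, opp, zero; simpl. ring. }
    apply is_derive_ext with (fun t => (Re (g t) - Re x) ^ 2 + (Im (g t) - Im x) ^ 2).
    - intros t. rewrite Cmod2_alt. reflexivity.
    - evar_last.
      + apply (is_derive_plus (V := RV));
          [exact (is_derive_pow _ 2 _ _ X1) | exact (is_derive_pow _ 2 _ _ X2)].
      + unfold plus, dot; simpl. unfold Re, Im. ring. }
  assert (Hdot : dot (g ts - x)%C (d ts) = 0).
  { apply is_derive_Reals in Hder.
    set (prf := exist _ _ Hder : derivable_pt (fun t => Cmod (g t - x) ^ 2) ts).
    assert (Z := deriv_minimum (fun t => Cmod (g t - x) ^ 2) (ts - 1) (ts + 1) ts prf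
                   ltac:(lra) ltac:(lra)).
    simpl in Z. unfold derive_pt, prf in Z. simpl in Z.
    enough (2 * dot (g ts - x)%C (d ts) = 0) by lra.
    apply Z. intros t _ _. pose proof (Hmin t). pose proof (Cmod_ge_0 (g ts - x)).
    rewrite !Rmult_1_r. apply Rmult_le_compat; assumption. }
  assert (E := orthogonal_rot _ _ (Hreg ts) Hdot).
  set (h := dot (g ts - x)%C (rot (d ts)) / Cmod (d ts) ^ 2) in *.
  assert (Ex : x = (g ts + RtoC (- h) * rot (d ts))%C).
  { transitivity (g ts - (g ts - x))%C; [ring|]. rewrite E at 1. rewrite RtoC_opp. ring. }
  exists (- h). split; [|exact Ex].
  intros E0. apply Hx, Hbd. exists ts. rewrite Ex, E0.
  change (@eq C (g ts + RtoC 0 * rot (d ts))%C (g ts)). ring.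
Qed.

Lemma side_of_normal (x : C) (ts h sg : R) :
  (forall t, Cmod (g ts - x) <= Cmod (g t - x)) -> h <> 0 ->
  x = (g ts + RtoC h * rot (d ts))%C ->
  (sg = 1 \/ sg = -1) -> scaled_normal ts = (RtoC sg * rot (d ts))%C ->
  (Omega x -> sg * h < 0) /\ (~ closure Omega x -> 0 < sg * h).
Proof.
  intros Hmin Hh Hx Hsg E.
  destruct (scaled_normal_sides ts) as [del [Hdel Hside]].
  assert (Hhp := Rabs_pos_lt _ Hh).
  (* The hypothesis on the normal decides the side only within [del] of the curve. The point at
     fraction [u0] of the segment from [g ts] to [x] is that close, and the rest of the segment
     carries the conclusion to [x]. *)
  set (u0 := Rmin 1 (del / (2 * Rabs h))).
  assert (Hu0 : 0 < u0 <= 1).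
  { split; [apply Rmin_pos; [lra | apply Rdiv_lt_0_compat; lra] | apply Rmin_l]. }
  assert (Hu0h : 0 < u0 * Rabs h < del).
  { split; [apply Rmult_lt_0_compat; lra|].
    assert (K : u0 <= del / (2 * Rabs h)) by apply Rmin_r.
    apply (Rmult_le_compat_r (Rabs h)) in K; [|lra].
    replace (del / (2 * Rabs h) * Rabs h) with (del / 2) in K by (field; lra). lra. }
  set (p := fun u => (g ts + RtoC (u * h) * rot (d ts))%C).
  assert (Hp1 : p 1 = x) by (unfold p; rewrite Hx, Rmult_1_l; reflexivity).
  assert (Hpc : forall t, Ccontinuous p t).
  { intros t. apply Ccontinuous_plus; [apply Ccontinuous_const|].
    apply Ccontinuous_mult; [|apply Ccontinuous_const]. apply Ccontinuous_RtoC.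
    apply (continuous_mult (K := R_AbsRing)); [apply continuous_id | apply continuous_const]. }
  assert (Hpb : forall u, u0 <= u <= 1 -> ~ boundary Omega (p u)).
  { intros u Hu Hb. apply Hbd in Hb. destruct Hb as [s Es]. specialize (Hmin s).
    rewrite <- Es in Hmin. rewrite Hx in Hmin. unfold p in Hmin.
    replace (g ts - (g ts + RtoC h * rot (d ts)))%C with (- (RtoC h * rot (d ts)))%C in Hmin by ring.
    replace (g ts + RtoC (u * h) * rot (d ts) - (g ts + RtoC h * rot (d ts)))%C with
      (RtoC (u - 1) * (RtoC h * rot (d ts)))%C in Hmin by (rewrite RtoC_mult, RtoC_minus; ring).
    rewrite Cmod_opp, (Cmod_mult (RtoC (u - 1))), Cmod_R in Hmin.
    assert (Hrot : 0 < Cmod (RtoC h * rot (d ts))).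
    { rewrite Cmod_mult, Cmod_R, Cmod_rot. apply Rmult_lt_0_compat; [exact Hhp|].
      apply Cmod_gt_0, Hreg. }
    rewrite Rabs_left1 in Hmin by lra. nra. }
  assert (Hpu : p u0 = (g ts + RtoC (sg * h * u0) * scaled_normal ts)%C).
  { unfold p. rewrite E, !RtoC_mult.
    assert (S2 : (RtoC sg * RtoC sg)%C = RtoC 1).
    { rewrite <- RtoC_mult. f_equal. destruct Hsg as [-> | ->]; ring. }
    replace (RtoC sg * RtoC h * RtoC u0 * (RtoC sg * rot (d ts)))%C with
      (RtoC sg * RtoC sg * (RtoC u0 * RtoC h * rot (d ts)))%C by ring.
    rewrite S2. ring. }
  assert (Habs : Rabs h = sg * h \/ Rabs h = - (sg * h)).
  { destruct Hsg as [-> | ->]; unfold Rabs; destruct (Rcase_abs h); lra. }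
  split; intros Hside0.
  - apply Rnot_le_lt. intros Hle.
    assert (Habs' : Rabs h = sg * h) by lra.
    destruct (Hside _ Hu0h) as [_ A].
    apply not_closure_not_in in A. apply A.
    replace (u0 * Rabs h) with (sg * h * u0) by (rewrite Habs'; ring). rewrite <- Hpu.
    apply (path_same_side Omega p 1 u0 HO Hpc); [|rewrite Hp1; exact Hside0].
    rewrite Rmin_right, Rmax_left by lra. exact Hpb.
  - apply Rnot_le_lt. intros Hle.
    assert (Habs' : Rabs h = - (sg * h)) by lra.
    destruct (Hside _ Hu0h) as [A _].
    apply (not_closure_not_in _ _ Hside0). rewrite <- Hp1.
    apply (path_same_side Omega p u0 1 HO Hpc).
    + rewrite Rmin_left, Rmax_right by lra. exact Hpb.
    + rewrite Hpu. replace (sg * h * u0) with (- (u0 * Rabs h)) by (rewrite Habs'; ring).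
      rewrite RtoC_opp.
      replace (g ts + - RtoC (u0 * Rabs h) * scaled_normal ts)%C with
        (g ts - RtoC (u0 * Rabs h) * scaled_normal ts)%C by ring. exact A.
Qed.

End Sides.

(** * The double layer potential *)

Lemma is_CInt_modify (f f' : R -> C) (a b c : R) (l : C) :
  a <= c <= b -> (forall t, a < t < b -> t <> c -> f t = f' t) ->
  is_CInt f a b l -> is_CInt f' a b l.
Proof.
  intros Hc Hff Hl.
  assert (Hex : ex_CInt f a b) by (exists l; exact Hl).
  assert (E1 : ex_CInt f a c) by (apply (ex_RInt_Chasles_1 (V := CCV)) with b; [lra | exact Hex]).
  assert (E2 : ex_CInt f c b) by (apply (ex_RInt_Chasles_2 (V := CCV)) with a; [lra | exact Hex]).
  apply CInt_correct in E1. apply CInt_correct in E2.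
  assert (El := is_CInt_unique _ _ _ _ Hl).
  rewrite (is_CInt_unique _ _ _ _ (is_CInt_Chasles _ _ _ _ _ _ E1 E2)) in El.
  rewrite <- El. apply is_CInt_Chasles with c.
  - apply is_CInt_ext with (3 := E1); [lra|]. intros t Ht. apply Hff; lra.
  - apply is_CInt_ext with (3 := E2); [lra|]. intros t Ht. apply Hff; lra.
Qed.

Lemma ex_CInt_sub (f : R -> C) (a b c d : R) :
  a <= c -> c <= d -> d <= b -> ex_CInt f a b -> ex_CInt f c d.
Proof.
  intros H1 H2 H3 H.
  apply (ex_RInt_Chasles_1 (V := CCV)) with b; [lra|].
  apply (ex_RInt_Chasles_2 (V := CCV)) with a; [lra | exact H].
Qed.

Lemma Ccontinuous_dot {U : UniformSpace} (f h : U -> C) (p : U) :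
  Ccontinuous f p -> Ccontinuous h p -> Ccontinuous (fun q => RtoC (dot (f q) (h q))) p.
Proof.
  intros [F1 F2] [H1 H2]. apply Ccontinuous_RtoC.
  apply (continuous_plus (V := RV)); apply (continuous_mult (K := R_AbsRing)); assumption.
Qed.

Section Potential.
Variables (k0 : R) (eps1 eps2 : C) (Omega : R2 -> Prop) (g d dd : R -> C) (T : R)
  (nu : R2 -> R2) (phi : R2 -> C).
Hypothesis Hk0 : 0 < k0.
Hypothesis Hre : Re eps1 * Re eps2 < 0.
Hypothesis Him1 : 0 < Im eps1.
Hypothesis Him2 : 0 < Im eps2.
Hypothesis HO : open Omega.
Hypothesis HT : 0 < T.
Hypothesis Hper : forall t, g (t + T) = g t.
Hypothesis Hinj : forall s t, 0 <= s < T -> 0 <= t < T -> g s = g t -> s = t.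
Hypothesis Hg : forall t, is_Cderive g t (d t).
Hypothesis Hd : forall t, is_Cderive d t (dd t).
Hypothesis Hdd : forall t, Ccontinuous dd t.
Hypothesis Hreg : forall t, d t <> 0.
Hypothesis Hbd : forall x, boundary Omega x <-> exists t, x = g t.
Hypothesis Hnu : forall t, Cmod (nu (g t)) = 1 /\ dot (nu (g t)) (d t) = 0 /\
  exists del, 0 < del /\ forall h, 0 < h < del ->
    Omega (shift (g t) (- h) (nu (g t))) /\ ~ closure Omega (shift (g t) h (nu (g t))).
Hypothesis Hpsi : forall t, Ccontinuous (fun u => phi (g u)) t.

Definition integrand (x : R2) (t : R) : C :=
  (dlp_integrand k0 eps1 eps2 nu phi x (g t) * RtoC (Cmod (d t)))%C.

Definition smooth_integrand (x : C) (t : R) : C :=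
  (RtoC (dot (g t - x)%C (scaled_normal g d nu t)) * kernel k0 eps1 eps2 (g t - x)%C *
   phi (g t))%C.

Definition potential (x : R2) : C := CInt (integrand x) 0 T.

Lemma integrand_eq (x : C) (t : R) : g t <> x -> integrand x t = smooth_integrand x t.
Proof.
  intros H. unfold integrand, dlp_integrand, smooth_integrand.
  rewrite dPhi_conormal_kernel by (try assumption; intros E; apply H; symmetry; exact E).
  replace (dot (g t - x)%C (scaled_normal g d nu t)) with
    (Cmod (d t) * dot (g t - x)%C (nu (g t))) by (unfold dot, scaled_normal; simpl; ring).
  rewrite RtoC_mult. ring.
Qed.

Lemma smooth_integrand_cross (x : C) (t sg : R) :
  scaled_normal g d nu t = (RtoC sg * rot (d t))%C ->
  smooth_integrand x t = (RtoC sg * cross_kernel k0 eps1 eps2 g d (fun u => phi (g u)) x t)%C.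
Proof.
  intros E. unfold smooth_integrand, cross_kernel. rewrite E.
  replace (dot (g t - x)%C (RtoC sg * rot (d t))%C) with (sg * cross (g t - x)%C (d t))
    by (unfold dot, cross, rot; simpl; ring).
  rewrite RtoC_mult. ring.
Qed.

(** A general parameter space covers both uses: [x] fixed, for integrability, and joint continuity
    in the pair, for uniform convergence away from the singularity. *)
Lemma smooth_integrand_continuous {U : UniformSpace} (fx : U -> C) (ft : U -> R) (p : U) :
  Ccontinuous fx p -> continuous ft p -> g (ft p) <> fx p ->
  Ccontinuous (fun q => smooth_integrand (fx q) (ft q)) p.
Proof.
  intros Hx Ht Hne.
  assert (Hgt : Ccontinuous (fun q => g (ft q)) p).
  { apply (Ccontinuous_comp ft g); [exact Ht | apply (is_Cderive_continuous _ _ _ (Hg _))]. }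
  assert (Hv : Ccontinuous (fun q => g (ft q) - fx q)%C p) by (apply Ccontinuous_minus; assumption).
  unfold smooth_integrand. apply Ccontinuous_mult; [apply Ccontinuous_mult|].
  - apply Ccontinuous_dot; [exact Hv|].
    apply (Ccontinuous_comp ft (scaled_normal g d nu)); [exact Ht|].
    apply (scaled_normal_continuous Omega g d dd T nu); assumption.
  - apply (Ccontinuous_comp_C (fun q => g (ft q) - fx q)%C (kernel k0 eps1 eps2)); [exact Hv|].
    apply Ccontinuous_kernel; try assumption. apply Cminus_neq, Hne.
  - apply (Ccontinuous_comp ft (fun u => phi (g u))); [exact Ht | apply Hpsi].
Qed.

Lemma off_boundary (x : C) (t : R) : ~ boundary Omega x -> g t <> x.
Proof. intros H E. apply H, Hbd. exists t. symmetry. exact E. Qed.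

Lemma integrable_off_boundary (x : C) (a b : R) :
  a <= b -> (forall t, a <= t <= b -> g t <> x) -> ex_CInt (integrand x) a b.
Proof.
  intros Hab H. apply (ex_RInt_ext (V := CV) (smooth_integrand x)).
  - rewrite Rmin_left, Rmax_right by exact Hab. intros t Ht. symmetry.
    apply integrand_eq, H. lra.
  - apply ex_CInt_continuous; [exact Hab|]. intros t Ht.
    apply (smooth_integrand_continuous (fun _ => x) (fun t => t)).
    + apply Ccontinuous_const.
    + apply continuous_id.
    + apply H, Ht.
Qed.

Lemma window_injective (t0 t : R) :
  t0 - T / 2 <= t <= t0 + T / 2 -> t <> t0 -> g t <> g t0.
Proof.
  intros Ht Hne E. apply Hne. apply (curve_injective g T HT Hper Hinj); [|exact E].
  apply Rabs_def1; lra.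
Qed.

Lemma integrand_extension (t0 : R) :
  exists f, Ccontinuous f t0 /\ exists eta, 0 < eta /\ forall t, Rabs (t - t0) <= eta ->
    t <> t0 -> integrand (g t0) t = f t.
Proof.
  destruct (scaled_normal_locally Omega g d dd T nu HO HT Hper Hinj Hg Hd Hdd Hreg Hbd Hnu t0)
    as [sg [eta [_ [Heta Hn]]]].
  destruct (cross_kernel_extension k0 eps1 eps2 g d dd (fun u => phi (g u)) Hk0 Him1 Him2
              Hg Hd Hdd Hreg Hpsi t0) as [f [Hf Hfe]].
  exists (fun t => RtoC sg * f t)%C. split.
  - apply Ccontinuous_mult; [apply Ccontinuous_const | exact Hf].
  - exists (Rmin eta (T / 2)). split; [apply Rmin_pos; lra|].
    intros t Ht Hne.
    destruct (le_Rmin _ _ _ Ht) as [T1 T2].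
    apply Rabs_le_between in T2.
    assert (Hgt := window_injective t0 t ltac:(lra) Hne).
    rewrite integrand_eq by exact Hgt.
    rewrite (smooth_integrand_cross _ _ sg) by (apply Hn, T1).
    rewrite Hfe by assumption. reflexivity.
Qed.

Lemma integrable_on_boundary (t0 : R) :
  ex_CInt (integrand (g t0)) (t0 - T / 2) (t0 + T / 2).
Proof.
  destruct (integrand_extension t0) as [f [Hf [eta [Heta Hfe]]]].
  apply ex_CInt_punctured with
    (h := fun t => if Req_EM_T t t0 then f t0 else smooth_integrand (g t0) t) (c := t0).
  - lra.
  - intros t Ht. destruct (Req_dec t t0) as [->|Hne].
    + apply Ccontinuous_ext_loc with (2 := Hf).
      assert (Hm : 0 < Rmin eta (T / 2)) by (apply Rmin_pos; lra).
      exists (mkposreal _ Hm). intros u Hu. change (Rabs (u - t0) < Rmin eta (T / 2)) in Hu.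
      destruct (Req_EM_T u t0) as [->|Hu0]; [reflexivity|].
      destruct (lt_Rmin _ _ _ Hu) as [U1 U2].
      apply Rabs_lt_between in U2.
      rewrite <- Hfe by (lra || assumption). apply integrand_eq.
      apply window_injective; [lra | exact Hu0].
    + apply Ccontinuous_ext_loc with (smooth_integrand (g t0)).
      * assert (Hp : 0 < Rabs (t - t0)) by (apply Rabs_pos_lt; lra).
        exists (mkposreal _ Hp). intros u Hu. change (Rabs (u - t) < Rabs (t - t0)) in Hu.
        destruct (Req_EM_T u t0) as [->|_]; [|reflexivity].
        rewrite Rabs_minus_sym in Hu. lra.
      * apply (smooth_integrand_continuous (fun _ => g t0) (fun t => t)).
        -- apply Ccontinuous_const.
        -- apply continuous_id.
        -- apply window_injective; assumption.
  - intros t Ht Hne. destruct (Req_EM_T t t0) as [|_]; [contradiction|].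
    apply integrand_eq, window_injective; assumption.
Qed.

Lemma tangent_periodic (t : R) : d (t + T) = d t.
Proof.
  assert (H : is_Cderive g t (d (t + T))).
  { destruct (Hg (t + T)) as [G1 G2].
    assert (Hs : is_derive (fun u => u + T) t 1) by (auto_derive; [auto | ring]).
    assert (Q : forall (F : R -> R) m, (forall u, F (u + T) = F u) ->
              is_derive F (t + T) m -> is_derive F t m).
    { intros F m HF HFm. apply is_derive_ext with (fun u => F (u + T)); [exact HF|].
      evar_last; [exact (is_derive_comp (V := RV) F _ _ _ _ HFm Hs)|].
      unfold scal; simpl; unfold mult; simpl. ring. }
    split; (apply Q; [intros u; rewrite Hper; reflexivity | assumption]). }
  apply is_Cderive_unique in H. rewrite <- H. apply is_Cderive_unique, Hg.
Qed.

Lemma integrand_periodic (x : R2) (t : R) : integrand x (t + T) = integrand x t.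
Proof. unfold integrand. rewrite Hper, tangent_periodic. reflexivity. Qed.

(** The range of [t0] places the left end [t0 - T / 2] of the centred window in the first period, as
    [CInt_periodic] requires. *)
Lemma boundary_parameter (x : R2) :
  boundary Omega x -> exists t0, T / 2 <= t0 <= T + T / 2 /\ x = g t0.
Proof.
  intros H. apply Hbd in H. destruct H as [t ->].
  destruct (curve_window g T HT Hper (T / 2) t) as [s [Hs E]].
  exists s. split; [lra | symmetry; exact E].
Qed.

Lemma potential_window (x : R2) (t0 : R) :
  T / 2 <= t0 <= T + T / 2 -> ex_CInt (integrand x) (t0 - T / 2) (t0 + T / 2) ->
  is_CInt (integrand x) 0 T (CInt (integrand x) (t0 - T / 2) (t0 + T / 2)).
Proof.
  intros Ht Hex. replace (t0 + T / 2) with (t0 - T / 2 + T) in * by field.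
  apply CInt_periodic; [apply integrand_periodic | lra | exact Hex].
Qed.

Lemma integrable (x : R2) : ex_CInt (integrand x) 0 T.
Proof.
  destruct (classic (boundary Omega x)) as [Hx|Hx].
  - destruct (boundary_parameter x Hx) as [t0 [Ht0 ->]].
    eexists. apply (potential_window _ t0 Ht0), integrable_on_boundary.
  - apply (integrable_off_boundary x); [lra|]. intros t _. apply off_boundary, Hx.
Qed.

Lemma smooth_integrand_uniform (x0 : C) (a b : R) :
  (forall t, a <= t <= b -> g t <> x0) ->
  forall e, 0 < e -> exists del, 0 < del /\ forall x t, Cmod (x - x0) < del -> a <= t <= b ->
    Cmod (smooth_integrand x t - smooth_integrand x0 t) <= e.
Proof.
  intros H. apply (continuous_uniform_on_interval smooth_integrand x0 a b).
  intros t Ht.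
  apply (smooth_integrand_continuous
    (U := prod_UniformSpace (prod_UniformSpace R_UniformSpace R_UniformSpace) R_UniformSpace)
    (fun p => fst p) (fun p => snd p)).
  - apply Ccontinuous_iff. apply (continuous_fst (U := prod_UniformSpace R_UniformSpace R_UniformSpace)).
  - apply (continuous_snd (U := prod_UniformSpace R_UniformSpace R_UniformSpace)).
  - apply H, Ht.
Qed.

Lemma integral_close (x x0 : C) (a b e : R) (l l0 : C) :
  a <= b -> (forall t, a <= t <= b -> g t <> x) -> (forall t, a <= t <= b -> g t <> x0) ->
  (forall t, a <= t <= b -> Cmod (smooth_integrand x t - smooth_integrand x0 t) <= e) ->
  is_CInt (integrand x) a b l -> is_CInt (integrand x0) a b l0 ->
  Cmod (l - l0) <= e * (b - a).
Proof.
  intros Hab Hx Hx0 H Hl Hl0.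
  apply (Cmod_is_CInt_le_const _ a b _ e Hab) with (2 := is_CInt_minus _ _ _ _ _ _ Hl Hl0).
  intros t Ht. rewrite !integrand_eq by auto. apply H, Ht.
Qed.

Lemma potential_continuous_off_boundary (x0 : C) :
  ~ boundary Omega x0 -> forall e, 0 < e -> exists del, 0 < del /\
  forall x, Cmod (x - x0) < del ->
    ~ boundary Omega x /\ Cmod (potential x - potential x0) <= e.
Proof.
  intros Hx0 e He.
  destruct (boundary_distance Omega g d T HT Hper Hg Hbd x0 Hx0) as [d1 [D1 H1]].
  assert (HeT : 0 < e / T) by (apply Rdiv_lt_0_compat; assumption).
  destruct (smooth_integrand_uniform x0 0 T (fun t _ => off_boundary x0 t Hx0) _ HeT) as [d2 [D2 H2]].
  exists (Rmin d1 d2). split; [apply Rmin_pos; assumption|].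
  intros x Hx.
  destruct (lt_Rmin _ _ _ Hx) as [X1 X2].
  assert (Hxb : ~ boundary Omega x).
  { intros Hb. apply Hbd in Hb. destruct Hb as [t E]. specialize (H1 t).
    rewrite <- E in H1. lra. }
  split; [exact Hxb|].
  replace e with (e / T * (T - 0)) by (field; lra).
  apply (integral_close x x0 0 T (e / T)); [lra| | | | apply CInt_correct, integrable | apply CInt_correct, integrable].
  - intros t _. apply off_boundary, Hxb.
  - intros t _. apply off_boundary, Hx0.
  - intros t Ht. apply H2; assumption.
Qed.

(** Four errors of a quarter each: the two far arcs, the short arc for [x] compared with the jump,
    and the short arc for [g t0], whose integrand is bounded. The arc length [eta] is fixed before
    [x] approaches, and [del] serves every direction of approach on both sides. *)
Lemma potential_jump (t0 : R) :
  T / 2 <= t0 <= T + T / 2 -> forall e, 0 < e -> exists del, 0 < del /\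
  forall x side, Cmod (x - g t0) < del ->
    side = 1 /\ ~ closure Omega x \/ side = -1 /\ Omega x ->
    Cmod (potential x - (potential (g t0) + RtoC (side / 2) * phi (g t0))) <= e.
Proof.
  intros Ht0 e He.
  destruct (scaled_normal_locally Omega g d dd T nu HO HT Hper Hinj Hg Hd Hdd Hreg Hbd Hnu t0)
    as [sg [eta1 [Hsg [Heta1 Hn]]]].
  destruct (near_jump k0 eps1 eps2 g d dd (fun u => phi (g u)) Hk0 Hre Him1 Him2
              Hg Hd Hdd Hreg Hpsi t0 (e / 4) ltac:(lra)) as [eta2 [Heta2 Hnear]].
  destruct (integrand_extension t0) as [f [Hf [eta3 [Heta3 Hfe]]]].
  destruct (Ccontinuous_R_Cmod _ _ 1 Hf Rlt_0_1) as [eta4 [Heta4 Hf4]].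
  set (M := Cmod (f t0) + 1). assert (HM : 1 <= M) by (pose proof (Cmod_ge_0 (f t0)); unfold M; lra).
  (* [T / 4] leaves room for the two far arcs within the period, and [e / (8 * M)] makes the
     integral of a function bounded by [M] over length [2 * eta] at most [e / 4]. *)
  set (eta := Rmin (Rmin (Rmin eta1 eta2) (Rmin eta3 eta4)) (Rmin (T / 4) (e / (8 * M)))).
  assert (Heta : 0 < eta).
  { assert (0 < e / (8 * M)) by (apply Rdiv_lt_0_compat; lra).
    unfold eta; repeat apply Rmin_pos; lra. }
  destruct (le_Rmin _ _ _ (Rle_refl eta)) as [L0 L56].
  destruct (le_Rmin _ _ _ L0) as [L12 L34]. destruct (le_Rmin _ _ _ L12) as [L1 L2].
  destruct (le_Rmin _ _ _ L34) as [L3 L4]. destruct (le_Rmin _ _ _ L56) as [L5 L6].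
  clearbody eta. clear L0 L12 L34 L56.
  destruct (Hnear eta (conj Heta L2)) as [dn [Hdn Hjump]].
  destruct (curve_separation g d T HT Hper Hinj Hg t0 eta Heta) as [ds [Hds Hsep]].
  assert (HeT : 0 < e / (2 * T)) by (apply Rdiv_lt_0_compat; lra).
  assert (Hfar1 : forall t, t0 - T / 2 <= t <= t0 - eta -> g t <> g t0)
    by (intros t Ht; apply window_injective; lra).
  assert (Hfar2 : forall t, t0 + eta <= t <= t0 + T / 2 -> g t <> g t0)
    by (intros t Ht; apply window_injective; lra).
  destruct (smooth_integrand_uniform _ _ _ Hfar1 _ HeT) as [da [Hda Ha]].
  destruct (smooth_integrand_uniform _ _ _ Hfar2 _ HeT) as [db [Hdb Hb]].
  exists (Rmin (Rmin dn (ds / 2)) (Rmin da db)). split; [repeat apply Rmin_pos; lra|].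
  intros x side Hx Hside.
  destruct (lt_Rmin _ _ _ Hx) as [X1 X2].
  destruct (lt_Rmin _ _ _ X1) as [X3 X4].
  destruct (lt_Rmin _ _ _ X2) as [X5 X6].
  assert (Hxb : ~ boundary Omega x).
  { destruct Hside as [[_ Hs]|[_ Hs]].
    - intros [Hc _]. exact (Hs Hc).
    - apply open_not_boundary; assumption. }
  destruct (nearest_point g d T HT Hper Hg x (t0 - T / 2)) as [ts [Hts Hmin]].
  (* The nearest point is no farther from [x] than [g t0] is, hence within twice that distance of
     [g t0]; this explains [ds / 2]. *)
  assert (Htse : Rabs (ts - t0) < eta).
  { apply Hsep; [lra|].
    replace (g ts - g t0)%C with ((g ts - x) + (x - g t0))%C by ring.
    Cmod_triangle_lt. specialize (Hmin t0).
    rewrite (Cmod_minus_sym (g t0)) in Hmin. lra. }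
  destruct (nearest_point_normal Omega g d Hg Hreg Hbd x ts Hxb Hmin) as [h [Hh Ex]].
  destruct (side_of_normal Omega g d nu HO Hreg Hbd Hnu x ts h sg Hmin Hh Ex Hsg (Hn ts ltac:(lra)))
    as [Sin Sout].
  (* [sh] is the side relative to the rotated tangent and [sg] compares the latter with the outward
     normal; their product is the true side. *)
  assert (Hhs : exists sh, (sh = 1 \/ sh = -1) /\ 0 < sh * h /\ side = sg * sh).
  { destruct (Rlt_or_le 0 h) as [Hp|Hp].
    - exists 1. split; [lra|]. split; [lra|].
      destruct Hside as [[-> Hs]|[-> Hs]]; [specialize (Sout Hs) | specialize (Sin Hs)];
        destruct Hsg as [-> | ->]; lra.
    - exists (-1). split; [lra|]. split; [lra|].
      destruct Hside as [[-> Hs]|[-> Hs]]; [specialize (Sout Hs) | specialize (Sin Hs)];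
        destruct Hsg as [-> | ->]; lra. }
  destruct Hhs as [sh [Hsh [Hshh Hsd]]].
  assert (Hxt : forall t, g t <> x) by (intros t; apply off_boundary, Hxb).
  assert (Wx : ex_CInt (integrand x) (t0 - T / 2) (t0 + T / 2))
    by (apply integrable_off_boundary; [lra | intros t _; apply Hxt]).
  assert (W0 := integrable_on_boundary t0).
  assert (Split : forall y, ex_CInt (integrand y) (t0 - T / 2) (t0 + T / 2) ->
    exists A J B, is_CInt (integrand y) (t0 - T / 2) (t0 - eta) A /\
      is_CInt (integrand y) (t0 - eta) (t0 + eta) J /\
      is_CInt (integrand y) (t0 + eta) (t0 + T / 2) B /\ potential y = (A + J + B)%C).
  { intros y Hy.
    assert (EA := CInt_correct _ _ _ (ex_CInt_sub _ (t0 - T / 2) (t0 + T / 2) (t0 - T / 2) (t0 - eta) ltac:(lra) ltac:(lra) ltac:(lra) Hy)).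
    assert (EJ := CInt_correct _ _ _ (ex_CInt_sub _ (t0 - T / 2) (t0 + T / 2) (t0 - eta) (t0 + eta) ltac:(lra) ltac:(lra) ltac:(lra) Hy)).
    assert (EB := CInt_correct _ _ _ (ex_CInt_sub _ (t0 - T / 2) (t0 + T / 2) (t0 + eta) (t0 + T / 2) ltac:(lra) ltac:(lra) ltac:(lra) Hy)).
    do 3 eexists. split; [exact EA|]. split; [exact EJ|]. split; [exact EB|].
    unfold potential. rewrite (is_CInt_unique _ _ _ _ (potential_window y t0 Ht0 Hy)).
    apply is_CInt_unique.
    exact (is_CInt_Chasles _ _ _ _ _ _ (is_CInt_Chasles _ _ _ _ _ _ EA EJ) EB). }
  destruct (Split x Wx) as [A [J [B [HA [HJ [HB EW]]]]]].
  destruct (Split (g t0) W0) as [A0 [J0 [B0 [HA0 [HJ0 [HB0 EW0]]]]]].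
  assert (Far : forall a b l l0, a <= b -> b - a <= T / 2 ->
    (forall t, a <= t <= b -> g t <> g t0) ->
    (forall t, a <= t <= b ->
       Cmod (smooth_integrand x t - smooth_integrand (g t0) t) <= e / (2 * T)) ->
    is_CInt (integrand x) a b l -> is_CInt (integrand (g t0)) a b l0 -> Cmod (l - l0) <= e / 4).
  { intros a b l l0 Hab Hlen Hne Hcl Hl Hl0. apply Rle_trans with (e / (2 * T) * (b - a)).
    - apply (integral_close x (g t0) a b); try assumption. intros t _; apply Hxt.
    - apply Rle_trans with (e / (2 * T) * (T / 2)).
      + apply Rmult_le_compat_l; lra.
      + right. field. lra. }
  assert (BA := Far (t0 - T / 2) (t0 - eta) _ _ ltac:(lra) ltac:(lra) Hfar1 (fun t => Ha x t X5) HA HA0).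
  assert (BB := Far (t0 + eta) (t0 + T / 2) _ _ ltac:(lra) ltac:(lra) Hfar2 (fun t => Hb x t X6) HB HB0).
  assert (BJ0 : Cmod J0 <= e / 4).
  { apply Rle_trans with (M * (t0 + eta - (t0 - eta))).
    (* The uncontrolled value at [t0] is replaced by [0] so that the bound holds at every point of
       the interval. *)
    - apply (Cmod_is_CInt_le_const (fun t => if Req_EM_T t t0 then RtoC 0 else integrand (g t0) t)
               (t0 - eta) (t0 + eta)).
      + lra.
      + intros t Ht. destruct (Req_EM_T t t0) as [|Hne]; [rewrite Cmod_0; lra|].
        assert (Hr : Rabs (t - t0) <= eta) by (apply Rabs_le; lra).
        rewrite Hfe by (lra || assumption).
        replace (f t) with (f t - f t0 + f t0)%C by ring.
        Cmod_triangle_le. specialize (Hf4 t ltac:(lra)). unfold M. lra.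
      + apply is_CInt_modify with (c := t0) (3 := HJ0); [lra|].
        intros t _ Hne. destruct (Req_EM_T t t0); [contradiction | reflexivity].
    - apply (Rmult_le_compat_l (2 * M)) in L6; [|lra].
      replace (2 * M * (e / (8 * M))) with (e / 4) in L6 by (field; lra). lra. }
  assert (Hsg2 : (RtoC sg * RtoC sg)%C = RtoC 1).
  { rewrite <- RtoC_mult. f_equal. destruct Hsg as [-> | ->]; ring. }
  assert (BJ : Cmod (J - RtoC (side / 2) * phi (g t0)) <= e / 4).
  { assert (HJc : is_CInt (cross_kernel k0 eps1 eps2 g d (fun u => phi (g u)) x)
                    (t0 - eta) (t0 + eta) (RtoC sg * J)%C).
    { apply is_CInt_ext with (3 := is_CInt_scal (RtoC sg) _ _ _ _ HJ); [lra|].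
      intros t Ht. rewrite integrand_eq by apply Hxt.
      rewrite (smooth_integrand_cross _ _ sg) by (apply Hn; apply Rabs_le; lra).
      rewrite Cmult_assoc, Hsg2. ring. }
    assert (K := Hjump ts h sh x _ ltac:(lra) Hsh Hshh Ex X3 (fun t _ => Hmin t) HJc).
    replace (J - RtoC (side / 2) * phi (g t0))%C with
      (RtoC sg * (RtoC sg * J - RtoC (sh / 2) * phi (g t0)))%C.
    - rewrite Cmod_mult, Cmod_R.
      replace (Rabs sg) with 1; [lra|].
      destruct Hsg as [-> | ->]; [rewrite Rabs_R1 | rewrite Rabs_left]; lra.
    - rewrite Hsd. replace (sg * sh / 2) with (sg * (sh / 2)) by field. rewrite RtoC_mult.
      transitivity (RtoC sg * RtoC sg * J - RtoC sg * RtoC (sh / 2) * phi (g t0))%C; [ring|].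
      rewrite Hsg2. ring. }
  rewrite EW, EW0.
  replace (A + J + B - (A0 + J0 + B0 + RtoC (side / 2) * phi (g t0)))%C with
    ((A - A0) + (B - B0) + (- J0 + (J - RtoC (side / 2) * phi (g t0))))%C by ring.
  Cmod_triangle_le.
  eapply Rle_trans; [apply Rplus_le_compat; apply Cmod_triangle|].
  rewrite Cmod_opp. lra.
Qed.

(* [side] is [1] outside and [-1] inside. *)
Definition side_limit (side : R) (x : R2) : C :=
  if excluded_middle_informative (boundary Omega x)
  then (potential x + RtoC (side / 2) * phi x)%C else potential x.

Definition side_set (side : R) (x : R2) : Prop :=
  side = 1 /\ ~ closure Omega x \/ side = -1 /\ Omega x.

Lemma side_limit_boundary (side : R) (x : R2) :
  boundary Omega x -> side_limit side x = (potential x + RtoC (side / 2) * phi x)%C.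
Proof. intros H. unfold side_limit. destruct (excluded_middle_informative _); tauto. Qed.

Lemma side_limit_off_boundary (side : R) (x : R2) :
  ~ boundary Omega x -> side_limit side x = potential x.
Proof. intros H. unfold side_limit. destruct (excluded_middle_informative _); tauto. Qed.

Lemma potential_jump_at (x0 : R2) :
  boundary Omega x0 -> forall side e, 0 < e -> exists del, 0 < del /\
  forall x : C, Cmod (x - x0) < del -> side_set side x ->
    Cmod (potential x - side_limit side x0) <= e.
Proof.
  intros Hx0 side e He. rewrite side_limit_boundary by exact Hx0.
  destruct (boundary_parameter x0 Hx0) as [t0 [Ht0 ->]].
  destruct (potential_jump t0 Ht0 e He) as [del [Hdel H]].
  exists del. split; [exact Hdel|]. intros x Hx Hs. apply H; assumption.
Qed.

Lemma normal_in_side (x0 : R2) (side : R) :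
  boundary Omega x0 -> side = 1 \/ side = -1 ->
  exists del, 0 < del /\ forall h, 0 < h < del ->
    side_set side (shift x0 (side * h) (nu x0)) /\
    Cmod (shift x0 (side * h) (nu x0) - x0)%C = h.
Proof.
  intros Hx0 Hside. apply Hbd in Hx0. destruct Hx0 as [t ->].
  destruct (Hnu t) as [H1 [_ [del [Hdel H]]]].
  exists del. split; [exact Hdel|]. intros h Hh. destruct (H h Hh) as [Hin Hout]. split.
  - destruct Hside as [-> | ->].
    + left. split; [reflexivity|]. rewrite Rmult_1_l. exact Hout.
    + right. split; [reflexivity|]. replace (-1 * h) with (- h) by ring. exact Hin.
  - rewrite shift_eq.
    replace (g t + RtoC (side * h) * nu (g t) - g t)%C with (RtoC (side * h) * nu (g t))%C by ring.
    rewrite Cmod_mult, H1, Cmod_R, Rmult_1_r, Rabs_mult, (Rabs_pos_eq h) by lra.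
    destruct Hside as [-> | ->]; [rewrite Rabs_R1 | rewrite Rabs_left]; lra.
Qed.

Lemma side_limit_normal (x0 : R2) (side : R) :
  boundary Omega x0 -> side = 1 \/ side = -1 ->
  filterlim (fun h => potential (shift x0 (side * h) (nu x0))) (at_right 0)
    (locally (side_limit side x0)).
Proof.
  intros Hx0 Hside P HP. apply locally_Cmod in HP. destruct HP as [e [He HP]].
  destruct (potential_jump_at x0 Hx0 side (e / 2) ltac:(lra)) as [d1 [D1 H1]].
  destruct (normal_in_side x0 side Hx0 Hside) as [d2 [D2 H2]].
  assert (Hm : 0 < Rmin d1 d2) by (apply Rmin_pos; assumption).
  exists (mkposreal _ Hm). intros h Hh Hpos. change (Rabs (h - 0) < Rmin d1 d2) in Hh.
  rewrite Rminus_0_r, Rabs_pos_eq in Hh by lra.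
  pose proof (Rmin_l d1 d2). pose proof (Rmin_r d1 d2).
  destruct (H2 h ltac:(lra)) as [Hs Hn].
  apply HP. specialize (H1 _ ltac:(rewrite Hn; lra) Hs). lra.
Qed.

(** The delicate case is a boundary point [x] near a boundary point [x0]. A point [y] on the normal
    at [x], taken close enough, has [potential y] near the one-sided limits at both, so those limits
    are close to each other; the values on the curve need no study of their own. *)
Lemma side_limit_continuous (side : R) (D : R2 -> Prop) :
  side = 1 \/ side = -1 ->
  (forall x, D x -> ~ boundary Omega x -> side_set side x) ->
  continuous_on D (side_limit side).
Proof.
  intros Hside HD x0 Hx0 P HP. apply locally_Cmod in HP. destruct HP as [e [He HP]].
  unfold filtermap, within.
  destruct (classic (boundary Omega x0)) as [Hb0|Hb0].
  - destruct (potential_jump_at x0 Hb0 side (e / 4) ltac:(lra)) as [d1 [D1 H1]].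
    apply (locally_Cmod x0). exists d1. split; [exact D1|].
    intros x Hx HxD. apply HP.
    destruct (classic (boundary Omega x)) as [Hb|Hb].
    + destruct (potential_jump_at x Hb side (e / 4) ltac:(lra)) as [d2 [D2 H2]].
      destruct (normal_in_side x side Hb Hside) as [d3 [D3 H3]].
      (* [y] must be close to [x] in a way depending on [x], on the right side of the curve, and
         still in the disc around [x0]. *)
      set (h := Rmin (Rmin d2 d3) (d1 - Cmod (x - x0)) / 2).
      assert (Hh : 0 < h /\ h < d2 /\ h < d3 /\ h < d1 - Cmod (x - x0)).
      { assert (0 < Rmin (Rmin d2 d3) (d1 - Cmod (x - x0))) by (repeat apply Rmin_pos; lra).
        pose proof (Rmin_l (Rmin d2 d3) (d1 - Cmod (x - x0))).
        pose proof (Rmin_r (Rmin d2 d3) (d1 - Cmod (x - x0))).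
        pose proof (Rmin_l d2 d3). pose proof (Rmin_r d2 d3). unfold h. lra. }
      destruct (H3 h ltac:(lra)) as [Hs Hn].
      set (y := shift x (side * h) (nu x) : C) in *.
      assert (Hy0 : Cmod (y - x0) < d1).
      { replace (y - x0)%C with ((y - x) + (x - x0))%C by ring.
        Cmod_triangle_lt. change (Cmod (y - x) = h) in Hn. lra. }
      assert (B1 := H1 y Hy0 Hs).
      assert (B2 := H2 y ltac:(change (Cmod (y - x) = h) in Hn; lra) Hs).
      replace (side_limit side x - side_limit side x0)%C with
        (- (potential y - side_limit side x) + (potential y - side_limit side x0))%C by ring.
      Cmod_triangle_lt. rewrite Cmod_opp. lra.
    + rewrite (side_limit_off_boundary side x Hb).
      specialize (H1 x Hx (HD x HxD Hb)). lra.
  - destruct (potential_continuous_off_boundary x0 Hb0 (e / 2) ltac:(lra)) as [d1 [D1 H1]].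
    apply (locally_Cmod x0). exists d1. split; [exact D1|].
    intros x Hx _. apply HP. destruct (H1 x Hx) as [Hb Hc].
    rewrite !side_limit_off_boundary by assumption. lra.
Qed.

End Potential.

Lemma is_Cderive_tangent (gamma : R -> R2) (t : R) :
  ex_derive (fun s => fst (gamma s)) t -> ex_derive (fun s => snd (gamma s)) t ->
  is_Cderive gamma t (tangent gamma t).
Proof. intros H1 H2. split; apply Derive_correct; assumption. Qed.

Lemma continuous_on_curve (D : R2 -> Prop) (phi : R2 -> C) (g : R -> C) (t : R) :
  continuous_on D phi -> (forall s, D (g s)) -> Ccontinuous g t ->
  Ccontinuous (fun s => phi (g s)) t.
Proof.
  intros Hphi HD Hg. apply Ccontinuous_iff. intros P HP.
  apply Ccontinuous_iff in Hg. specialize (Hg _ (Hphi (g t) (HD t) P HP)).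
  revert Hg. unfold filtermap. apply filter_imp. intros s Hs. exact (Hs (HD s)).
Qed.

Theorem lemma2p1
  (k0 : R) (eps1 eps2 : C)
  (Omega : R2 -> Prop) (gamma : R -> R2) (T : R) (nu : R2 -> R2)
  (phi : R2 -> C)
  (Hk0 : 0 < k0)
  (Hre : Re eps1 * Re eps2 < 0)
  (Him1 : 0 < Im eps1) (Him2 : 0 < Im eps2)
  (Hdom : plane_domain Omega)
  (Hbdd : bounded_set Omega)
  (Hsc : simply_connected Omega)
  (Hcurve : C2_closed_curve (boundary Omega) gamma T)
  (Hnu : outward_unit_normal Omega gamma nu)
  (Hphi : continuous_on (boundary Omega) phi) :
  let w := dlp k0 eps1 eps2 gamma T nu phi in
  (forall x, arc_integrable gamma T (dlp_integrand k0 eps1 eps2 nu phi x)) /\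
  exists w_minus w_plus : R2 -> C,
    (forall x, Omega x -> w_minus x = w x) /\
    continuous_on (closure Omega) w_minus /\
    (forall x, ~ closure Omega x -> w_plus x = w x) /\
    continuous_on (compl Omega) w_plus /\
    (forall x, boundary Omega x ->
      w_plus x = (w x + RtoC (1 / 2) * phi x)%C /\
      w_minus x = (w x - RtoC (1 / 2) * phi x)%C /\
      filterlim (fun h => w (shift x h (nu x)))
        (at_right 0) (locally (w_plus x)) /\
      filterlim (fun h => w (shift x (- h) (nu x)))
        (at_right 0) (locally (w_minus x))).
Proof.
  intros w.
  destruct Hdom as [HO _].
  destruct Hcurve as [HT [Hper [Hinj [HC1 [HC2 [Hreg Hbd]]]]]].
  set (d := tangent gamma : R -> C).
  set (dd := (fun t => (Derive (Derive (fun s => fst (gamma s))) t,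
                        Derive (Derive (fun s => snd (gamma s))) t)) : R -> C).
  assert (Hg : forall t, is_Cderive gamma t (d t)).
  { intros t. apply is_Cderive_tangent; [apply HC1 | apply HC2]. }
  assert (Hd : forall t, is_Cderive d t (dd t)).
  { intros t. split; apply Derive_correct; [apply (HC1 t) | apply (HC2 t)]. }
  assert (Hdd : forall t, Ccontinuous dd t).
  { intros t. split; [apply (HC1 t) | apply (HC2 t)]. }
  assert (Hpsi : forall t, Ccontinuous (fun u => phi (gamma u)) t).
  { intros t. apply (continuous_on_curve (boundary Omega) phi gamma t Hphi).
    - intros s. apply Hbd. exists s. reflexivity.
    - apply (is_Cderive_continuous _ _ _ (Hg t)). }
  assert (Hside : forall side, side = 1 \/ side = -1 ->
    let L := side_limit k0 eps1 eps2 Omega gamma d T nu phi side in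
    (forall x, ~ boundary Omega x -> L x = w x) /\
    (forall x, boundary Omega x -> L x = (w x + RtoC (side / 2) * phi x)%C) /\
    (forall x, boundary Omega x ->
       filterlim (fun h => w (shift x (side * h) (nu x))) (at_right 0) (locally (L x))) /\
    (forall D : R2 -> Prop, (forall x, D x -> ~ boundary Omega x -> side_set Omega side x) ->
       continuous_on D L)).
  { intros side Hs L. split; [|split; [|split]].
    (* [w] and [potential] agree by conversion, since [norm2] and [Cmod] unfold to the same square
       root. *)
    - intros x Hx. apply (side_limit_off_boundary k0 eps1 eps2 Omega gamma d T nu phi side x Hx).
    - intros x Hx. apply (side_limit_boundary k0 eps1 eps2 Omega gamma d T nu phi side x Hx).
    - intros x Hx.
      apply (side_limit_normal k0 eps1 eps2 Omega gamma d dd T nu phi); assumption.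
    - intros D HD.
      apply (side_limit_continuous k0 eps1 eps2 Omega gamma d dd T nu phi); assumption. }
  destruct (Hside 1 ltac:(lra)) as [P1 [P2 [P3 P4]]].
  destruct (Hside (-1) ltac:(lra)) as [M1 [M2 [M3 M4]]].
  split.
  { intros x. apply (integrable k0 eps1 eps2 Omega gamma d dd T nu phi); assumption. }
  exists (side_limit k0 eps1 eps2 Omega gamma d T nu phi (-1)),
         (side_limit k0 eps1 eps2 Omega gamma d T nu phi 1).
  split; [|split; [|split; [|split]]].
  - intros x Hx. apply M1, open_not_boundary; assumption.
  - apply M4. intros x Hx Hb. right. split; [reflexivity|].
    destruct (boundary_or_sides Omega x Hb); tauto.
  - intros x Hx. apply P1. intros [Hc _]. exact (Hx Hc).
  - apply P4. intros x Hx Hb. left. split; [reflexivity|].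
    destruct (boundary_or_sides Omega x Hb); [contradiction | assumption].
  - intros x Hx. split; [apply P2, Hx|]. split; [|split].
    + rewrite M2 by exact Hx. replace (-1 / 2) with (- (1 / 2)) by field.
      rewrite RtoC_opp. ring.
    + eapply filterlim_ext; [|exact (P3 x Hx)]. intros h. cbv beta. rewrite Rmult_1_l. reflexivity.
    + eapply filterlim_ext; [|exact (M3 x Hx)]. intros h. cbv beta.
      replace (-1 * h) with (- h) by ring. reflexivity.
Qed.
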